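(* In the continuous-weight model, let $\bar{\boldsymbol\theta}^*=\bar{\boldsymbol\theta}^*_n$ satisfy $q_n\le\bar\alpha_i^*+\bar\beta_j^*\le Q_n$ for all $i\ne j$ with $0<q_n\le Q_n$, and let $A\sim\mathbb{P}_{\bar{\boldsymbol\theta}^*}$. If $Q_n/q_n=o\bigl(n^{1/50}/(\log n)^{1/25}\bigr)$, then for every fixed $k\ge1$, as $n\to\infty$, the vector of the first $k$ coordinates of $\hat{\boldsymbol\theta}-\bar{\boldsymbol\theta}^*$ is asymptotically multivariate normal with mean zero and covariance matrix equal to the upper-left $k\times k$ block $S_{[k]}$ of $S$; i.e. $S_{[k]}^{-1/2}(\hat{\boldsymbol\theta}-\bar{\boldsymbol\theta}^* )_{1:k}\to N(0,I_k)$ in distribution.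
   Context: Continuous-weight model: parameters $\bar{\boldsymbol\theta}=(\bar\alpha_1,\dots,\bar\alpha_n,\bar\beta_1,\dots,\bar\beta_{n-1})^\top$, $\bar\beta_n:=0$, $\bar\alpha_i+\bar\beta_j>0$ for $i\ne j$. Under $\mathbb{P}_{\bar{\boldsymbol\theta}}$, $A=(a_{i,j})$ has $a_{i,i}=0$ and independent entries $a_{i,j}$ ($i\ne j$) with density $(\bar\alpha_i+\bar\beta_j)e^{-(\bar\alpha_i+\bar\beta_j)a}$, $a\ge0$. $d_i=\sum_{j\ne i}a_{i,j}$, $b_j=\sum_{i\ne j}a_{i,j}$. The MLE $\hat{\boldsymbol\theta}$ (with $\hat\beta_n=0$) solves $d_i=\sum_{k\ne i}(\hat\alpha_i+\hat\beta_k)^{-1}$ ($i\le n$), $b_j=\sum_{k\ne j}(\hat\alpha_k+\hat\beta_j)^{-1}$ ($j\le n-1$). Fisher information at $\bar{\boldsymbol\theta}^*$: with $u(x)=1/x^2$, $v_{i,i}=\sum_{k\ne i}u(\bar\alpha_i^*+\bar\beta_k^* )$ ($i\le n$), $v_{n+j,n+j}=\sum_{k\ne j}u(\bar\alpha_k^*+\bar\beta_j^* )$ ($j\le n-1$), $v_{i,n+j}=v_{n+j,i}=u(\bar\alpha_i^*+\bar\beta_j^* )$ for $i\ne j$, other off-diagonal entries zero. $v_{2n,i}:=v_{i,i}-\sum_{j\le2n-1,j\ne i}v_{i,j}$, $v_{2n,2n}:=\sum_{i=1}^{2n-1}v_{2n,i}$. $S=(s_{i,j})$: $s_{i,j}=\delta_{i,j}/v_{i,i}+1/v_{2n,2n}$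 if $i,j\in\{1,\dots,n\}$ or $i,j\in\{n+1,\dots,2n-1\}$, else $s_{i,j}=-1/v_{2n,2n}$. *)

(* Defs.v *)
From HB Require Import structures.
From mathcomp Require Import all_boot all_order all_algebra.
From mathcomp Require Import all_classical all_reals all_analysis.
Set Implicit Arguments. Unset Strict Implicit. Unset Printing Implicit Defensive.
Import Order.TTheory GRing.Theory Num.Theory.
Import numFieldNormedType.Exports.
Local Open Scope classical_set_scope.
Local Open Scope ring_scope.

(* Conventions: 0-based indices.  For size n, alpha_i (i < n) and beta_j (j < n)
   are functions nat -> R; beta_{n-1} = 0 (the paper's beta_n := 0).
   The parameter vector theta has 2n-1 coordinates l = 0..2n-2:
   l < n -> alpha_l ;  n <= l <= 2n-2 -> beta_{l-n}. *)

Section Defs.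
Variable R : realType.

Definition theta_coord (n : nat) (al be : nat -> R) (l : nat) : R :=
  if (l < n)%N then al l else be (l - n)%N.

Definition ufun (x : R) : R := (x ^+ 2)^-1.

(* Fisher information matrix entries v_{i,j}, 0-based, i,j <= 2n-2. *)
Definition vmat (n : nat) (al be : nat -> R) (i j : nat) : R :=
  if i == j then
    (if (i < n)%N then \sum_(k < n | (k : nat) != i) ufun (al i + be k)
     else \sum_(k < n | (k : nat) != (i - n)%N) ufun (al k + be (i - n)%N))
  else if [&& (i < n)%N, (n <= j)%N, (j < n.*2.-1)%N & i != (j - n)%N]
    then ufun (al i + be (j - n)%N)
  else if [&& (j < n)%N, (n <= i)%N, (i < n.*2.-1)%N & j != (i - n)%N]
    then ufun (al j + be (i - n)%N)
  else 0.

(* v_{2n,i} := v_{i,i} - sum_{j <= 2n-1, j <> i} v_{i,j} (paper's 1-based 2n). *)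
Definition v2n (n : nat) (al be : nat -> R) (i : nat) : R :=
  vmat n al be i i - \sum_(j < n.*2.-1 | (j : nat) != i) vmat n al be i j.

Definition v2n2n (n : nat) (al be : nat -> R) : R :=
  \sum_(i < n.*2.-1) v2n n al be i.

Definition Smat (n : nat) (al be : nat -> R) (i j : nat) : R :=
  if ((i < n) && (j < n))%N || ((n <= i) && (n <= j))%N then
    (if i == j then (vmat n al be i i)^-1 else 0) + (v2n2n n al be)^-1
  else - (v2n2n n al be)^-1.

Definition Sblock (k n : nat) (al be : nat -> R) : 'M[R]_k :=
  \matrix_(i < k, j < k) Smat n al be i j.

Definition mle_eq (n : nat) (a : nat -> nat -> R) (al be : nat -> R) : Prop :=
  [/\ be n.-1 = 0,
      (forall i j : nat, (i < n)%N -> (j < n)%N -> i != j -> 0 < al i + be j),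
      (forall i : nat, (i < n)%N ->
         \sum_(j < n | (j : nat) != i) a i j
         = \sum_(k < n | (k : nat) != i) (al i + be k)^-1) &
      (forall j : nat, (j < n.-1)%N ->
         \sum_(i < n | (i : nat) != j) a i j
         = \sum_(k < n | (k : nat) != j) (al k + be j)^-1)].

Definition posdef (k : nat) (M : 'M[R]_k) : Prop :=
  forall x : 'rV[R]_k, x != 0 -> 0 < (x *m M *m x^T) ord0 ord0.

End Defs.

(* Main.v *)
(* Write t_ij = alpha_i + beta_j, u_ij = 1/t_ij^2, kappa = Q/q, L = log n, and let
   D_i, B_j be the row and column sums of the centered entries a_ij - 1/t_ij.

   When all a_ij are positive the log-likelihood is coercive once beta_n = 0 is pinned,
   so that the likelihood equations have a solution.  They say that the errors x_ij of
   the fitted t_ij satisfy sum_j (1/t_ij - 1/(t_ij + x_ij)) = - D_i for every row, and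
   the same with - B_j for every column.  By Chernoff's bound |D_i| and |B_j| are
   O(sqrt(n L) / q) off an event of probability O(n^-2); comparing the rows and columns
   of extreme error then gives
   sup |x_ij| = O(kappa^4 q sqrt(L/n)).  After linearization the remaining terms are
   controlled because the stochastic matrix of two half-steps, u_ij / v_i followed by
   u_ij / w_j, contracts oscillations by a factor 1 - kappa^-2 / 2 (Dobrushin); this
   yields  alpha^_i - alpha_i = - D_i / v_ii - B_n / v_{2n,2n} + O(kappa^10 q L/n).

   The entries of S_[k]^{-1/2} are O(sqrt n / q), so that the standardized error is
   O(kappa^25 L / sqrt n), which tends to 0 by hypothesis.  The standardized linear
   part is a weighted sum of independent centered exponentials whose characteristic
   function converges to that of N(0, I_k).  Trigonometric polynomials built from
   Bernstein polynomials approximate indicators of half-lines on compact sets, which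
   turns this into convergence of distribution functions; a Slutsky argument ends
   the proof. *)

Require Import Defs.
From HB Require Import structures.
From mathcomp Require Import all_boot all_order all_algebra.
From mathcomp Require Import all_classical all_reals all_analysis.
From mathcomp Require Import measurable_realfun.
From mathcomp Require Import ring lra.
Set Implicit Arguments. Unset Strict Implicit. Unset Printing Implicit Defensive.
Import Order.TTheory GRing.Theory Num.Theory.
Import numFieldNormedType.Exports.
Local Open Scope classical_set_scope.
Local Open Scope ring_scope.

(** * Integration and independence *)

(** The matrix [S_[k]^{-1/2}] can be of order sqrt n / q, so only errors of order o(q / sqrt n) in
    the expansion of the estimator are harmless. The uniform bound of order sqrt(L/n) is too weak to
    be used directly: it enters only through its square, in the Taylor remainder. For the same
    reason the weighted averages of B_j / w_j and D_i / v_i, which appear when one equation is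
    substituted into the other, cannot be bounded term by term. Each is a sum over all off-diagonal
    entries with coefficients of order n^-2, and a separate Chernoff bound gives the order sqrt L /
    n.

    The expansion itself costs only kappa^10. The exponent 25 comes from the hypothesis, whose 25th
    power says that kappa^25 L / sqrt n tends to 0; this single quantity majorizes every error term.

    Independence is given on rectangles of sets and has to be extended to products of functions.
    Characteristic functions are kept real: E cos(X + y) with a free phase y contains both the real
    and the imaginary part. *)

Section Density.
Import HBNNSimple.
Context d d' (T : measurableType d) (Y : measurableType d') (R : realType).
Local Open Scope ereal_scope.

(** Simple functions reduce the formula to indicators, so the image of a weighted measure has to be
    identified on sets only. It serves with the other factors of a product as weight, for
    independence, and with [X] the identity of the line, for laws given by a density. *)
Lemma ge0_integral_density (mu : {measure set T -> \bar R}) (X : T -> Y)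
    (w : T -> R) (nu : {measure set Y -> \bar R})
    (f : Y -> \bar R) :
  measurable_fun setT X -> measurable_fun setT w ->
  (forall t, (0 <= w t)%R) ->
  (forall B : set Y, measurable B ->
     nu B = \int[mu]_(t in X @^-1` B) (w t)%:E) ->
  measurable_fun setT f -> (forall x, 0 <= f x) ->
  \int[nu]_x f x = \int[mu]_t (f (X t) * (w t)%:E).
Proof.
move=> mX mw w0 nuE mf f0.
have mXB B : measurable B -> measurable (X @^-1` B).
  by move=> mB; rewrite -[_ @^-1` _]setTI; exact: mX.
pose h := nnsfun_approx measurableT mf.
have -> : \int[nu]_x f x = lim (\int[nu]_x (EFin \o h n) x @[n --> \oo]).
  have fE x : f x = lim ((EFin \o h n) x @[n --> \oo]).
    by apply/esym/cvg_lim => //; exact: cvg_nnsfun_approx.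
  under eq_integral => x _ do rewrite fE.
  apply: monotone_convergence => //.
  - by move=> n; apply/measurable_EFinP.
  - by move=> n x _ /=; rewrite lee_fin.
  - by move=> x _ a b ab; rewrite lee_fin; exact/lefP/nd_nnsfun_approx.
have mhX n : measurable_fun setT (fun t => h n (X t)).
  exact: (measurableT_comp (measurable_funP (h n)) mX).
have -> : \int[mu]_t (f (X t) * (w t)%:E) =
    lim (\int[mu]_t ((EFin \o h n) (X t) * (w t)%:E) @[n --> \oo]).
  have fg t : f (X t) * (w t)%:E =
      lim (((EFin \o h n) (X t) * (w t)%:E) @[n --> \oo]).
    apply/esym/cvg_lim => //; apply: cvgeZr => //.
    exact: cvg_nnsfun_approx.
  under eq_integral => x _ do rewrite fg.
  apply: monotone_convergence => [//| | |].
  - by move=> n; apply/emeasurable_funM; apply/measurable_EFinP.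
  - by move=> n x _ /=; rewrite mule_ge0 ?lee_fin.
  - move=> x _ a b ab/=; rewrite lee_wpmul2r ?lee_fin//.
    exact/lefP/nd_nnsfun_approx.
suff suf n : \int[mu]_t ((EFin \o h n) (X t) * (w t)%:E) =
    \int[nu]_x (EFin \o h n) x by under eq_fun do rewrite -suf.
transitivity (\int[nu]_x
    (\sum_(y \in range (h n)) (y * \1_(h n @^-1` [set y]) x)%:E)); last first.
  by apply: eq_integral => t tE; rewrite /= fimfunE -fsumEFin.
rewrite ge0_integral_fsum//; last 2 first.
- by move=> y; apply/measurable_EFinP; exact: measurable_funM.
- by move=> m y Ey; exact: nnfun_muleindic_ge0.
transitivity (\int[mu]_t (\sum_(y \in range (h n))
    (y * \1_(h n @^-1` [set y]) (X t))%:E * (w t)%:E)).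
  under [RHS]eq_integral => x xE.
    rewrite -ge0_mule_fsuml => [|y]; last exact: nnfun_muleindic_ge0.
    rewrite fsumEFin // -(fimfunE _ (X x)); over.
  by [].
have mi y : measurable_fun setT (fun t => \1_(h n @^-1` [set y]) (X t) : R).
  by apply: (measurableT_comp _ mX); exact: measurable_indic.
rewrite ge0_integral_fsum//; last 2 first.
- move=> y; apply: emeasurable_funM => //; apply/measurable_EFinP => //.
  exact: measurable_funM.
- by move=> m y Ey; apply: mule_ge0; [exact: nnfun_muleindic_ge0|rewrite lee_fin].
apply: eq_fsbigr => r rhn.
under [RHS]eq_integral do rewrite EFinM.
rewrite integralZl_indic_nnsfun => //.
under eq_integral do rewrite EFinM -muleA.
rewrite ge0_integralZl//.
- rewrite integral_indic// setIT nuE//.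
  congr (_ * _); rewrite [RHS]integral_mkcond.
  apply: eq_integral => t _; rewrite patchE indicE.
  have -> : (X t \in h n @^-1` [set r]) = (t \in X @^-1` (h n @^-1` [set r])).
    by apply/idP/idP; rewrite !inE.
  by case: ifPn => _; rewrite ?mul1e ?mul0e.
- by apply: emeasurable_funM; apply/measurable_EFinP.
- by move=> t Et; rewrite mule_ge0 ?lee_fin.
- by move: rhn; rewrite inE => -[t _ <-]; rewrite lee_fin.
Qed.

End Density.

Section Independence.
Context d (T : measurableType d) (R : realType) (P : probability T R).
Variable I : finType.
Variable X : I -> T -> R.

(** Taking [B i] to be the whole line outside a subfamily recovers the product rule for that
    subfamily, so one identity over all indices suffices. *)
Definition mutual_indep := forall B : I -> set R,
  (forall i, measurable (B i)) ->
  fine (P [set w | forall i, B i (X i w)]) =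
  \prod_i fine (P (X i @^-1` B i)).

Hypothesis mX : forall i, measurable_fun setT (X i).
Hypothesis indepX : mutual_indep.

Let mXB i (B : set R) : measurable B -> measurable (X i @^-1` B).
Proof. by move=> mB; rewrite -[_ @^-1` _]setTI; exact: mX. Qed.

Let mcomp i (f : R -> R) : measurable_fun setT f ->
  measurable_fun setT (fun t => f (X i t)).
Proof. by move=> mf; exact: (measurableT_comp mf (mX i)). Qed.

Let mprodX (Q : pred I) (f : I -> R -> R) : (forall i, measurable_fun setT (f i)) ->
  measurable_fun setT (fun t => \prod_(i | Q i) f i (X i t)).
Proof.
move=> mf; under eq_fun do rewrite -big_filter.
by apply: measurable_prod => i _; exact: mcomp.
Qed.

(** The list [s] holds the indices whose factor is not yet reduced to an indicator. With an
    indicator in place of [f i], the induction hypothesis says that the measure of density [g], the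
    product of the other factors, has as image under [X i] the law of [X i] times [c]. Integrating
    [f i] against that image restores the general factor. *)
Let indep_prod_seq (s : seq I) : forall f : I -> R -> R,
  (forall i, measurable_fun setT (f i)) -> (forall i x, 0 <= f i x) ->
  (forall i, (\int[P]_t (f i (X i t))%:E < +oo)%E) ->
  (forall i, i \notin s -> exists2 B : set R, measurable B & f i = \1_B) ->
  (\int[P]_t (\prod_i f i (X i t))%:E =
   (\prod_i \int[P]_t (f i (X i t)))%:E)%E.
Proof.
elim: s => [|i s IH] f mf f0 foo fI.
  have [B HB] : {B : I -> set R & forall i, measurable (B i) /\ f i = \1_(B i)}.
    apply: (@choice _ _ (fun i B => measurable B /\ f i = \1_B)) => i.
    by have [B mB fB] := fI i isT; exists B.
  pose E := [set w | forall i, B i (X i w)].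
  have mE : measurable E.
    rewrite (_ : E = \bigcap_(i in [set: I]) (X i @^-1` B i)).
      by apply: fin_bigcap_measurable => // i _; apply: mXB; case: (HB i).
    by apply/seteqP; split => [w Ew i _|w Ew i]; [exact: Ew|exact: Ew].
  transitivity (P E).
    rewrite -[in RHS](setIT E) -integral_indic//; apply: eq_integral => t _.
    congr EFin; rewrite indicE; case: (boolP (t \in E)) => [/set_mem tE|tE].
      rewrite big1// => i _; have [_ ->] := HB i.
      by rewrite indicE mem_set//; exact: tE.
    have [i Hi] : exists i, ~ B i (X i t).
      by apply/existsNP => H; move/negP: tE; apply; exact: mem_set.
    rewrite (bigD1 i)//=; have [_ ->] := HB i.
    by rewrite indicE memNset// mul0r.
  rewrite -[LHS]fineK ?fin_num_measure//; congr EFin.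
  rewrite indepX; last by move=> i; case: (HB i).
  apply: eq_bigr => i _; have [mB ->] := HB i.
  rewrite /Rintegral; congr fine.
  rewrite -[in LHS](setIT (X i @^-1` _)) -integral_indic//; last exact: mXB.
have intf j : P.-integrable setT (fun t => (f j (X j t))%:E).
  apply/integrableP; split; first exact/measurable_EFinP/mcomp.
  by under eq_integral do rewrite gee0_abs ?lee_fin//.
pose g t := \prod_(j | j != i) f j (X j t).
have g0 t : 0 <= g t by apply: prodr_ge0.
have mg : measurable_fun setT g by exact: mprodX.
pose c := \prod_(j | j != i) \int[P]_t (f j (X j t)).
have c0 : 0 <= c.
  by apply: prodr_ge0 => j _; apply: Rintegral_ge0.
pose C := NngNum c0.
have key (B : set R) : measurable B ->
    (\int[P]_(t in X i @^-1` B) (g t)%:E = c%:E * P (X i @^-1` B))%E.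
  move=> mB; pose f' j := if j == i then \1_B else f j.
  have f'i j : j != i -> f' j = f j by rewrite /f' => /negbTE ->.
  have f'ii : f' i = \1_B by rewrite /f' eqxx.
  have := IH f'; rewrite (_ : (fun t => _) =
      fun t => ((\1_(X i @^-1` B) t : R) * g t)%:E); last first.
    apply/funext => t; congr EFin; rewrite (bigD1 i)//= f'ii; congr *%R.
    by apply: eq_bigr => j /f'i ->.
  rewrite (bigD1 i)//= f'ii.
  rewrite (_ : \prod_(j | j != i) _ = c); last first.
    by apply: eq_bigr => j /f'i ->.
  move=> H; rewrite integral_mkcond.
  transitivity (\int[P]_t ((\1_(X i @^-1` B) t : R) * g t)%:E)%E.
    apply: eq_integral => t _; rewrite patchE indicE.
    by case: (t \in _); rewrite ?mul1r ?mul0r.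
  rewrite H => [||||j js]; last first.
  - rewrite /f'; case: eqVneq => [_|ji]; first by exists B.
    by apply: fI; rewrite inE negb_or ji.
  - move=> j; rewrite /f'; case: eqVneq => // _.
    rewrite -[ltLHS]/(\int[P]_t (\1_(X j @^-1` B) t)%:E)%E.
    rewrite integral_indic//; last exact: mXB.
    by rewrite setIT ltey_eq fin_num_measure//; exact: mXB.
  - by move=> j x; rewrite /f'; case: eqVneq => // _; rewrite indicE.
  - by move=> j; rewrite /f'; case: eqVneq => // _; exact: measurable_indic.
  rewrite mulrC EFinM; congr (_ * _)%E.
  rewrite /Rintegral -[RHS]fineK; last by apply: fin_num_measure; exact: mXB.
  congr (fine _)%:E.
  rewrite -[in RHS](setIT (X i @^-1` _)) -integral_indic//; exact: mXB.
pose Xi : {RV P >-> R} := mfun_Sub (mem_set (mX i)).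
have := @ge0_integral_density _ _ T R R P (X i) g
  (mscale C (distribution P Xi)) (EFin \o f i) (mX i) mg g0.
move=> H; rewrite [in RHS](bigD1 i)//=.
under eq_integral do rewrite (bigD1 i)//= EFinM.
rewrite -H; last 3 first.
- by move=> B mB; rewrite key.
- exact/measurable_EFinP.
- by move=> x; rewrite lee_fin.
rewrite ge0_integral_mscale//=; [|exact/measurable_EFinP|by move=> x _; rewrite lee_fin].
rewrite ge0_integral_distribution//=; [|exact/measurable_EFinP|by move=> x; rewrite lee_fin].
rewrite mulrC EFinM -/c; congr (_ * _)%E.
by rewrite /Rintegral fineK//; exact: integrable_fin_num.
Qed.

Lemma indep_ge0_prod (f : I -> R -> R) :
  (forall i, measurable_fun setT (f i)) -> (forall i x, 0 <= f i x) ->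
  (forall i, (\int[P]_t (f i (X i t))%:E < +oo)%E) ->
  (\int[P]_t (\prod_i f i (X i t))%:E =
   (\prod_i \int[P]_t (f i (X i t)))%:E)%E.
Proof.
move=> mf f0 foo; apply: (indep_prod_seq (s := enum I)) => // i.
by rewrite mem_enum.
Qed.

End Independence.

(** * Bounded random variables and their expectations *)

Section BoundedFunctions.
Context d (T : measurableType d) (R : realType) (P : probability T R).

(** The class is stable under sums and products and consists of integrable functions, so linearity
    of the expectation applies without separate integrability arguments. *)
Definition bounded_measurable (f : T -> R) :=
  measurable_fun setT f /\ exists M : R, forall t, `|f t| <= M.

Lemma bounded_measurable_integrable f : bounded_measurable f ->
  P.-integrable setT (EFin \o f).
Proof.
move=> [mf [M fM]]; apply: measurable_bounded_integrable => //.
  exact: le_lt_trans (probability_le1 _ _) (ltry 1).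
exists M; split; first by rewrite num_real.
by move=> x Mx t _; apply: le_trans (fM t) (ltW Mx).
Qed.

Lemma bounded_measurable_cst (c : R) : bounded_measurable (fun=> c).
Proof. by split; [exact: measurable_cst|exists `|c|]. Qed.

Lemma bounded_measurableD f g : bounded_measurable f -> bounded_measurable g ->
  bounded_measurable (fun t => f t + g t).
Proof.
move=> [mf [M fM]] [mg [N gN]]; split; first exact: measurable_funD.
by exists (M + N) => t; rewrite (le_trans (ler_normD _ _))// lerD.
Qed.

Lemma bounded_measurableM f g : bounded_measurable f -> bounded_measurable g ->
  bounded_measurable (fun t => f t * g t).
Proof.
move=> [mf [M fM]] [mg [N gN]]; split; first exact: measurable_funM.
by exists (M * N) => t; rewrite normrM ler_pM.
Qed.

Lemma bounded_measurable_sum (I : Type) (s : seq I) (Q : pred I)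
    (f : I -> T -> R) : (forall i, bounded_measurable (f i)) ->
  bounded_measurable (fun t => \sum_(i <- s | Q i) f i t).
Proof.
move=> bf; elim: s => [|i s IH].
  by under eq_fun do rewrite big_nil; exact: bounded_measurable_cst.
under eq_fun do rewrite big_cons.
by case: (Q i) => //; exact: bounded_measurableD.
Qed.

Lemma bounded_measurable_prod (I : Type) (s : seq I) (Q : pred I)
    (f : I -> T -> R) : (forall i, bounded_measurable (f i)) ->
  bounded_measurable (fun t => \prod_(i <- s | Q i) f i t).
Proof.
move=> bf; elim: s => [|i s IH].
  by under eq_fun do rewrite big_nil; exact: bounded_measurable_cst.
under eq_fun do rewrite big_cons.
by case: (Q i) => //; exact: bounded_measurableM.
Qed.

Lemma bounded_RintegralD f g : bounded_measurable f -> bounded_measurable g ->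
  \int[P]_t (f t + g t) = \int[P]_t f t + \int[P]_t g t.
Proof.
by move=> bf bg; rewrite RintegralD//; exact: bounded_measurable_integrable.
Qed.

Lemma bounded_RintegralZ f c : bounded_measurable f ->
  \int[P]_t (c * f t) = c * \int[P]_t f t.
Proof.
by move=> bf; rewrite RintegralZl//; exact: bounded_measurable_integrable.
Qed.

Lemma probability_Rintegral_cst (c : R) : \int[P]_t c = c.
Proof. by rewrite Rintegral_cst//= probability_setT mulr1. Qed.

Lemma bounded_Rintegral_sum (I : Type) (s : seq I) (Q : pred I)
    (f : I -> T -> R) : (forall i, bounded_measurable (f i)) ->
  \int[P]_t (\sum_(i <- s | Q i) f i t) = \sum_(i <- s | Q i) \int[P]_t f i t.
Proof.
move=> bf; elim: s => [|i s IH].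
  under eq_Rintegral do rewrite big_nil.
  by rewrite big_nil probability_Rintegral_cst.
under eq_Rintegral do rewrite big_cons.
rewrite big_cons; case: (Q i) => //; rewrite -IH -bounded_RintegralD//.
exact: bounded_measurable_sum.
Qed.

Lemma bounded_le_Rintegral f g : bounded_measurable f -> bounded_measurable g ->
  (forall t, f t <= g t) -> \int[P]_t f t <= \int[P]_t g t.
Proof.
move=> bf bg fg; apply: le_Rintegral => //; exact: bounded_measurable_integrable.
Qed.

Lemma le_norm_Rintegral (f : T -> R) (M : R) : measurable_fun setT f ->
  (forall t, `|f t| <= M) -> `|\int[P]_t f t| <= M.
Proof.
move=> mf fM; have bf : bounded_measurable f by split=> //; exists M.
rewrite ler_norml -(probability_Rintegral_cst (- M)).
rewrite -[X in _ && (_ <= X)](probability_Rintegral_cst M).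
by apply/andP; split; apply: bounded_le_Rintegral => //;
  try (exact: bounded_measurable_cst); move=> t;
  have := fM t; rewrite ler_norml => /andP[].
Qed.

Lemma bounded_measurable_indic A : measurable A ->
  bounded_measurable (\1_A : T -> R).
Proof.
move=> mA; split; first exact: measurable_indic.
by exists 1 => t; rewrite indicE; case: (_ \in _); rewrite ?normr1 ?normr0.
Qed.

Lemma Rintegral_indic A : measurable A -> \int[P]_t (\1_A t : R) = fine (P A).
Proof.
by move=> mA; rewrite /Rintegral integral_indic// setIT.
Qed.

End BoundedFunctions.

Section IndependenceBounded.
Context d (T : measurableType d) (R : realType) (P : probability T R).
Variable I : finType.
Variable X : I -> T -> R.
Hypothesis mX : forall i, measurable_fun setT (X i).
Hypothesis indepX : mutual_indep P X.

(* each factor is split as (f + M) - M, a difference of nonnegative functions *)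
Lemma indep_bounded_prod (f : I -> R -> R) :
  (forall i, measurable_fun setT (f i)) ->
  (forall i, exists M : R, forall x, `|f i x| <= M) ->
  \int[P]_t (\prod_i f i (X i t)) = \prod_i \int[P]_t (f i (X i t)).
Proof.
move=> mf /(@choice _ _ (fun i M => forall x, `|f i x| <= M)) [M fM].
have M0 i : 0 <= M i by apply: le_trans (normr_ge0 _) (fM i 0).
pose h (i : I) (b : bool) (x : R) := if b then f i x + M i else M i.
pose s (b : bool) : R := if b then 1 else - 1.
have fE i x : f i x = \sum_(b : bool) s b * h i b x.
  by rewrite big_bool/= mul1r mulN1r addrK.
have h0 i b x : 0 <= h i b x.
  rewrite /h; case: b => //; rewrite -lerBlDr sub0r.
  by have := fM i x; rewrite ler_norml => /andP[].
have mh i b : measurable_fun setT (h i b).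
  by rewrite /h; case: b; [exact: measurable_funD|exact: measurable_cst].
have mcomp i (g : R -> R) : measurable_fun setT g ->
    measurable_fun setT (fun t => g (X i t)).
  by move=> mg; exact: (measurableT_comp mg (mX i)).
have bh i b : bounded_measurable (fun t => h i b (X i t)).
  split; first exact: mcomp.
  exists (M i + M i) => t; rewrite /h; case: b.
    by rewrite (le_trans (ler_normD _ _))// lerD// ger0_norm.
  by rewrite ger0_norm// lerDl.
under eq_Rintegral => t _.
  under eq_bigr => i _ do rewrite fE.
  rewrite bigA_distr_bigA/=.
  under eq_bigr => i _ do rewrite big_split/=.
  over.
rewrite bounded_Rintegral_sum; last first.
  move=> g; apply: bounded_measurableM; first exact: bounded_measurable_cst.
  exact: bounded_measurable_prod.
transitivity (\sum_(g : {ffun I -> bool})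
    (\prod_i s (g i)) * \prod_i \int[P]_t (h i (g i) (X i t))).
  apply: eq_bigr => g _; rewrite bounded_RintegralZ; last first.
    exact: bounded_measurable_prod.
  congr (_ * _); rewrite {1}/Rintegral (indep_ge0_prod mX indepX (f := fun i x => h i (g i) x))//.
  move=> i; have := bounded_measurable_integrable P (bh i (g i)).
  by move/integrable_lty; exact.
transitivity (\sum_(g : {ffun I -> bool})
    \prod_i (s (g i) * \int[P]_t (h i (g i) (X i t)))).
  by apply: eq_bigr => g _; rewrite big_split.
rewrite -(bigA_distr_bigA (fun i b => s b * \int[P]_t h i b (X i t)))/=.
apply: eq_bigr => i _.
transitivity (\int[P]_t (\sum_(b : bool) s b * h i b (X i t))).
  rewrite bounded_Rintegral_sum; last first.
    by move=> b; apply: bounded_measurableM => //; exact: bounded_measurable_cst.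
  by apply: eq_bigr => b _; rewrite bounded_RintegralZ.
by apply: eq_Rintegral => t _; rewrite fE.
Qed.

End IndependenceBounded.

(** * Exponential and normal laws *)

Section Taylor.
Variable R : realType.
Implicit Types x r y : R.

(** Mean value theorem from 0. Most inequalities below have the preceding one as derivative, which
    produces the alternating Taylor bounds one degree at a time. *)
Lemma ge0_of_derive_ge0 (f df : R -> R) :
  (forall x, is_derive x (1 : R) f (df x)) -> (forall x, 0 <= x -> 0 <= df x) ->
  0 <= f 0 -> forall x, 0 <= x -> 0 <= f x.
Proof.
move=> fdf df0 f0 x x0.
have [|c] := @MVT_segment R f df 0 x x0 (fun z _ => fdf z).
  apply: derivable_within_continuous => z _.
  by case: (fdf z).
rewrite in_itv/= => /andP[c0 _] /eqP.
rewrite subr_eq => /eqP ->.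
by rewrite addr_ge0// mulr_ge0 ?subr_ge0// df0.
Qed.

Lemma sin_le_id x : 0 <= x -> sin x <= x.
Proof.
move=> x0; rewrite -subr_ge0; move: x x0.
apply: (@ge0_of_derive_ge0 (fun z => z - sin z) (fun z => 1 - cos z)) => [x _|].
- by rewrite subr_ge0 cos_le1.
- by rewrite sin0 subrr.
Qed.

Lemma cos_ge_quadratic x : 0 <= x -> 1 - x ^+ 2 / 2 <= cos x.
Proof.
move=> x0; rewrite -subr_ge0; move: x x0.
apply: (@ge0_of_derive_ge0 (fun z => cos z - (1 - z ^+ 2 / 2)) (fun z => z - sin z)) => [x|x x0|].
- apply: is_derive_eq; rewrite /GRing.scale/=; lra.
- by rewrite subr_ge0 sin_le_id.
- by rewrite cos0; lra.
Qed.

Lemma sin_ge_cubic x : 0 <= x -> x - x ^+ 3 / 6 <= sin x.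
Proof.
move=> x0; rewrite -subr_ge0; move: x x0.
apply: (@ge0_of_derive_ge0 (fun z => sin z - (z - z ^+ 3 / 6)) (fun z => cos z - (1 - z ^+ 2 / 2))) => [x|x x0|].
- apply: is_derive_eq; rewrite /GRing.scale/=; lra.
- by rewrite subr_ge0 cos_ge_quadratic.
- by rewrite sin0; lra.
Qed.

Lemma cos_le_quartic x : 0 <= x -> cos x <= 1 - x ^+ 2 / 2 + x ^+ 4 / 24.
Proof.
move=> x0; rewrite -subr_ge0; move: x x0.
apply: (@ge0_of_derive_ge0 (fun z => 1 - z ^+ 2 / 2 + z ^+ 4 / 24 - cos z) (fun z => sin z - (z - z ^+ 3 / 6))) => [x|x x0|].
- apply: is_derive_eq; rewrite /GRing.scale/=; lra.
- by rewrite subr_ge0 sin_ge_cubic.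
- by rewrite cos0; lra.
Qed.

Lemma expRN_le_quadratic x : 0 <= x -> expR (- x) <= 1 - x + x ^+ 2 / 2.
Proof.
move=> x0; rewrite -subr_ge0; move: x x0.
apply: (@ge0_of_derive_ge0 (fun z => 1 - z + z ^+ 2 / 2 - expR (- z)) (fun z => expR (- z) - (1 - z))) => [x|x x0|].
- apply: is_derive_eq; rewrite /GRing.scale/=; lra.
- by rewrite subr_ge0 expR_ge1Dx.
- by rewrite oppr0 expR0; lra.
Qed.

Lemma expR_ge_quadratic x : 0 <= x -> 1 + x + x ^+ 2 / 2 <= expR x.
Proof.
move=> x0; rewrite -subr_ge0; move: x x0.
apply: (@ge0_of_derive_ge0 (fun z => expR z - (1 + z + z ^+ 2 / 2))
  (fun z => expR z - (1 + z))) => [x|x x0|].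
- by apply: is_derive_eq; rewrite /GRing.scale/=; lra.
- by rewrite subr_ge0 expR_ge1Dx.
- by rewrite expR0; lra.
Qed.

(** For [X] exponential of rate [l] and r = c / l, the left side is E exp(c (X - 1/l)). Allowing r^2
    instead of the Gaussian r^2 / 2 makes the bound hold for r up to 1/2, away from the pole r =
    1. *)
Lemma exp_mgf_step r : `|r| <= 2^-1 -> expR (- r) / (1 - r) <= expR (r ^+ 2).
Proof.
rewrite ler_norml => /andP[r1 r2].
have r0 : 0 < 1 - r by lra.
rewrite ler_pdivrMr// expRN -[X in X <= _]mul1r ler_pdivrMr ?expR_gt0//.
rewrite mulrAC -expRD.
have [r_le0|r_gt0] := lerP r 0.
  have := expR_ge1Dx (r ^+ 2 + r) => h.
  apply: (le_trans _ (ler_wpM2r (ltW r0) h)).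
  have : 0 <= - r ^+ 3 by rewrite exprS; have := sqr_ge0 r; nra.
  lra.
have h : 0 <= r ^+ 2 + r by rewrite addr_ge0 ?sqr_ge0// ltW.
apply: (le_trans _ (ler_wpM2r (ltW r0) (expR_ge_quadratic h))).
(* This is what remains of the quadratic bound at r^2 + r, multiplied by 1 - r, after subtracting
   1. *)
have : 0 <= r ^+ 2 * ((1 - r) * (1 + r) ^+ 2 / 2 - r).
  by rewrite mulr_ge0 ?sqr_ge0//; nra.
lra.
Qed.

Let exp_cf_step_nneg r y : 0 <= r <= 1 ->
  `|(cos (y - r) - r * sin (y - r)) / (1 + r ^+ 2)
    - expR (- (r ^+ 2 / 2)) * cos y| <= 2 * r ^+ 3.
Proof.
move=> /andP[r0 r1].
have d0 : 0 < 1 + r ^+ 2 by rewrite ltr_pwDl// sqr_ge0.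
(* [A] and [B] are the coefficients of cos y and sin y after expansion of the angles. To second
   order in r, [A] agrees with e (1 + r^2) and [B] with 0, so both errors are at most of cubic
   order. *)
pose A := cos r + r * sin r; pose B := sin r - r * cos r.
pose e := expR (- (r ^+ 2 / 2)).
rewrite -/e cosB sinB.
have -> : (cos y * cos r + sin y * sin r - r * (sin y * cos r - cos y * sin r))
    / (1 + r ^+ 2) - e * cos y =
    (cos y * (A - e * (1 + r ^+ 2)) + sin y * B) / (1 + r ^+ 2).
  by rewrite /A /B; field; rewrite gt_eqF.
rewrite normrM [X in _ * X]gtr0_norm ?invr_gt0// ler_pdivrMr//.
have r3 : 0 <= r ^+ 3 by rewrite exprn_ge0.
have r43 : r ^+ 4 <= r ^+ 3 by rewrite exprS ler_piMl.
have r53 : r ^+ 5 <= r ^+ 3 by rewrite (exprD r 2 3) ler_piMl// expr_le1.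
have r63 : r ^+ 6 <= r ^+ 3 by rewrite (exprD r 3 3) ler_piMl// expr_le1.
have c1 := cos_ge_quadratic r0; have c2 := cos_le_quartic r0.
have s1 := sin_ge_cubic r0; have s2 := sin_le_id r0.
have e1 : 1 - r ^+ 2 / 2 <= e by have := expR_ge1Dx (- (r ^+ 2 / 2)).
have e2 : e <= 1 - r ^+ 2 / 2 + r ^+ 4 / 8.
  have h : 0 <= r ^+ 2 / 2 by rewrite divr_ge0// sqr_ge0.
  apply: (le_trans (expRN_le_quadratic h)).
  by rewrite expr_div_n -exprM; lra.
have hA : `|A - e * (1 + r ^+ 2)| <= r ^+ 3.
  have a1 : r * (r - r ^+ 3 / 6) <= r * sin r by rewrite ler_wpM2l.
  have a2 : r * sin r <= r * r by rewrite ler_wpM2l.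
  have a3 : (1 - r ^+ 2 / 2) * (1 + r ^+ 2) <= e * (1 + r ^+ 2).
    by rewrite ler_pM2r.
  have a4 : e * (1 + r ^+ 2) <= (1 - r ^+ 2 / 2 + r ^+ 4 / 8) * (1 + r ^+ 2).
    by rewrite ler_pM2r.
  rewrite /A ler_norml; apply/andP; split; nra.
have hB : `|B| <= r ^+ 3 / 2.
  have b1 : r * (1 - r ^+ 2 / 2) <= r * cos r by rewrite ler_wpM2l.
  have b2 : r * cos r <= r * (1 - r ^+ 2 / 2 + r ^+ 4 / 24) by rewrite ler_wpM2l.
  rewrite /B ler_norml; apply/andP; split; nra.
have cy := cos_max y; have sy := sin_max y.
apply: (@le_trans _ _ (2 * r ^+ 3)); last first.
  by rewrite ler_peMr ?mulr_ge0// lerDl sqr_ge0.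
apply: (le_trans (ler_normD _ _)); rewrite !normrM.
have : `|cos y| * `|A - e * (1 + r ^+ 2)| <= r ^+ 3.
  by apply: le_trans (ler_piMl _ cy) _.
have : `|sin y| * `|B| <= r ^+ 3 / 2 by apply: le_trans (ler_piMl _ sy) _.
lra.
Qed.

(* The left-hand fraction is E cos(y + c(X - 1/l)) for X exponential of rate l,
   with r = c / l. *)
Lemma exp_cf_step r y : `|r| <= 1 ->
  `|(cos (y - r) - r * sin (y - r)) / (1 + r ^+ 2)
    - expR (- (r ^+ 2 / 2)) * cos y| <= 2 * `|r| ^+ 3.
Proof.
case: (leP 0 r) => [r0|r0] r1.
  by rewrite ger0_norm in r1 *; rewrite // exp_cf_step_nneg// r0.
have := @exp_cf_step_nneg (- r) (- y).
rewrite -opprD cosN sinN mulrNN sqrrN cosN.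
rewrite ltr0_norm// in r1 *.
by apply; rewrite oppr_ge0 ltW.
Qed.

End Taylor.

Section ExponentialLaw.
Context d (T : measurableType d) (R : realType) (P : probability T R).
Notation mu := (@lebesgue_measure R).

Lemma cvg_expRN_rate (l : R) : 0 < l -> expR (- l * x) @[x --> +oo] --> (0 : R).
Proof.
move=> l0; rewrite (_ : (fun x => expR (- l * x)) =
    (fun z => expR (- z)) \o (fun z => l * z)); last first.
  by apply/funext => x /=; rewrite mulNr.
apply: (@cvg_comp _ _ _ _ _ _ (pinfty_nbhs R)); last exact: cvgr_expR.
exact: gt0_cvgMry.
Qed.

Variables (X : T -> R) (l : R).
Hypothesis l0 : 0 < l.
Hypothesis mX : measurable_fun setT X.
Hypothesis lawX : forall B : set R, measurable B ->
  P (X @^-1` B) = exponential_prob l B.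

Lemma ge0_expectation_exponential (f : R -> R) :
  measurable_fun setT f -> (forall x, 0 <= f x) ->
  (\int[P]_t (f (X t))%:E =
   \int[mu]_(x in `[0%R, +oo[) (f x * (l * expR (- l * x)))%:E)%E.
Proof.
move=> mf f0; pose X' : {RV P >-> R} := mfun_Sub (mem_set mX).
transitivity (\int[distribution P X']_x (f x)%:E)%E.
  by rewrite ge0_integral_distribution//=; exact/measurable_EFinP.
rewrite (@ge0_integral_density _ _ _ R R lebesgue_measure id (exponential_pdf l)
    (distribution P X') (EFin \o f))//.
- rewrite [RHS]integral_mkcond; apply: eq_integral => x _.
  rewrite /= !patchE /exponential_pdf !patchE.
  by case: ifP => _; rewrite -EFinM ?mulr0.
- exact: measurable_exponential_pdf.
- by move=> t; exact/exponential_pdf_ge0/ltW.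
- exact/measurable_EFinP.
Qed.

Lemma mgf_exponential (s : R) : s < l ->
  (\int[P]_t (expR (s * X t))%:E = (l / (l - s))%:E)%E.
Proof.
move=> sl; have ls : 0 < l - s by rewrite subr_gt0.
rewrite (ge0_expectation_exponential (f := fun x => expR (s * x))); last 2 first.
- by apply: measurableT_comp => //; exact: measurable_funM.
- by move=> x; exact: expR_ge0.
have E x : expR (s * x) * (l * expR (- l * x)) = l * expR (- (l - s) * x).
  by rewrite mulrCA -expRD; congr (_ * expR _); lra.
under eq_integral do rewrite E.
rewrite (@ge0_continuous_FTC2y R _ (fun x => - (l / (l - s)) * expR (- (l - s) * x)) 0 0).
- by rewrite mulr0 expR0 mulr1 sub0e EFinN oppeK.
- by move=> x _; rewrite mulr_ge0 ?expR_ge0// ltW.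
- apply: continuous_subspaceT => x.
  apply: cvgM; first exact: cvg_cst.
  apply: continuous_comp; last exact: continuous_expR.
  by apply: cvgM; [exact: cvg_cst|exact: cvg_id].
- rewrite -(mulr0 (- (l / (l - s)))); apply: cvgM; first exact: cvg_cst.
  exact: cvg_expRN_rate.
- by move=> x _; exact: ex_derive.
- apply: cvg_at_right_filter; apply: cvgM; first exact: cvg_cst.
  apply: continuous_comp; last exact: continuous_expR.
  by apply: cvgM; [exact: cvg_cst|exact: cvg_id].
- move=> x _; rewrite derive1E.
  apply: derive_val; apply: is_derive_eq.
  by rewrite /GRing.scale/=; field; rewrite gt_eqF.
Qed.

Lemma expectation_cos_exponential (s p : R) :
  \int[P]_t cos (s * X t + p) = l * (l * cos p - s * sin p) / (l ^+ 2 + s ^+ 2).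
Proof.
have ls : 0 < l ^+ 2 + s ^+ 2 by rewrite ltr_pwDl ?sqr_ge0// exprn_gt0.
have mc : measurable_fun setT (fun x : R => cos (s * x + p)).
  apply: continuous_measurable_fun => x.
  apply: continuous_comp; last exact: continuous_cos.
  by apply: cvgD; [apply: cvgM; [exact: cvg_cst|exact: cvg_id]|exact: cvg_cst].
have bc : bounded_measurable (fun t => cos (s * X t + p)).
  by split; [exact: (measurableT_comp mc mX)|exists 1 => t; exact: cos_max].
(* The added 1 makes the integrand nonnegative, as both the density formula and the improper
   integral require. *)
suff H : \int[P]_t (1 + cos (s * X t + p)) =
    1 + l * (l * cos p - s * sin p) / (l ^+ 2 + s ^+ 2).
  move: H; rewrite bounded_RintegralD//; last exact: bounded_measurable_cst.
  by rewrite probability_Rintegral_cst => /addrI.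
rewrite /Rintegral (ge0_expectation_exponential (f := fun x => 1 + cos (s * x + p))).
- pose F (x : R) := - expR (- l * x) + expR (- l * x) *
    (l / (l ^+ 2 + s ^+ 2) * (s * sin (s * x + p) - l * cos (s * x + p))).
  rewrite (@ge0_continuous_FTC2y R _ F 0 0).
  + by rewrite -EFinB /F /= !mulr0 !add0r expR0; field; rewrite gt_eqF.
  + move=> x _; apply: mulr_ge0; last by rewrite mulr_ge0 ?expR_ge0 ?(ltW l0).
    by rewrite -lerBlDl sub0r cos_geN1.
  + apply: continuous_subspaceT => x.
    apply: cvgM.
      apply: cvgD; first exact: cvg_cst.
      apply: continuous_comp; last exact: continuous_cos.
      by apply: cvgD; [apply: cvgM; [exact: cvg_cst|exact: cvg_id]|exact: cvg_cst].
    apply: cvgM; first exact: cvg_cst.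
    apply: continuous_comp; last exact: continuous_expR.
    by apply: cvgM; [exact: cvg_cst|exact: cvg_id].
  + rewrite -(addr0 (0 : R)) -{1}oppr0; apply: cvgD.
      by apply: cvgN; exact: cvg_expRN_rate.
    pose C := l / (l ^+ 2 + s ^+ 2) * (`|s| + l).
    apply: (@squeeze_cvgr _ _ _ _ (fun x => - (C * expR (- l * x)))
        (fun x => C * expR (- l * x))).
    * near=> x; rewrite -ler_norml normrM mulrC (ger0_norm (expR_ge0 _)).
      rewrite ler_wpM2r ?expR_ge0// /C normrM ger0_norm; last first.
        by rewrite divr_ge0// ltW.
      apply: ler_wpM2l; first by rewrite divr_ge0 ?ltW.
      apply: (le_trans (ler_normB _ _)).
      rewrite !normrM (gtr0_norm l0) lerD//.
        by rewrite ler_piMr// sin_max.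
      by rewrite ler_piMr ?(ltW l0)// cos_max.
    * rewrite -oppr0 -(mulr0 C); apply: cvgN; apply: cvgM; first exact: cvg_cst.
      exact: cvg_expRN_rate.
    * rewrite -(mulr0 C); apply: cvgM; first exact: cvg_cst.
      exact: cvg_expRN_rate.
  + by move=> x _; exact: ex_derive.
  + apply: cvg_at_right_filter.
    have : derivable F 0 1 by exact: ex_derive.
    by move=> /derivable1_diffP /differentiable_continuous.
  + move=> x _; rewrite derive1E.
    apply: derive_val; apply: is_derive_eq.
    by rewrite /GRing.scale/=; field; rewrite gt_eqF.
- by apply: measurable_funD => //.
- by move=> x; rewrite -lerBlDl sub0r cos_geN1.
Unshelve. all: by end_near. Qed.

Lemma expectation_cos_centered (c y : R) :
  \int[P]_t cos (y + c * (X t - l^-1)) =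
  (cos (y - c / l) - c / l * sin (y - c / l)) / (1 + (c / l) ^+ 2).
Proof.
have -> : (fun t => cos (y + c * (X t - l^-1))) =
    (fun t => cos (c * X t + (y - c / l))).
  by apply/funext => t; congr cos; lra.
rewrite expectation_cos_exponential; field.
by rewrite !gt_eqF// ltr_pwDl ?sqr_ge0// exprn_gt0.
Qed.

End ExponentialLaw.

(** * Characteristic function of the standard normal law *)

Section NormalCharacteristicFunction.
Variable R : realType.
Notation mu := (@lebesgue_measure R).
Local Notation phi := (normal_pdf (0 : R) 1).

Lemma std_normal_pdfE : phi = fun x => normal_peak 1 * expR (- (x ^+ 2 / 2)).
Proof.
apply/funext => x; rewrite normal_pdfE ?oner_neq0// /normal_fun subr0 expr1n.
by rewrite mulNr.
Qed.

Lemma is_derive_std_normal_pdf x : is_derive x (1 : R) phi (- x * phi x).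
Proof.
rewrite std_normal_pdfE; apply: is_derive_eq.
by rewrite /GRing.scale/=; lra.
Qed.

Let phi_ge0 x : 0 <= phi x. Proof. exact: normal_pdf_ge0. Qed.

Let mphi : measurable_fun setT phi. Proof. exact: measurable_normal_pdf. Qed.

Let cphi : continuous phi.
Proof. by apply: continuous_normal_pdf; rewrite oner_neq0. Qed.

Let int_phi : mu.-integrable setT (EFin \o phi).
Proof. exact: integrable_normal_pdf. Qed.

Let int_absphi : mu.-integrable setT (EFin \o (fun x => `|x| * phi x)).
Proof.
(* The comparison is with the normal density of variance 2: since |x| <= exp(x^2 / 4), the function
   |x| exp(-x^2 / 2) lies below exp(-x^2 / 4). *)
pose s : R := Num.sqrt 2.
have s2 : s ^+ 2 = 2 by rewrite sqr_sqrtr.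
have s0 : s != 0 by rewrite gt_eqF// sqrtr_gt0.
have pk := normal_peak_gt0 s0.
have ig : mu.-integrable setT
    (fun x => (normal_peak 1 / normal_peak s)%:E * (normal_pdf 0 s x)%:E)%E.
  by apply: integrableZl => //; exact: integrable_normal_pdf.
apply: (le_integrable measurableT _ _ ig).
- by apply/measurable_EFinP; apply: measurable_funM => //; exact: measurableT_comp.
- move=> x _; rewrite std_normal_pdfE (normal_pdfE _ s0) -EFinM abse_EFin /= lee_fin normrM normr_id.
  have -> : normal_peak 1 / normal_peak s * (normal_peak s * normal_fun 0 s x) =
      normal_peak 1 * normal_fun 0 s x by field; rewrite gt_eqF.
  rewrite [X in _ <= X]ger0_norm ?[X in _ * X]ger0_norm ?mulr_ge0 ?normal_peak_ge0 ?expR_ge0//.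
  rewrite mulrCA ler_wpM2l ?normal_peak_ge0//.
  rewrite /normal_fun subr0 s2 mulNr.
  have -> : - (x ^+ 2 / 2) = - (x ^+ 2 / (2 *+ 2)) + - (x ^+ 2 / 4) by field.
  rewrite expRD mulrCA ler_piMr ?expR_ge0// expRN ler_pdivrMr ?expR_gt0// mul1r.
  apply: (le_trans _ (expR_ge1Dx _)).
  rewrite -[x ^+ 2]real_normK ?num_real//.
  have := sqr_ge0 (1 - `|x| / 2); lra.
Qed.

Variable s : R.

Let F t := \int[mu]_x (cos (t * x + s) * phi x).

Let c_affine (t : R) : continuous (fun x : R => t * x + s).
Proof.
by move=> x; apply: cvgD; [apply: cvgM; [exact: cvg_cst|exact: cvg_id]|exact: cvg_cst].
Qed.

Let ccos t : continuous (fun x : R => cos (t * x + s)).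
Proof.
by move=> x; apply: continuous_comp; [exact: c_affine|exact: continuous_cos].
Qed.

Let csin t : continuous (fun x : R => sin (t * x + s)).
Proof.
by move=> x; apply: continuous_comp; [exact: c_affine|exact: continuous_sin].
Qed.

Let int_cos t : mu.-integrable setT (EFin \o (fun x => cos (t * x + s) * phi x)).
Proof.
apply: (le_integrable measurableT _ _ int_phi) => //.
  apply/measurable_EFinP/measurable_funM => //.
  exact: continuous_measurable_fun.
move=> x _; rewrite lee_fin normrM ler_piMl//; exact: cos_max.
Qed.

Let int_xsin t :
  mu.-integrable setT (EFin \o (fun x => x * sin (t * x + s) * phi x)).
Proof.
apply: (le_integrable measurableT _ _ int_absphi) => //.
  apply/measurable_EFinP/measurable_funM => //; apply: measurable_funM => //.
  exact: continuous_measurable_fun.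
move=> x _; rewrite lee_fin !normrM normr_id ler_wpM2r// ler_piMr//.
exact: sin_max.
Qed.

Let partial_cos t x : partial1of2 (fun t x => cos (t * x + s) * phi x) t x =
  - (x * sin (t * x + s) * phi x).
Proof.
rewrite partial1of2E; apply: derive_val; apply: is_derive_eq.
by rewrite /GRing.scale/=; lra.
Qed.

Let derive_F (t : R) : is_derive t (1 : R) F (- \int[mu]_x (x * sin (t * x + s) * phi x)).
Proof.
pose f t x := cos (t * x + s) * phi x.
have It : `](t - 1), (t + 1)[%classic t.
  by rewrite /= in_itv/= ltrBlDr ltrDl ltr01.
have intf x : `](t - 1), (t + 1)[%classic x -> mu.-integrable setT (EFin \o f x).
  by move=> _; exact: int_cos.
have dff x y : `](t - 1), (t + 1)[%classic x -> [set: R] y -> derivable (f ^~ y) x 1.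
  by move=> _ _; exact: ex_derive.
have Gub x y : `](t - 1), (t + 1)[%classic x -> [set: R] y ->
    `|partial1of2 f x y| <= `|y| * phi y.
  move=> _ _; rewrite partial_cos normrN !normrM (ger0_norm (phi_ge0 _)).
  by rewrite ler_wpM2r// ler_piMr// sin_max.
have G0 y : 0 <= `|y| * phi y by rewrite mulr_ge0.
have D := derivable_under_integral measurableT It intf dff G0 int_absphi Gub.
have V := differentiation_under_integral measurableT It intf dff G0 int_absphi Gub.
apply: DeriveDef; first exact: D.
rewrite -derive1E [LHS]V.
under eq_Rintegral do rewrite partial_cos -mulN1r.
by rewrite RintegralZl// mulN1r.
Qed.

(** Integration by parts: the difference of the two integrands is the derivative of [G]. It is
    integrable, so its integral is the limit of those over [-n, n], where only the boundary values
    of [G], of order 1/n, remain. *)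
Let F_ode t : \int[mu]_x (x * sin (t * x + s) * phi x) = t * F t.
Proof.
have itc : mu.-integrable setT (EFin \o (fun x => t * (cos (t * x + s) * phi x))).
  exact: (integrableZl measurableT t (int_cos t)).
rewrite /F -RintegralZl//; apply/eqP; rewrite -subr_eq0 -RintegralB//.
pose g (x : R) := x * sin (t * x + s) * phi x - t * (cos (t * x + s) * phi x).
rewrite -[X in X == _]/(\int[mu]_x g x).
pose G (x : R) := - (sin (t * x + s) * phi x).
have dG (x : R) : is_derive x (1 : R) G (g x).
  have := is_derive_std_normal_pdf x => Hphi.
  by apply: is_derive_eq; rewrite /g /GRing.scale/=; lra.
have cg : continuous g.
  move=> x; apply: cvgB; (apply: cvgM; last first); try exact: cphi.
  - by apply: cvgM; [exact: cvg_id|exact: csin].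
  - by apply: cvgM; [exact: ccos|exact: cphi].
  - exact: cvg_cst.
have intg : mu.-integrable setT (EFin \o g).
  exact: (integrableB measurableT (int_xsin t) itc).
have cvg1 : (\int[mu]_x ((g \_ `[- n.+1%:R, n.+1%:R]) x)%:E @[n --> \oo] -->
    \int[mu]_x (g x)%:E)%E.
  apply: (@dominated_cvg _ _ _ mu setT measurableT _ _ (fun x => `|(g x)%:E|%E)).
  - move=> n; apply/measurable_EFinP.
    apply/(measurable_restrictT _ _).1 => //.
    by apply: measurable_funTS; exact: continuous_measurable_fun.
  - move=> x _; apply: cvg_near_cst; near=> n; rewrite patchE mem_set//=.
    rewrite in_itv/= -ler_norml.
    apply: (le_trans (ltW (archi_boundP (normr_ge0 x)))).
    by rewrite ler_nat leqW//; near: n; exact: nbhs_infty_ge.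
  - by [].
  - exact: integrable_abse.
  - move=> n x _; rewrite patchE; case: ifP => _ //=.
    by rewrite normr0 lee_fin.
have cvg2 : (\int[mu]_x ((g \_ `[- n.+1%:R, n.+1%:R]) x)%:E @[n --> \oo] --> 0)%E.
  have E n : (\int[mu]_x ((g \_ `[- n.+1%:R, n.+1%:R]) x)%:E =
      (G n.+1%:R - G (- n.+1%:R))%:E)%E.
    rewrite EFinB -(@continuous_FTC2 _ g G (- n.+1%:R) n.+1%:R).
    - rewrite [RHS]integral_mkcond; apply: eq_integral => x _.
      by rewrite !patchE; case: ifP.
    - by rewrite gt0_cp.
    - exact: continuous_subspaceT.
    - have cG : continuous G.
        move=> x; have [+ _] := dG x.
        by move=> /derivable1_diffP /differentiable_continuous.
      split.
      + by move=> x _; case: (dG x).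
      + by apply: cvg_at_right_filter; exact: cG.
      + by apply: cvg_at_left_filter; exact: cG.
    - by move=> x _; rewrite derive1E; case: (dG x).
  under eq_fun do rewrite E.
  apply/cvg_EFin; first exact: nearW.
  have G_le x (n : nat) : `|x| = n.+1%:R -> `|G x| <= 2 * normal_peak 1 * harmonic n.
    move=> xn; rewrite normrN normrM (ger0_norm (phi_ge0 _)).
    apply: (@le_trans _ _ (phi x)); first by rewrite ler_piMl// sin_max.
    rewrite std_normal_pdfE [2 * _]mulrC -[X in _ <= X]mulrA.
    apply: ler_wpM2l; first exact: normal_peak_ge0.
    have n0 : 0 < n.+1%:R :> R by rewrite ltr0n.
    have x2 : x ^+ 2 = n.+1%:R ^+ 2 by rewrite -xn real_normK ?num_real.
    rewrite expRN x2 /harmonic/= -(invf_div _ 2) lef_pV2.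
    - apply: le_trans (expR_ge1Dx _).
      have : 1 <= n.+1%:R :> R by rewrite ler1n.
      by move: n.+1%:R => z ?; nra.
    - by rewrite posrE expR_gt0.
    - by rewrite posrE divr_gt0.
  apply: norm_cvg0; apply: (@squeeze_cvgr _ _ _ _ (cst 0)
      (fun n => 4 * normal_peak 1 * harmonic n)).
  - near=> n; rewrite normr_ge0/=; apply: (le_trans (ler_normB _ _)).
    have n0 : `|n.+1%:R : R| = n.+1%:R by rewrite ger0_norm.
    apply: (le_trans (lerD (G_le _ n n0) (G_le _ n _))); first by rewrite normrN.
    rewrite -[X in _ <= X]/(4 * normal_peak 1 * harmonic n).
    by move: (harmonic n) (normal_peak 1) => h p; lra.
  - exact: cvg_cst.
  - rewrite -(mulr0 (4 * normal_peak 1)); apply: cvgM; first exact: cvg_cst.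
    exact: cvg_harmonic.
apply/eqP; rewrite /Rintegral.
by rewrite -(cvg_lim _ cvg1)// (cvg_lim _ cvg2).
Unshelve. all: by end_near. Qed.

Lemma derive0_constant (f : R -> R) : (forall x, is_derive x (1 : R) f 0) ->
  forall x, f x = f 0.
Proof.
move=> df x; have cf : continuous f.
  by move=> y; case: (df y) => /derivable1_diffP /differentiable_continuous.
have [x0|x0|->//] := ltgtP x 0.
- have [|c _] := @MVT R f (fun=> 0) x 0 x0 (fun z _ => df z).
    exact: continuous_subspaceT.
  by rewrite mul0r => /eqP; rewrite subr_eq0 => /eqP.
- have [|c _] := @MVT R f (fun=> 0) 0 x x0 (fun z _ => df z).
    exact: continuous_subspaceT.
  by rewrite mul0r => /eqP; rewrite subr_eq0 => /eqP.
Qed.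

(** The two preceding facts give F' = - t F, so F(t) exp(t^2 / 2) is constant, equal to its value
    cos s at t = 0. *)
Let F_eq t : F t = expR (- (t ^+ 2 / 2)) * cos s.
Proof.
pose K (t : R) := F t * expR (t ^+ 2 / 2).
have dK x : is_derive x (1 : R) K 0.
  have := derive_F x => dF; apply: is_derive_eq.
  by rewrite F_ode /GRing.scale/=; lra.
have := derive0_constant dK t.
rewrite /K expr0n/= mul0r expR0 mulr1 => H.
have -> : F t = F 0 * expR (- (t ^+ 2 / 2)).
  by rewrite -H -mulrA -expRD addrN expR0 mulr1.
rewrite mulrC; congr (_ * _); rewrite /F.
under eq_Rintegral do rewrite mul0r add0r.
rewrite RintegralZl// /Rintegral integral_normal_pdf//= mulr1.
by [].
Qed.

Lemma expectation_cos_std_normal t :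
  \int[normal_prob 0 1]_x cos (t * x + s) = expR (- (t ^+ 2 / 2)) * cos s.
Proof.
rewrite -F_eq.
have bc : bounded_measurable (fun x : R => cos (t * x + s)).
  by split; [exact: continuous_measurable_fun|exists 1 => x; exact: cos_max].
suff H : \int[normal_prob 0 1]_x (1 + cos (t * x + s)) = 1 + F t.
  move: H; rewrite bounded_RintegralD//; last exact: bounded_measurable_cst.
  by rewrite probability_Rintegral_cst => /addrI.
rewrite /Rintegral (@ge0_integral_density _ _ _ _ R lebesgue_measure id phi
    (normal_prob 0 1) (fun x => (1 + cos (t * x + s))%:E))//.
- transitivity (\int[mu]_x (phi x + cos (t * x + s) * phi x)).
    by congr fine; apply: eq_integral => x _; rewrite -EFinM mulrDl mul1r.
  rewrite RintegralD//; congr (_ + _).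
  by rewrite /Rintegral integral_normal_pdf.
- apply/measurable_EFinP; apply: measurable_funD => //.
  exact: continuous_measurable_fun.
Qed.

End NormalCharacteristicFunction.

(** * Sums of independent centered exponentials *)

Section ExponentialSums.
Context d (T : measurableType d) (R : realType) (P : probability T R).
Variables (I : finType) (X : I -> T -> R) (l : I -> R).
Hypothesis mX : forall i, measurable_fun setT (X i).
Hypothesis indepX : mutual_indep P X.
Hypothesis l0 : forall i, 0 < l i.
Hypothesis lawX : forall i (B : set R), measurable B ->
  P (X i @^-1` B) = exponential_prob (l i) B.

Section CharacteristicFunction.
Variable c : I -> R.

Let xi i (x : R) := c i * (x - (l i)^-1).
Let S (s : seq I) t := \sum_(i <- s) xi i (X i t).
(** The phase [y] replaces complex numbers: y = 0 gives the real part of the characteristic function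
    and y = - pi / 2 the imaginary part. *)
Let K s y := \int[P]_t cos (y + S s t).

Let mxi i : measurable_fun setT (xi i).
Proof. by apply: measurable_funM => //; exact: measurable_funB. Qed.

Let mS s : measurable_fun setT (S s).
Proof.
by apply: measurable_sum => i; exact: (measurableT_comp (mxi i) (mX i)).
Qed.

Let mcos : measurable_fun setT (@cos R).
Proof. by apply: continuous_measurable_fun; exact: continuous_cos. Qed.

Let msin : measurable_fun setT (@sin R).
Proof. by apply: continuous_measurable_fun; exact: continuous_sin. Qed.

Let bcos s y : bounded_measurable (fun t => cos (y + S s t)).
Proof.
split; last by exists 1 => t; exact: cos_max.
by apply: (measurableT_comp mcos); exact: measurable_funD.
Qed.

Let bcomp i (g : R -> R) : measurable_fun setT g ->
  (exists M : R, forall x, `|g x| <= M) ->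
  bounded_measurable (fun t => g (X i t)).
Proof.
move=> mg [M gM]; split; first exact: (measurableT_comp mg (mX i)).
by exists M => t; exact: gM.
Qed.

Let Ec i := \int[P]_t cos (xi i (X i t)).
Let Es i := \int[P]_t sin (xi i (X i t)).

Let mcosxi i : measurable_fun setT (fun x => cos (xi i x)).
Proof. exact: (measurableT_comp mcos (mxi i)). Qed.

Let msinxi i : measurable_fun setT (fun x => sin (xi i x)).
Proof. exact: (measurableT_comp msin (mxi i)). Qed.

(** The cosine of a sum is not a product of one-variable functions, so the product rule does not
    apply to it. This property expresses the independence of the sum over [s] from the remaining
    variables in a form that survives induction on [s]. *)
Let Kfactor s := forall y (g : I -> R -> R),
  (forall i, measurable_fun setT (g i)) ->
  (forall i, exists M : R, forall x, `|g i x| <= M) ->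
  \int[P]_t (cos (y + S s t) * \prod_(i | i \notin s) g i (X i t)) =
  K s y * \prod_(i | i \notin s) \int[P]_t g i (X i t).

(** The addition formula, with sine written as a shift of the phase by pi / 2, splits off one
    summand. Its cosine or sine then joins the other factors in the role of [g i]. *)
Let factor_rec i s : i \notin s -> Kfactor s -> forall y (g : I -> R -> R),
  (forall i, measurable_fun setT (g i)) ->
  (forall i, exists M : R, forall x, `|g i x| <= M) ->
  \int[P]_t (cos (y + S (i :: s) t) * \prod_(j | j \notin i :: s) g j (X j t)) =
  (K s y * Ec i - K s (y - pi / 2) * Es i) *
  \prod_(j | j \notin i :: s) \int[P]_t g j (X j t).
Proof.
move=> nis Ks y g mg bg.
have step (h : R -> R) z : measurable_fun setT h ->
    (exists M : R, forall x, `|h x| <= M) ->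
    \int[P]_t (cos (z + S s t) *
      (h (X i t) * \prod_(j | j \notin i :: s) g j (X j t))) =
    K s z * (\int[P]_t h (X i t) *
      \prod_(j | j \notin i :: s) \int[P]_t g j (X j t)).
  move=> mh bh; pose gh j := if j == i then h else g j.
  have E (F : I -> (R -> R) -> R) : \prod_(j | j \notin s) F j (gh j) =
      F i h * \prod_(j | j \notin i :: s) F j (g j).
    rewrite (bigD1 i)//= {1}/gh eqxx; congr (_ * _).
    rewrite (eq_bigl (fun j => j \notin i :: s)); last first.
      by move=> j; rewrite inE negb_or andbC.
    apply: eq_bigr => j; rewrite inE negb_or => /andP[ji _].
    by rewrite /gh (negbTE ji).
  rewrite -(E (fun j f => \int[P]_t f (X j t))) -Ks.
  - by apply: eq_Rintegral => t _; rewrite (E (fun j f => f (X j t))).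
  - by move=> j; rewrite /gh; case: ifP.
  - by move=> j; rewrite /gh; case: ifP.
have bprod (Q : pred I) : bounded_measurable (fun t => \prod_(j | Q j) g j (X j t)).
  by apply: bounded_measurable_prod => j; exact: bcomp.
have bc : bounded_measurable (fun t => cos (xi i (X i t))).
  by have := @bcomp i _ (mcosxi i); apply; exists 1 => x; exact: cos_max.
have bs : bounded_measurable (fun t => sin (xi i (X i t))).
  by have := @bcomp i _ (msinxi i); apply; exists 1 => x; exact: sin_max.
transitivity (\int[P]_t (cos (y + S s t) *
    (cos (xi i (X i t)) * \prod_(j | j \notin i :: s) g j (X j t)) +
    (- 1) * (cos (y - pi / 2 + S s t) *
    (sin (xi i (X i t)) * \prod_(j | j \notin i :: s) g j (X j t))))).
  apply: eq_Rintegral => t _.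
  rewrite [y - _ + _]addrAC cosBpihalf /S big_cons addrA addrAC cosD; ring.
rewrite bounded_RintegralD; last 2 first.
- by do 2 apply: bounded_measurableM => //.
- apply: bounded_measurableM; first exact: bounded_measurable_cst.
  by do 2 apply: bounded_measurableM => //.
rewrite bounded_RintegralZ; last by do 2 apply: bounded_measurableM => //.
rewrite (step (fun x => cos (xi i x)))//; last by exists 1 => x; exact: cos_max.
rewrite (step (fun x => sin (xi i x)))//; last by exists 1 => x; exact: sin_max.
by rewrite /Ec /Es; ring.
Qed.

Let K_rec i s : i \notin s -> Kfactor s -> forall y,
  K (i :: s) y = K s y * Ec i - K s (y - pi / 2) * Es i.
Proof.
move=> nis Ks y.
have E : \prod_(j | j \notin i :: s) (\int[P]_t (1 : R)) = 1.
  by apply: big1 => j _; exact: probability_Rintegral_cst.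
have := @factor_rec i s nis Ks y (fun _ _ => 1) (fun=> measurable_cst _).
rewrite E mulr1 => <- => [|j]; last by exists 1 => x; rewrite normr1.
by apply: eq_Rintegral => t _; rewrite big1// mulr1.
Qed.

Let K_factor s : uniq s -> Kfactor s.
Proof.
elim: s => [_|i s IH /andP[nis us]] y g mg bg.
  rewrite /K /S; under eq_Rintegral do rewrite big_nil addr0.
  under [in RHS]eq_Rintegral do rewrite big_nil addr0.
  rewrite bounded_RintegralZ; last first.
    by apply: bounded_measurable_prod => i; exact: bcomp.
  rewrite probability_Rintegral_cst; congr (_ * _).
  exact: (indep_bounded_prod mX indepX mg bg).
by rewrite (K_rec nis (IH us)) (factor_rec nis (IH us)).
Qed.

(** Exponential summands are exchanged for Gaussian factors one at a time. Each exchange costs at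
    most 4 |r|^3, half from the cosine and half from the sine, and the errors only add up because
    |K| and the Gaussian factors are at most 1. *)
Let K_approx s : uniq s -> (forall i, `|c i / l i| <= 1) -> forall y,
  `|K s y - expR (- (\sum_(i <- s) (c i / l i) ^+ 2) / 2) * cos y| <=
  4 * \sum_(i <- s) `|c i / l i| ^+ 3.
Proof.
move=> us c1; elim: s us => [_|i s IH /= /andP[nis us]] y.
  rewrite /K /S; under eq_Rintegral do rewrite big_nil addr0.
  by rewrite probability_Rintegral_cst !big_nil oppr0 mul0r expR0 mul1r subrr normr0 mulr0.
rewrite (K_rec nis (K_factor us)) !big_cons.
set r := c i / l i; set e := expR (- (r ^+ 2 / 2)).
set V := \sum_(j <- s) _ ^+ 2; set W := \sum_(j <- s) _ ^+ 3.
have K1 z : `|K s z| <= 1.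
  by apply: le_norm_Rintegral => [|t]; [case: (bcos s z)|exact: cos_max].
have -> : expR (- (r ^+ 2 + V) / 2) = e * expR (- V / 2).
  by rewrite -expRD; congr expR; lra.
have Hc : `|Ec i - e| <= 2 * `|r| ^+ 3.
  have := exp_cf_step 0 (c1 i); rewrite -/r cos0 mulr1 -(expectation_cos_centered (l0 i) (mX i) (@lawX i)).
  by rewrite /Ec; under eq_Rintegral do rewrite add0r.
have Hs : `|Es i| <= 2 * `|r| ^+ 3.
  have := exp_cf_step (- (pi / 2)) (c1 i).
  rewrite -/r cosN cos_pihalf mulr0 subr0 -(expectation_cos_centered (l0 i) (mX i) (@lawX i)).
  by rewrite /Es; under eq_Rintegral do rewrite addrC cosBpihalf.
have e1 : 0 <= e <= 1.
  by rewrite expR_ge0 expR_le1 oppr_le0 divr_ge0// sqr_ge0.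
have -> : K s y * Ec i - K s (y - pi / 2) * Es i - e * expR (- V / 2) * cos y =
    K s y * (Ec i - e) - K s (y - pi / 2) * Es i +
    e * (K s y - expR (- V / 2) * cos y) by ring.
rewrite [X in _ <= X]mulrDr; apply: (le_trans (ler_normD _ _)); apply: lerD.
  apply: (le_trans (ler_normB _ _)); rewrite (normrM (K s y)) (normrM (K s _)).
  have h1 : `|K s y| * `|Ec i - e| <= 2 * `|r| ^+ 3.
    by apply: le_trans Hc; rewrite ler_piMl.
  have h2 : `|K s (y - pi / 2)| * `|Es i| <= 2 * `|r| ^+ 3.
    by apply: le_trans Hs; rewrite ler_piMl.
  by apply: (le_trans (lerD h1 h2)); lra.
rewrite normrM; apply: le_trans (IH us y).
by case/andP: e1 => e0 e1; rewrite ger0_norm// ler_piMl.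
Qed.

Lemma characteristic_function_approx : (forall i, `|c i / l i| <= 1) -> forall y,
  `|\int[P]_t cos (y + \sum_i c i * (X i t - (l i)^-1))
    - expR (- (\sum_i (c i / l i) ^+ 2) / 2) * cos y| <=
  4 * \sum_i `|c i / l i| ^+ 3.
Proof.
by move=> c1 y; exact: K_approx (index_enum_uniq I) c1 y.
Qed.

End CharacteristicFunction.

Lemma mgf_sum_exponential (c : I -> R) : (forall i, `|c i / l i| <= 2^-1) ->
  (\int[P]_t (expR (\sum_i c i * (X i t - (l i)^-1)))%:E <=
   (expR (\sum_i (c i / l i) ^+ 2))%:E)%E.
Proof.
move=> c1; pose f i (x : R) := expR (c i * (x - (l i)^-1)).
have mf i : measurable_fun setT (f i).
  by apply: measurableT_comp => //; apply: measurable_funM => //; exact: measurable_funB.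
have cl i : c i < l i.
  have := c1 i; rewrite ler_norml => /andP[_].
  by rewrite ler_pdivrMr//; have := l0 i; lra.
have Ef i : (\int[P]_t (f i (X i t))%:E =
    (expR (- (c i / l i)) / (1 - c i / l i))%:E)%E.
  transitivity (\int[P]_t ((expR (- (c i / l i)))%:E * (expR (c i * X i t))%:E))%E.
    apply: eq_integral => t _; rewrite -EFinM -expRD; congr (expR _)%:E; lra.
  rewrite ge0_integralZl//; last first.
    by apply/measurable_EFinP; apply: measurableT_comp => //; exact: measurable_funM.
  rewrite (mgf_exponential (l0 i) (mX i) (@lawX i) (cl i)) -EFinM; congr EFin.
  have := l0 i; have := cl i => h1 h2; field.
  by rewrite gt_eqF// subr_eq0 gt_eqF.
under eq_integral do rewrite expR_sum.
rewrite (indep_ge0_prod mX indepX mf); last 2 first.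
- by move=> i x; exact: expR_ge0.
- by move=> i; rewrite Ef ltry.
rewrite lee_fin expR_sum; apply: ler_prod => i _.
rewrite /Rintegral Ef/= exp_mgf_step// andbT divr_ge0 ?expR_ge0//.
by have := c1 i; rewrite ler_norml => /andP[_]; lra.
Qed.

End ExponentialSums.

(** * From characteristic functions to distribution functions *)

Section BernsteinStep.
Variable R : realType.
Implicit Types (v h th : R).

(* Bernstein polynomial of the indicator of [0, th] *)
Definition bernstein_step (N : nat) th v : R :=
  \sum_(j < N.+1 | j%:R <= th * N%:R) (1 - v) ^+ (N - j) * v ^+ j *+ 'C(N, j).

Let weight (N : nat) v (j : nat) : R := (1 - v) ^+ (N - j) * v ^+ j *+ 'C(N, j).

Let weight_ge0 N v j : 0 <= v <= 1 -> 0 <= weight N v j.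
Proof.
move=> /andP[v0 v1]; rewrite /weight mulrn_wge0// mulr_ge0// exprn_ge0//.
by rewrite subr_ge0.
Qed.

Let weight_sum N v : \sum_(j < N.+1) weight N v j = 1.
Proof. by rewrite -exprDn subrK expr1n. Qed.

Let weight_mgf N v h : \sum_(j < N.+1) weight N v j * expR (h * j%:R) =
  (1 - v + v * expR h) ^+ N.
Proof.
rewrite exprDn; apply: eq_bigr => j _; rewrite /weight exprMn -expRM_natl.
by rewrite [in RHS]mulrA -[RHS]mulrnAl (mulrC h).
Qed.

Let weight_mgf_le N v h : 0 <= v <= 1 ->
  \sum_(j < N.+1) weight N v j * expR (h * j%:R) <=
  expR (N%:R * (v * (expR h - 1))).
Proof.
move=> /andP[v0 v1]; rewrite weight_mgf expRM_natl.
apply: lerXn2r; rewrite ?nnegrE ?expR_ge0//.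
  by rewrite addr_ge0 ?mulr_ge0 ?expR_ge0 ?subr_ge0.
by apply: (le_trans _ (expR_ge1Dx _)); lra.
Qed.

Lemma bernstein_step_ge0 N th v : 0 <= v <= 1 -> 0 <= bernstein_step N th v.
Proof. by move=> v01; apply: sumr_ge0 => j _; exact: (weight_ge0 N j v01). Qed.

Let bernstein_stepC N th v :
  bernstein_step N th v = 1 - \sum_(j < N.+1 | ~~ (j%:R <= th * N%:R)) weight N v j.
Proof.
rewrite -[X in X - _](weight_sum N v) [X in X - _](bigID (fun j : 'I_N.+1 => j%:R <= th * N%:R))/=.
by rewrite addrK.
Qed.

Lemma bernstein_step_le1 N th v : 0 <= v <= 1 -> bernstein_step N th v <= 1.
Proof.
move=> v01; rewrite bernstein_stepC lerBlDr lerDl.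
by apply: sumr_ge0 => j _; exact: weight_ge0.
Qed.

(** The value is the probability that a binomial variable with parameters N and v is at most th N,
    so this is Chernoff's bound with tilt - e. *)
Lemma bernstein_step_small N th e v : 0 <= v <= 1 -> 0 <= e -> th + e <= v ->
  bernstein_step N th v <= expR (- (N%:R * e ^+ 2 / 8)).
Proof.
move=> v01 e0 thv.
apply: (@le_trans _ _ (\sum_(j < N.+1) weight N v j * expR (- e * j%:R) * expR (e * (th * N%:R)))).
  rewrite [leRHS](bigID (fun j : 'I_N.+1 => j%:R <= th * N%:R))/=.
  rewrite -[leLHS]addr0; apply: lerD; last first.
    by apply: sumr_ge0 => j _; rewrite !mulr_ge0 ?expR_ge0// weight_ge0.
  apply: ler_sum => j jth; rewrite -[leLHS]mulr1 -mulrA.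
  rewrite ler_wpM2l ?weight_ge0// -expRD -[leLHS]expR0 ler_expR.
  have -> : - e * j%:R + e * (th * N%:R) = e * (th * N%:R - j%:R) by ring.
  by apply: mulr_ge0 => //; rewrite subr_ge0.
rewrite -mulr_suml; apply: (le_trans (ler_wpM2r (expR_ge0 _) (weight_mgf_le N _ v01))).
rewrite -expRD ler_expR.
have h1 : expR (- e) - 1 <= - e + e ^+ 2 / 2.
  by have := expRN_le_quadratic e0; lra.
case/andP: v01 => v0 v1.
have h2 : v * (expR (- e) - 1) <= v * (- e + e ^+ 2 / 2) by rewrite ler_wpM2l.
have h3 : v * (- e + e ^+ 2 / 2) + e * th <= - (e ^+ 2 / 8).
  have := mulr_ge0 e0 (_ : 0 <= v - (th + e)); rewrite subr_ge0 => /(_ thv).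
  have := mulr_ge0 (sqr_ge0 e) (_ : 0 <= 1 - v); rewrite subr_ge0 => /(_ v1).
  by have := sqr_ge0 e; lra.
have -> : - (N%:R * e ^+ 2 / 8) = N%:R * - (e ^+ 2 / 8) by lra.
have -> : e * (th * N%:R) = N%:R * (e * th) by ring.
by rewrite -mulrDr ler_wpM2l//; lra.
Qed.

Lemma bernstein_step_large N th e v : 0 <= v <= 1 -> 0 <= e <= 1 -> v <= th - e ->
  1 - expR (- (N%:R * e ^+ 2 / 8)) <= bernstein_step N th v.
Proof.
move=> v01 /andP[e0 e1] thv; rewrite bernstein_stepC lerD2l lerN2.
(* With v <= 1 and v <= th - e, the exponent per trial is at most 2 h^2 - h e; the choice h = e / 4
   minimizes it and gives - e^2 / 8. *)
pose h := e / 4.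
have h0 : 0 <= h by rewrite divr_ge0.
apply: (@le_trans _ _ (\sum_(j < N.+1) weight N v j * expR (h * j%:R) * expR (- h * (th * N%:R)))).
  rewrite [leRHS](bigID (fun j : 'I_N.+1 => ~~ (j%:R <= th * N%:R)))/=.
  rewrite -[leLHS]addr0; apply: lerD; last first.
    by apply: sumr_ge0 => j _; rewrite !mulr_ge0 ?expR_ge0// weight_ge0.
  apply: ler_sum => j; rewrite -ltNge => jth; rewrite -[leLHS]mulr1 -mulrA.
  rewrite ler_wpM2l ?weight_ge0// -expRD -[leLHS]expR0 ler_expR.
  have -> : h * j%:R + - h * (th * N%:R) = h * (j%:R - th * N%:R) by ring.
  by apply: mulr_ge0 => //; rewrite subr_ge0 ltW.
rewrite -mulr_suml; apply: (le_trans (ler_wpM2r (expR_ge0 _) (weight_mgf_le N _ v01))).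
rewrite -expRD ler_expR.
have h1 : expR h - 1 <= h + 2 * h ^+ 2.
  have : expR (- h) >= 1 - h := expR_ge1Dx (- h).
  rewrite expRN -[X in _ <= X]div1r ler_pdivlMr ?expR_gt0// => H.
  have hh : h <= 2^-1 by rewrite /h; lra.
  rewrite -(@ler_pM2l _ (1 - h)); last by lra.
  have := mulr_ge0 (sqr_ge0 h) (_ : 0 <= 1 - 2 * h) => /(_ _).
  by move=> /(_ ltac:(lra)); lra.
case/andP: v01 => v0 v1.
have h2 : v * (expR h - 1) <= v * (h + 2 * h ^+ 2) by rewrite ler_wpM2l.
have h3 : v * (h + 2 * h ^+ 2) - h * th <= - (e ^+ 2 / 8).
  have := mulr_ge0 e0 (_ : 0 <= th - e - v); rewrite subr_ge0 => /(_ thv).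
  have := mulr_ge0 (sqr_ge0 e) (_ : 0 <= 1 - v); rewrite subr_ge0 => /(_ v1).
  by rewrite /h; have := sqr_ge0 e; lra.
have -> : - (N%:R * e ^+ 2 / 8) = N%:R * - (e ^+ 2 / 8) by lra.
have -> : - h * (th * N%:R) = N%:R * - (h * th) by ring.
by rewrite -mulrDr ler_wpM2l//; lra.
Qed.

End BernsteinStep.

(** * Trigonometric approximation of indicators of half-lines *)

Section TrigonometricPolynomials.
Variable R : realType.

(* the sum of the a * cos (t x + b) over the triples ((a, t), b) of s *)
Definition trig_sum (s : seq (R * R * R)) (x : R) : R :=
  \sum_(p <- s) p.1.1 * cos (p.1.2 * x + p.2).

Definition trigpoly (f : R -> R) := exists s, f =1 trig_sum s.

Lemma trigpoly_cos t b : trigpoly (fun x => cos (t * x + b)).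
Proof.
by exists [:: (1, t, b)] => x; rewrite /trig_sum big_seq1/= mul1r.
Qed.

Lemma eq_trigpoly f g : f =1 g -> trigpoly f -> trigpoly g.
Proof. by move=> fg [s fs]; exists s => x; rewrite -fg. Qed.

Lemma trigpoly_cst c : trigpoly (fun=> c).
Proof.
by exists [:: (c, 0, 0)] => x; rewrite /trig_sum big_seq1/= mul0r addr0 cos0 mulr1.
Qed.

Lemma trigpolyD f g : trigpoly f -> trigpoly g -> trigpoly (fun x => f x + g x).
Proof.
by move=> [s fs] [u gu]; exists (s ++ u) => x; rewrite /trig_sum big_cat/= fs gu.
Qed.

Lemma trigpoly_sum (I : Type) (r : seq I) (Q : pred I) (F : I -> R -> R) :
  (forall i, trigpoly (F i)) -> trigpoly (fun x => \sum_(i <- r | Q i) F i x).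
Proof.
move=> tF; elim: r => [|i r IH].
  by apply: eq_trigpoly (trigpoly_cst 0) => x; rewrite big_nil.
apply: (@eq_trigpoly (fun x => if Q i then F i x + \sum_(i <- r | Q i) F i x else
    \sum_(i <- r | Q i) F i x)) => [x|]; first by rewrite big_cons.
by case: (Q i) => //; exact: trigpolyD.
Qed.

Lemma trigpolyM f g : trigpoly f -> trigpoly g -> trigpoly (fun x => f x * g x).
Proof.
move=> [s fs] [u gu].
have H : trigpoly (fun x => \sum_(p <- s) \sum_(r <- u)
    (p.1.1 * cos (p.1.2 * x + p.2)) * (r.1.1 * cos (r.1.2 * x + r.2))).
  apply: trigpoly_sum => -[[a t] b]; apply: trigpoly_sum => -[[a' t'] b']/=.
  exists [:: (a * a' / 2, t + t', b + b'); (a * a' / 2, t - t', b - b')] => x.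
  rewrite /trig_sum big_cons big_seq1/=.
  have -> : (t + t') * x + (b + b') = (t * x + b) + (t' * x + b') by ring.
  have -> : (t - t') * x + (b - b') = (t * x + b) - (t' * x + b') by ring.
  by rewrite (cosD (t * x + b)) (cosB (t * x + b)); field.
apply: eq_trigpoly H => x; rewrite fs gu /trig_sum mulr_suml.
by apply: eq_bigr => p _; rewrite mulr_sumr.
Qed.

Lemma trigpolyX f n : trigpoly f -> trigpoly (fun x => f x ^+ n).
Proof.
move=> tf; elim: n => [|n IH]; first exact: trigpoly_cst.
by apply: eq_trigpoly (trigpolyM tf IH) => x; rewrite exprS.
Qed.

(** The function (1 + sin(pi x / (2 M))) / 2 is a trigonometric polynomial with values in [0, 1],
    increasing on [-M, M]; a Bernstein step in it separates y from y'. The values stay in [0, 1] on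
    the whole line, so what happens beyond M costs no more than a tail probability. *)
Lemma trigpoly_step_approx (y y' M e : R) : 0 < e -> 0 < M ->
  - M <= y -> y < y' -> y' <= M -> exists f, [/\ trigpoly f,
    forall x, 0 <= f x <= 1,
    forall x, `|x| <= M -> x <= y -> 1 - e <= f x &
    forall x, `|x| <= M -> y' <= x -> f x <= e].
Proof.
move=> e0 M0 My yy' y'M.
pose w : R := pi / (2 * M).
have w0 : 0 < w by rewrite divr_gt0 ?pi_gt0// mulr_gt0.
have wM : w * M = pi / 2 by rewrite /w; field; rewrite gt_eqF.
pose v x := (1 + sin (w * x)) / 2.
have v01 x : 0 <= v x <= 1.
  by have := sin_le1 (w * x); have := sin_geN1 (w * x); rewrite /v => ? ?; apply/andP; lra.
have vmono x z : `|x| <= M -> `|z| <= M -> x < z -> v x < v z.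
  have wx u : `|u| <= M -> w * u \in `[- (pi / 2), pi / 2].
    rewrite ler_norml in_itv/= -wM => /andP[h1 h2].
    by rewrite -mulrN !ler_pM2l ?h1.
  move=> xM zM xz; rewrite /v ltr_pM2r ?invr_gt0// ltrD2l ltr_sin ?wx//.
  by rewrite ltr_pM2l.
have yM : `|y| <= M by rewrite ler_norml My (le_trans (ltW yy')).
have y'M' : `|y'| <= M by rewrite ler_norml y'M (le_trans My (ltW yy')).
have vmono' x z : `|x| <= M -> `|z| <= M -> x <= z -> v x <= v z.
  by move=> xM zM; rewrite le_eqVlt => /predU1P[->//|xz]; exact/ltW/vmono.
pose th := (v y + v y') / 2; pose h := (v y' - v y) / 2.
have h0 : 0 < h by rewrite divr_gt0// subr_gt0 vmono.
have h1 : h <= 1 by have := v01 y; have := v01 y'; rewrite /h => /andP[? ?] /andP[? ?]; lra.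
(* N h^2 / 8 exceeds 1 / e, and exp(1 / e) >= 1 / e makes the Bernstein error at most e. *)
pose N := Num.bound (8 / (h ^+ 2 * e)).
have NE : expR (- (N%:R * h ^+ 2 / 8)) <= e.
  have he : 0 < h ^+ 2 * e by rewrite mulr_gt0// exprn_gt0.
  have := archi_boundP (ltW (divr_gt0 (ltr0n _ 8) he)); rewrite -/N => HN.
  rewrite expRN -[X in _ <= X]invrK lef_pV2 ?posrE ?expR_gt0 ?invr_gt0//.
  apply: (le_trans _ (expR_ge1Dx _)).
  move: HN; rewrite ltr_pdivrMr// => HN.
  rewrite -[X in X <= _]div1r ler_pdivrMr//.
  by have := mulr_ge0 (ler0n R N) (sqr_ge0 h); nra.
exists (fun x => bernstein_step N th (v x)); split.
- have tv : trigpoly v.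
    apply: (@eq_trigpoly (fun x => (1 + cos (w * x + - (pi / 2))) * 2^-1)).
      by move=> x; rewrite cosBpihalf.
    apply: trigpolyM; last exact: trigpoly_cst.
    by apply: trigpolyD; [exact: trigpoly_cst|exact: trigpoly_cos].
  have tv' : trigpoly (fun x => 1 - v x).
    apply: (@eq_trigpoly (fun x => 1 + - 1 * v x)) => [x|]; first by rewrite mulN1r.
    apply: trigpolyD; first exact: trigpoly_cst.
    by apply: trigpolyM => //; exact: trigpoly_cst.
  apply: trigpoly_sum => j.
  apply: (@eq_trigpoly (fun x => (1 - v x) ^+ (N - j) * v x ^+ j * 'C(N, j)%:R)).
    by move=> x; rewrite mulr_natr.
  apply: trigpolyM; last exact: trigpoly_cst.
  by apply: trigpolyM; exact: trigpolyX.
- by move=> x; rewrite bernstein_step_ge0// bernstein_step_le1.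
- move=> x xM xy; apply: le_trans (bernstein_step_large N (v01 x) _ (_ : v x <= th - h)).
  + by rewrite lerD2l lerN2.
  + by rewrite (ltW h0).
  + by apply: le_trans (vmono' _ _ xM yM xy) _; rewrite /th /h; lra.
- move=> x xM xy; apply: le_trans (bernstein_step_small N (v01 x) (ltW h0) (_ : th + h <= v x)) NE.
  by apply: le_trans (vmono' _ _ y'M' xM xy); rewrite /th /h; lra.
Qed.

End TrigonometricPolynomials.

(** For two factors the errors add because each error is multiplied by a number in [0, 1]. These
    bounds are carried through the induction together with the inequality. *)
Lemma prod_le_prodD (R : realDomainType) (I : finType) (a b c : I -> R) :
  (forall i, 0 <= a i <= 1) -> (forall i, 0 <= b i <= 1) -> (forall i, 0 <= c i) ->
  (forall i, a i <= b i + c i) -> \prod_i a i <= \prod_i b i + \sum_i c i.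
Proof.
move=> a01 b01 c0 abc.
suff : [/\ 0 <= \prod_i a i <= 1, 0 <= \prod_i b i <= 1,
    0 <= \sum_i c i & \prod_i a i <= \prod_i b i + \sum_i c i] by case.
apply: (big_ind3 (fun x y z => [/\ 0 <= x <= 1, 0 <= y <= 1, 0 <= z & x <= y + z])).
- by split; rewrite ?lexx ?ler01// addr0.
- move=> x1 x2 y1 y2 z1 z2 [/andP[x10 x11] /andP[x20 x21] z10 h1].
  move=> [/andP[y10 y11] /andP[y20 y21] z20 h2]; split; try (apply/andP; split); nra.
- by move=> i _; split.
Qed.

Lemma cvgr_sum (R : realType) (I : Type) (s : seq I) (u : I -> nat -> R) (a : I -> R) :
  (forall i, u i @ \oo --> a i) ->
  (fun n => \sum_(i <- s) u i n) @ \oo --> \sum_(i <- s) a i.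
Proof.
move=> ua; elim: s => [|i s IH].
  by rewrite big_nil; under eq_fun do rewrite big_nil; exact: cvg_cst.
by rewrite big_cons; under eq_fun do rewrite big_cons; exact: cvgD.
Qed.

Lemma Rintegral_prod_le (R : realType) d (T : measurableType d) (P : probability T R)
    (I : finType) (a b : I -> T -> R) (A : I -> set T) (e : R) :
  (forall i, bounded_measurable (a i)) -> (forall i, bounded_measurable (b i)) ->
  (forall i, measurable (A i)) -> (forall i, fine (P (A i)) <= e) -> 0 <= e ->
  (forall i t, 0 <= a i t <= 1) -> (forall i t, 0 <= b i t <= 1) ->
  (forall i t, a i t <= b i t + (e + \1_(A i) t)) ->
  \int[P]_t (\prod_i a i t) <= \int[P]_t (\prod_i b i t) + 2 * e * #|I|%:R.
Proof.
move=> ba bb mA Ae e0 a01 b01 ab.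
have bA i : bounded_measurable (fun t => e + \1_(A i) t : R).
  apply: bounded_measurableD; first exact: bounded_measurable_cst.
  exact: bounded_measurable_indic.
have bS : bounded_measurable (fun t => \sum_i (e + \1_(A i) t) : R).
  exact: bounded_measurable_sum.
apply: (@le_trans _ _ (\int[P]_t (\prod_i b i t + \sum_i (e + \1_(A i) t)))).
  apply: bounded_le_Rintegral; first exact: bounded_measurable_prod.
    by apply: bounded_measurableD => //; exact: bounded_measurable_prod.
  move=> t; apply: prod_le_prodD => // i.
  by rewrite addr_ge0// indicE.
rewrite bounded_RintegralD//; last exact: bounded_measurable_prod.
rewrite lerD2l bounded_Rintegral_sum//.
apply: (@le_trans _ _ (\sum_(i : I) (2 * e))); last by rewrite sumr_const mulr_natr.
apply: ler_sum => i _; rewrite bounded_RintegralD; last 2 first.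
- exact: bounded_measurable_cst.
- exact: bounded_measurable_indic.
by rewrite probability_Rintegral_cst Rintegral_indic//; have := Ae i; lra.
Qed.

Lemma measurable_norm_gt (R : realType) d (T : measurableType d) (f : T -> R) (M : R) :
  measurable_fun setT f -> measurable [set w | M < `|f w|].
Proof.
move=> mf; rewrite (_ : [set w | _] = (fun w => `|f w|) @^-1` `]M, +oo[).
  rewrite -[_ @^-1` _]setTI.
  have : measurable_fun setT (fun w => `|f w|) by exact: measurableT_comp.
  by apply => //; exact: measurable_itv.
by apply/seteqP; split => x; rewrite /= in_itv/= andbT.
Qed.

Lemma measurable_le_cst (R : realType) d (T : measurableType d) (f : T -> R) (y : R) :
  measurable_fun setT f -> measurable [set w | f w <= y].
Proof.
move=> mf; rewrite (_ : [set w | _] = f @^-1` `]-oo, y]).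
  by rewrite -[_ @^-1` _]setTI; apply: mf => //; exact: measurable_itv.
by apply/seteqP; split => x; rewrite /= in_itv.
Qed.

Lemma std_normal_tail (R : realType) (e : R) : 0 < e ->
  exists2 M : R, 0 < M & fine (normal_prob 0 1 [set x : R | M < `|x|]) <= e.
Proof.
move=> e0; pose F (n : nat) := [set x : R | n.+1%:R < `|x|].
have mF n : measurable (F n) by exact: (measurable_norm_gt _ (measurable_id (D := setT))).
have F0 : \bigcap_n F n = set0.
  apply/seteqP; split => // x /(_ (Num.bound `|x|) Logic.I).
  rewrite /F/= ltNge => /negP; apply.
  apply: (le_trans (ltW (archi_boundP (normr_ge0 x)))); rewrite ler_nat.
  exact: leqnSn.
have ndF : nonincreasing_seq F.
  move=> m n mn; apply/subsetPset => x; rewrite /F/=; apply: le_lt_trans.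
  by rewrite ler_nat.
have := @nonincreasing_cvg_mu _ _ R (normal_prob 0 1) F.
rewrite F0 measure0 => /(_ _ mF measurable0 ndF) H.
have {H} : (normal_prob 0 1 \o F) x @[x --> \oo] --> (0%:E : \bar R).
  apply: H; have := @probability_le1 _ _ R (normal_prob 0 1) (F 0%N) (mF 0%N).
  by move=> /le_lt_trans; apply; exact: ltry.
move=> /fine_cvgP[_] /cvgrPdist_le /(_ e e0) [N _ HN].
exists N.+1%:R => //.
have := HN N (leqnn N); rewrite /= sub0r normrN ger0_norm//.
by rewrite fine_ge0.
Qed.

Lemma le_indic_tail (R : realType) (h : R -> R) (e M y z : R) : 0 <= e ->
  (forall z, 0 <= h z <= 1) -> (forall z, `|z| <= M -> y <= z -> h z <= e) ->
  h z <= \1_(`]-oo, y]) z + (e + \1_[set z : R | M < `|z|] z).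
Proof.
move=> e0 h01 hy; have /andP[hz0 hz1] := h01 z.
rewrite !indicE; have [zM|zM] := ltP M `|z|.
  rewrite [X in _ + (_ + X)](_ : _ = 1); last by rewrite mem_set.
  by clear hy h01; case: (_ \in _) => /=; lra.
have [zy|zy] := leP z y.
  rewrite (_ : z \in `]-oo, y]%classic = true); last by rewrite mem_set//= in_itv.
  by clear hy h01; case: (_ \in _) => /=; lra.
have := hy z zM (ltW zy); clear hy h01; case: (z \in _); case: (z \in _) => /=; lra.
Qed.

Lemma indic_le_tail (R : realType) (h : R -> R) (e M y z : R) : 0 <= e ->
  (forall z, 0 <= h z <= 1) -> (forall z, `|z| <= M -> z <= y -> 1 - e <= h z) ->
  \1_(`]-oo, y]) z <= h z + (e + \1_[set z : R | M < `|z|] z).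
Proof.
move=> e0 h01 hy; have /andP[hz0 hz1] := h01 z.
rewrite !indicE; have [zM|zM] := ltP M `|z|.
  rewrite [X in _ + (_ + X)](_ : _ = 1); last by rewrite mem_set.
  by clear hy h01; case: (_ \in _) => /=; lra.
have [zy|zy] := leP z y.
  by have := hy z zM zy; clear hy h01; case: (z \in _); case: (z \in _) => /=; lra.
rewrite (_ : z \in `]-oo, y]%classic = false).
  by clear hy h01; case: (_ \in _) => /=; lra.
by apply/negbTE; rewrite notin_setE/= in_itv/=; apply/negP; rewrite -ltNge.
Qed.

Lemma approx_le_lower (R : realFieldType) (a b c p e e' K : R) : `|a - b| < e' ->
  b <= c + 2 * e' * K -> p <= a + 2 * e' * K ->
  2 * e' * K + (2 * e' * K + e') = e -> p - e <= c.
Proof. by rewrite ltr_norml => /andP[]; lra. Qed.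

Lemma approx_le_upper (R : realFieldType) (a b c p e e' K : R) : `|a - b| < e' ->
  c <= b + 2 * e' * K -> a <= p + 2 * e' * K ->
  2 * e' * K + (2 * e' * K + e') = e -> c <= p + e.
Proof. by rewrite ltr_norml => /andP[]; lra. Qed.

(** * Convergence of joint distribution functions *)

Section CdfLimit.
Context (R : realType) (k : nat) (d : nat -> measure_display)
  (T : forall n, measurableType (d n)) (P : forall n, probability (T n) R).
Variable W : forall n, 'I_k -> T n -> R.
Hypothesis mW : forall n l, measurable_fun setT (@W n l).
Hypothesis cf_cvg : forall (t : 'I_k -> R) (s : R),
  (fun n => \int[P n]_w cos (\sum_l t l * @W n l w + s)) @ \oo -->
  expR (- (\sum_l t l ^+ 2) / 2) * cos s.
Hypothesis tight : forall e : R, 0 < e -> exists2 M : R, 0 < M & forall l,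
  \forall n \near \oo, fine (P n [set w | M < `|@W n l w|]) <= e.

Local Notation Ephi f := (\int[normal_prob 0 1]_x f x).
Local Notation Phi x := (fine (normal_prob (0 : R) 1 `]-oo, x])).

Lemma bounded_measurable_cos_affine (t b : R) :
  bounded_measurable (fun x : R => cos (t * x + b)).
Proof.
split; last by exists 1 => x; exact: cos_max.
apply: continuous_measurable_fun => x.
apply: continuous_comp; last exact: continuous_cos.
by apply: cvgD; [apply: cvgM; [exact: cvg_cst|exact: cvg_id]|exact: cvg_cst].
Qed.

Lemma trigpoly_bounded (f : R -> R) : trigpoly f -> bounded_measurable f.
Proof.
move=> [s /funext ->]; apply: bounded_measurable_sum => p.
apply: bounded_measurableM; first exact: bounded_measurable_cst.
exact: bounded_measurable_cos_affine.
Qed.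

Lemma trig_sum_normal s :
  Ephi (@trig_sum R s) = \sum_(p <- s) p.1.1 * (expR (- (p.1.2 ^+ 2 / 2)) * cos p.2).
Proof.
rewrite bounded_Rintegral_sum => [|p].
  apply: eq_bigr => p _; rewrite bounded_RintegralZ.
    by rewrite expectation_cos_std_normal.
  exact: bounded_measurable_cos_affine.
apply: bounded_measurableM; first exact: bounded_measurable_cst.
exact: bounded_measurable_cos_affine.
Qed.

Let comp_bounded n l (f : R -> R) : bounded_measurable f ->
  bounded_measurable (fun w => f (@W n l w)).
Proof.
move=> [mf [M fM]]; split; first exact: (measurableT_comp mf (@mW n l)).
by exists M => w; exact: fM.
Qed.

Let cos_bounded n (t : 'I_k -> R) s :
  bounded_measurable (fun w => cos (\sum_l t l * @W n l w + s)).
Proof.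
split; last by exists 1 => x; exact: cos_max.
have mc : measurable_fun setT (@cos R).
  by apply: continuous_measurable_fun; exact: continuous_cos.
apply: (measurableT_comp mc); apply: measurable_funD => //.
by apply: measurable_sum => l; exact: measurable_funM.
Qed.

(** Induction over the coordinates. The factor of coordinate [l] is a sum of cosines, and the
    product-to-sum formula moves each of them into the common cosine as the frequencies +u and -u at
    [l]. The frequency there was 0 before, so u^2 simply adds to the sum of squares, and the
    Gaussian limit factorizes over the coordinates. *)
Let trig_limit (r : seq 'I_k) : uniq r -> forall f : 'I_k -> R -> R,
  (forall l, trigpoly (f l)) -> forall (t : 'I_k -> R) s,
  (forall l, l \in r -> t l = 0) ->
  (fun n => \int[P n]_w (cos (\sum_l t l * @W n l w + s) *
                         \prod_(l <- r) f l (@W n l w))) @ \oo -->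
  expR (- (\sum_l t l ^+ 2) / 2) * cos s * \prod_(l <- r) Ephi (f l).
Proof.
elim: r => [_|l r IH /= /andP[lr ur]] f tf t s t0.
  under eq_fun do under eq_Rintegral do rewrite big_nil mulr1.
  by rewrite big_nil mulr1; exact: cf_cvg.
have [S fS] := tf l.
have bprod n : bounded_measurable (fun w => \prod_(l <- r) f l (@W n l w)).
  by apply: bounded_measurable_prod => j; apply: comp_bounded; exact: trigpoly_bounded.
pose tp (u : R) j := if j == l then u else t j.
have tpr u j : j \in r -> tp u j = 0.
  move=> jr; rewrite /tp; case: eqVneq => [jl|_]; first by rewrite -jl jr in lr.
  by rewrite t0// inE jr orbT.
have tl : t l = 0 by rewrite t0// inE eqxx.
have tpW n u w : \sum_j tp u j * @W n j w = \sum_j t j * @W n j w + u * @W n l w.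
  rewrite [LHS](bigD1 l)//= [in RHS](bigD1 l)//= tl mul0r add0r addrC.
  rewrite {2}/tp eqxx; congr (_ + _); apply: eq_bigr => j /negbTE jl.
  by rewrite /tp jl.
have tp2 u : \sum_j tp u j ^+ 2 = \sum_j t j ^+ 2 + u ^+ 2.
  rewrite [LHS](bigD1 l)//= [in RHS](bigD1 l)//= tl expr0n add0r addrC.
  rewrite {2}/tp eqxx; congr (_ + _); apply: eq_bigr => j /negbTE jl.
  by rewrite /tp jl.
pose I n u v := \int[P n]_w (cos (\sum_j tp u j * @W n j w + v) *
   \prod_(l <- r) f l (@W n l w)).
rewrite [X in X @ _ --> _](_ : _ = fun n => \sum_(p <- S) p.1.1 / 2 *
    (I n p.1.2 (s + p.2) + I n (- p.1.2) (s - p.2))); last first.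
  apply/funext => n; rewrite /I.
  have bI u v : bounded_measurable (fun w => cos (\sum_j tp u j * @W n j w + v) *
      \prod_(l <- r) f l (@W n l w)) by exact: bounded_measurableM.
  transitivity (\int[P n]_w (\sum_(p <- S) p.1.1 / 2 *
    (cos (\sum_j tp p.1.2 j * @W n j w + (s + p.2)) *
       \prod_(l <- r) f l (@W n l w) +
     cos (\sum_j tp (- p.1.2) j * @W n j w + (s - p.2)) *
       \prod_(l <- r) f l (@W n l w)))).
    apply: eq_Rintegral => w _; rewrite big_cons fS /trig_sum mulrA mulr_sumr mulr_suml.
    apply: eq_bigr => p _; rewrite !tpW.
    set A := \sum_j _; set Q := \prod_(_ <- _) _; set b := p.1.2 * _.
    have -> : A + b + (s + p.2) = (A + s) + (b + p.2) by ring.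
    have -> : A + - p.1.2 * @W n l w + (s - p.2) = (A + s) - (b + p.2).
      by rewrite /b; ring.
    by rewrite (cosD (A + s)) (cosB (A + s)); field.
  rewrite bounded_Rintegral_sum => [|p].
    apply: eq_bigr => p _; rewrite bounded_RintegralZ ?bounded_RintegralD//.
    exact: bounded_measurableD.
  apply: bounded_measurableM; first exact: bounded_measurable_cst.
  exact: bounded_measurableD.
rewrite big_cons (_ : Ephi (f l) = Ephi (trig_sum S)); last first.
  by apply: eq_Rintegral => x _; exact: fS.
rewrite trig_sum_normal.
set V := \sum_l t l ^+ 2; set Q := \prod_(_ <- _) _.
have -> : expR (- V / 2) * cos s *
  ((\sum_(p <- S) p.1.1 * (expR (- (p.1.2 ^+ 2 / 2)) * cos p.2)) * Q) =
  \sum_(p <- S) p.1.1 / 2 * (expR (- (V + p.1.2 ^+ 2) / 2) * cos (s + p.2) * Q +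
     expR (- (V + (- p.1.2) ^+ 2) / 2) * cos (s - p.2) * Q).
  rewrite mulrA mulr_sumr mulr_suml; apply: eq_bigr => p _.
  rewrite sqrrN (_ : - (V + p.1.2 ^+ 2) / 2 = - V / 2 + - (p.1.2 ^+ 2 / 2)); last by field.
  by rewrite expRD (cosD s) (cosB s); field.
apply: cvgr_sum => p; apply: cvgM; first exact: cvg_cst.
apply: cvgD; rewrite -tp2; apply: IH => //; exact: tpr.
Qed.

Lemma trigpoly_prod_cvg (f : 'I_k -> R -> R) : (forall l, trigpoly (f l)) ->
  (fun n => \int[P n]_w (\prod_l f l (@W n l w))) @ \oo --> \prod_l Ephi (f l).
Proof.
move=> tf.
have -> : (fun n => \int[P n]_w (\prod_l f l (@W n l w))) =
    (fun n => \int[P n]_w (cos (\sum_(l < k) 0 * @W n l w + 0) *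
      \prod_l f l (@W n l w))).
  apply/funext => n; apply: eq_Rintegral => w _.
  by rewrite [X in cos (X + 0)]big1 => [|l _]; rewrite ?mul0r// addr0 cos0 mul1r.
have -> : \prod_l Ephi (f l) =
    expR (- (\sum_(l < k) 0 ^+ 2) / 2) * cos 0 * \prod_l Ephi (f l).
  by rewrite [X in - X / 2]big1 => [|l _]; rewrite ?expr0n// oppr0 mul0r expR0 cos0 !mul1r.
exact: (@trig_limit _ (index_enum_uniq _) f tf (fun=> 0) 0 (fun _ _ => erefl)).
Qed.

(** A trigonometric polynomial needs a gap in which to descend from 1 to 0. The gap has width e and
    lies above [x l] for the upper bound and below it for the lower one, hence the shifted
    arguments. *)
Lemma cdf_sandwich (x : 'I_k -> R) (e : R) : 0 < e ->
  \forall n \near \oo,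
    \prod_l Phi (x l - e) - e <= fine (P n [set w | forall l, @W n l w <= x l])
    <= \prod_l Phi (x l + e) + e.
Proof.
(* Replacing indicators by polynomials costs 2 e' in each of the k factors, once under [P n] and
   once under the normal law; the convergence costs one more e'. *)
move=> e0; pose e' := e / (4 * k%:R + 1).
have k0 : 0 < 4 * k%:R + 1 :> R by rewrite ltr_wpDl// mulr_ge0.
have e'0 : 0 < e' by rewrite divr_gt0.
have e'E : 2 * e' * k%:R + (2 * e' * k%:R + e') = e.
  by rewrite /e'; field; rewrite gt_eqF.
have [M1 M10 HM1] := tight e'0; have [M2 M20 HM2] := std_normal_tail e'0.
(* Large enough for both tails to be at most e' and for all the points x l - e and x l + e to lie in
   [-M, M]. *)
pose M := M1 + M2 + \sum_l (`|x l| + e).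
have S0 l : `|x l| + e <= \sum_l (`|x l| + e).
  rewrite (bigD1 l)//= lerDl; apply: sumr_ge0 => j _.
  by rewrite addr_ge0// ltW.
have Sge0 : 0 <= \sum_l (`|x l| + e).
  by apply: sumr_ge0 => j _; rewrite addr_ge0// ltW.
have M0 : 0 < M by rewrite /M; lra.
have MM1 : M1 <= M by rewrite /M; lra.
have MM2 : M2 <= M by rewrite /M; lra.
have xM l : - M <= x l - e /\ x l + e <= M.
  have := S0 l; have := ler_norm (x l); have := ler_norm (- x l); rewrite normrN /M.
  by split; lra.
have fup l : exists f, [/\ trigpoly f, forall z, 0 <= f z <= 1,
    forall z, `|z| <= M -> z <= x l -> 1 - e' <= f z &
    forall z, `|z| <= M -> x l + e <= z -> f z <= e'].
  by have [h1 h2] := xM l; apply: trigpoly_step_approx => //; lra.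
have flo l : exists f, [/\ trigpoly f, forall z, 0 <= f z <= 1,
    forall z, `|z| <= M -> z <= x l - e -> 1 - e' <= f z &
    forall z, `|z| <= M -> x l <= z -> f z <= e'].
  by have [h1 h2] := xM l; apply: trigpoly_step_approx => //; lra.
have [f Hf] := choice fup; have [g Hg] := choice flo.
have mtail n l : measurable [set w | M < `|@W n l w|].
  exact: measurable_norm_gt.
have mlow n l (y : R) : measurable [set w | @W n l w <= y].
  exact: measurable_le_cst.
have mtailN : measurable [set z : R | M < `|z|].
  exact: (measurable_norm_gt _ (measurable_id (D := setT))).
have tailN : fine (normal_prob 0 1 [set z : R | M < `|z|]) <= e'.
  apply: le_trans HM2; apply: fine_le; rewrite ?fin_num_measure//.
    exact: (measurable_norm_gt _ (measurable_id (D := setT))).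
  apply: le_measure; rewrite ?inE//.
    exact: (measurable_norm_gt _ (measurable_id (D := setT))).
  by move=> z /=; exact: le_lt_trans.
near=> n.
have tailW l : fine (P n [set w | M < `|@W n l w|]) <= e'.
  apply: (@le_trans _ _ (fine (P n [set w | M1 < `|@W n l w|]))); last first.
    by move: l; near: n; apply: filter_forall => l; exact: HM1.
  apply: fine_le; rewrite ?fin_num_measure//; try exact: measurable_norm_gt.
  apply: le_measure; rewrite ?inE//; try exact: measurable_norm_gt.
  by move=> z /=; exact: le_lt_trans.
have HF : `|\prod_l Ephi (f l) - \int[P n]_w (\prod_l f l (@W n l w))| < e'.
  near: n; apply: (cvgrPdist_lt _ _).1 e'0.
  by apply: trigpoly_prod_cvg => l; case: (Hf l).
have HG : `|\prod_l Ephi (g l) - \int[P n]_w (\prod_l g l (@W n l w))| < e'.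
  near: n; apply: (cvgrPdist_lt _ _).1 e'0.
  by apply: trigpoly_prod_cvg => l; case: (Hg l).
have PE : fine (P n [set w | forall l, @W n l w <= x l]) =
    \int[P n]_w (\prod_l \1_[set w | @W n l w <= x l] w).
  rewrite -Rintegral_indic; last first.
    rewrite (_ : [set w | _] = \bigcap_(l in [set: 'I_k]) [set w | @W n l w <= x l]).
      by apply: fin_bigcap_measurable.
    by apply/seteqP; split => [w wx l _|w wx l]; [exact: wx|exact: wx].
  apply: eq_Rintegral => w _; rewrite indicE.
  case: (boolP (w \in _)) => [/set_mem wx|wx].
    by rewrite big1// => l _; rewrite indicE mem_set//; exact: wx.
  have [l Hl] : exists l, ~ (@W n l w <= x l).
    by apply/existsNP => H; move/negP: wx; apply; exact: mem_set.
  by rewrite (bigD1 l)//= indicE memNset// mul0r.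
have ind01 (U : Type) (A : set U) (u : U) : 0 <= (\1_A u : R) <= 1.
  by rewrite indicE; case: (_ \in _); rewrite ?ler01 ?lexx.
have PhiE y : Phi y = \int[normal_prob 0 1]_z (\1_(`]-oo, y]) z : R).
  by rewrite Rintegral_indic.
have EN (a b : R -> R) : bounded_measurable a -> bounded_measurable b ->
    (forall z, a z <= b z + (e' + \1_[set z : R | M < `|z|] z)) ->
    \int[normal_prob 0 1]_z a z <= \int[normal_prob 0 1]_z b z + 2 * e'.
  move=> ba bb abz; have bi : bounded_measurable (\1_[set z : R | M < `|z|] : R -> R).
    exact: bounded_measurable_indic.
  have be : bounded_measurable (fun z : R => e' + \1_[set z : R | M < `|z|] z).
    by apply: bounded_measurableD => //; exact: bounded_measurable_cst.
  apply: (@le_trans _ _ (\int[normal_prob 0 1]_z (b z + (e' + \1_[set z : R | M < `|z|] z)))).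
    by apply: bounded_le_Rintegral => //; exact: bounded_measurableD.
  rewrite bounded_RintegralD// lerD2l bounded_RintegralD//; last exact: bounded_measurable_cst.
  by rewrite probability_Rintegral_cst Rintegral_indic//; lra.
have Phi01 y : 0 <= Phi y <= 1.
  rewrite fine_ge0//= -lee_fin fineK ?fin_num_measure//.
  exact: probability_le1.
have Ephi01 (h : R -> R) : trigpoly h -> (forall z, 0 <= h z <= 1) -> 0 <= Ephi h <= 1.
  move=> th h01; have bh := @trigpoly_bounded h th; apply/andP; split.
    by apply: Rintegral_ge0 => z _; case/andP: (h01 z).
  rewrite -[leRHS](probability_Rintegral_cst (normal_prob 0 1)).
  apply: bounded_le_Rintegral; first exact: bh.
    exact: bounded_measurable_cst.
  by move=> z; case/andP: (h01 z).
have inW l w : (\1_(`]-oo, x l]) (@W n l w) : R) = \1_[set w | @W n l w <= x l] w.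
  rewrite !indicE; congr (_ %:R).
have intail l w : (\1_[set z : R | M < `|z|] (@W n l w) : R) =
    \1_[set w | M < `|@W n l w|] w.
  rewrite !indicE; congr (_ %:R).
apply/andP; split.
- rewrite PE.
  have h1 : \int[P n]_w (\prod_l g l (@W n l w)) <=
      \int[P n]_w (\prod_l \1_[set w | @W n l w <= x l] w) + 2 * e' * #|'I_k|%:R.
    apply: (Rintegral_prod_le (A := fun l => [set w | M < `|@W n l w|])) => //.
    + by move=> l; apply/comp_bounded/trigpoly_bounded; case: (Hg l).
    + by move=> l; exact: bounded_measurable_indic.
    + exact: ltW.
    + by move=> l w; case: (Hg l).
    + move=> l w; have [_ g01 _ gx] := Hg l.
      by have := le_indic_tail (@W n l w) (ltW e'0) g01 gx; rewrite inW intail.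
  have h2 : \prod_l Phi (x l - e) <= \prod_l Ephi (g l) + \sum_(l < k) (2 * e').
    apply: prod_le_prodD => l //.
    + by have [tg g01 _ _] := Hg l; exact: Ephi01.
    + by rewrite mulr_ge0// ltW.
    + rewrite PhiE; apply: EN.
      * exact: bounded_measurable_indic.
      * by apply/trigpoly_bounded; case: (Hg l).
      * by move=> z; have [_ g01 gx _] := Hg l; exact: (indic_le_tail z (ltW e'0) g01 gx).
  rewrite sumr_const card_ord -(mulr_natr (2 * e') k) in h2; rewrite card_ord in h1.
  exact: (approx_le_lower HG h1 h2 e'E).
- rewrite PE.
  have h1 : \int[P n]_w (\prod_l \1_[set w | @W n l w <= x l] w) <=
      \int[P n]_w (\prod_l f l (@W n l w)) + 2 * e' * #|'I_k|%:R.
    apply: (Rintegral_prod_le (A := fun l => [set w | M < `|@W n l w|])) => //.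
    + by move=> l; exact: bounded_measurable_indic.
    + by move=> l; apply/comp_bounded/trigpoly_bounded; case: (Hf l).
    + exact: ltW.
    + by move=> l w; case: (Hf l).
    + move=> l w; have [_ f01 fx _] := Hf l.
      by have := indic_le_tail (@W n l w) (ltW e'0) f01 fx; rewrite inW intail.
  have h2 : \prod_l Ephi (f l) <= \prod_l Phi (x l + e) + \sum_(l < k) (2 * e').
    apply: prod_le_prodD => l //.
    + by have [tf f01 _ _] := Hf l; exact: Ephi01.
    + by rewrite mulr_ge0// ltW.
    + rewrite PhiE; apply: EN.
      * by apply/trigpoly_bounded; case: (Hf l).
      * exact: bounded_measurable_indic.
      * by move=> z; have [_ f01 _ fx] := Hf l; exact: (le_indic_tail z (ltW e'0) f01 fx).
  rewrite sumr_const card_ord -(mulr_natr (2 * e') k) in h2; rewrite card_ord in h1.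
  exact: (approx_le_upper HF h1 h2 e'E).
Unshelve. all: by end_near. Qed.

End CdfLimit.

(** * Deterministic analysis of the likelihood equations *)

Section Consistency.
Variables (R : realType) (I : finType) (N : nat).
Hypothesis cardI : #|I| = N.+1.
Hypothesis N3 : (3 <= N)%N.
Variables (q Q : R) (t : I -> I -> R).
Hypothesis q0 : 0 < q.
Hypothesis qQ : q <= Q.
Hypothesis tqQ : forall i j, i != j -> q <= t i j <= Q.

Let Q0 : 0 < Q. Proof. exact: lt_le_trans qQ. Qed.

Lemma sum_neq_const (i : I) (c : R) : \sum_(j | j != i) c = c * N%:R.
Proof. by rewrite sumr_const cardC1 cardI mulr_natr. Qed.

Lemma exists_max (f : I -> R) : exists i, forall j, f j <= f i.
Proof.
have /card_gt0P[i0 _] : (0 < #|I|)%N by rewrite cardI.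
by case: (arg_maxP f (i0 := i0) (P := xpredT)) => // i _ Hi; exists i => j; exact: Hi.
Qed.

Lemma exists_min (f : I -> R) : exists i, forall j, f i <= f j.
Proof.
by have [i Hi] := exists_max (fun j => - f j); exists i => j; rewrite -lerN2.
Qed.

Let f (s x : R) := s^-1 - (s + x)^-1.

Let fE s x : 0 < s -> 0 < s + x -> f s x = x / (s * (s + x)).
Proof. by move=> s0 sx; rewrite /f; field; rewrite !gt_eqF. Qed.

(** As [f s x] never exceeds 1 / s, a lower bound linear in r requires r to be bounded; r <= Q is
    what the estimate r (s + x) <= 2 Q x uses. *)
Let f_large s x r : q <= s <= Q -> 0 <= r <= Q -> r <= x -> r / (2 * Q ^+ 2) <= f s x.
Proof.
move=> /andP[qs sQ] /andP[r0 rQ] rx.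
have s0 : 0 < s by exact: lt_le_trans qs.
have x0 : 0 <= x by exact: le_trans rx.
rewrite fE ?ltr_wpDr// ler_pdivrMr ?mulr_gt0 ?exprn_gt0//.
rewrite mulrAC ler_pdivlMr ?mulr_gt0 ?ltr_wpDr//.
have h1 : r * (s + x) <= x * (2 * Q) by nra.
have h2 : r * (s + x) * s <= x * (2 * Q) * Q.
  by apply: ler_pM => //; rewrite ?mulr_ge0 ?addr_ge0// ltW.
by nra.
Qed.

Let f_neg s x r : q <= s <= Q -> 0 < s + x -> 0 <= r -> x <= - r -> f s x <= - (r / Q ^+ 2).
Proof.
move=> /andP[qs sQ] sx r0 xr.
have s0 : 0 < s by exact: lt_le_trans qs.
rewrite fE// -lerN2 opprK -mulNr ler_pdivrMr ?exprn_gt0//.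
rewrite mulrAC ler_pdivlMr ?mulr_gt0//.
apply: ler_pM => //; first by rewrite mulr_ge0// ltW.
  by lra.
by rewrite expr2; apply: ler_pM; lra.
Qed.

Let f_ge s x r : q <= s <= Q -> 0 < s + x -> 0 <= r <= q / 2 -> - r <= x ->
  - (2 * r / q ^+ 2) <= f s x.
Proof.
move=> /andP[qs sQ] sx /andP[r0 rq] xr.
have s0 : 0 < s by exact: lt_le_trans qs.
rewrite fE// lerNl -mulNr ler_pdivrMr ?mulr_gt0//.
rewrite mulrAC ler_pdivlMr ?exprn_gt0//.
apply: (@le_trans _ _ (r * q ^+ 2)); first (apply: ler_wpM2r; [by rewrite exprn_ge0// ltW|lra]).
have : q / 2 <= s + x by lra.
move=> h; have {}h : q * (q / 2) <= s * (s + x) by apply: ler_pM; lra.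
by have := ler_wpM2l r0 h; lra.
Qed.

Let f_le s x r : q <= s <= Q -> 0 < s + x -> 0 <= r -> x <= r ->
  f s x <= r / q ^+ 2.
Proof.
move=> /andP[qs sQ] sx r0 xr.
have s0 : 0 < s by exact: lt_le_trans qs.
have [x0|x0] := lerP x 0.
  rewrite fE//; apply: (@le_trans _ _ 0); last by apply: divr_ge0 => //; apply: exprn_ge0; exact: ltW.
  by apply: mulr_le0_ge0 => //; rewrite invr_ge0; apply: mulr_ge0; exact: ltW.
rewrite fE// ler_pdivrMr ?mulr_gt0// mulrAC ler_pdivlMr ?exprn_gt0//.
apply: ler_pM => //; [exact: ltW|by rewrite exprn_ge0 ?ltW|].
rewrite expr2; apply: ler_pM => //; [exact: ltW|exact: ltW|].
by rewrite (le_trans qs)// lerDl ltW.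
Qed.

Variables (al be D B : I -> R) (E : R).
Local Notation x i j := (al i + be j).
Hypothesis tx : forall i j, i != j -> 0 < t i j + x i j.
Hypothesis row_eq : forall i, \sum_(j | j != i) f (t i j) (x i j) = - D i.
Hypothesis col_eq : forall j, \sum_(i | i != j) f (t i j) (x i j) = - B j.
Hypothesis E0 : 0 < E.
Hypothesis DE : forall i, `|D i| <= E.
Hypothesis BE : forall j, `|B j| <= E.

(** Scale calibrated so that a row or column whose entries all exceed rho has sum at least 2 E, and
    at most - 4 E if all lie below - rho. Both contradict the likelihood equations. *)
Let rho := 4 * Q ^+ 2 * E / N%:R.
Let kap := Q / q.
Let Lam := 16 * kap ^+ 2 * rho.
(** An oscillation of 2 [Lam] is allowed for [al], and the third [Lam] absorbs [rho]. Unfolded, the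
    radius is 192 (Q/q)^2 Q^2 E / N. *)
Definition sup_radius := 3 * Lam.
Hypothesis small : sup_radius <= q / 2.

Let NR : 3 <= N%:R :> R. Proof. by rewrite (ler_nat R 3). Qed.
Let N0 : 0 < N%:R :> R. Proof. by apply: lt_le_trans NR. Qed.
Let rho0 : 0 < rho. Proof. by rewrite divr_gt0// !mulr_gt0// exprn_gt0. Qed.
Let kap1 : 1 <= kap. Proof. by rewrite ler_pdivlMr// mul1r. Qed.
Let rhoLam : 16 * rho <= Lam.
Proof.
rewrite /Lam -mulrA ler_wpM2l//; apply: ler_peMl; first exact: ltW.
exact: exprn_ege1.
Qed.
Let rhoE : rho * N%:R = 4 * Q ^+ 2 * E.
Proof. by rewrite /rho; field; rewrite gt_eqF. Qed.
Let Lam_small : Lam <= q / 6. Proof. by move: small; rewrite /sup_radius; lra. Qed.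

Let rho_leQ : 0 <= rho <= Q.
Proof.
rewrite (ltW rho0)/=; have := rhoLam; have := Lam_small; have := q0; have := qQ.
have := rho0; lra.
Qed.

Let sum_ge (i : I) (F : I -> R) (c : R) :
  (forall j, j != i -> c <= F j) -> c * N%:R <= \sum_(j | j != i) F j.
Proof. by move=> h; rewrite -(sum_neq_const i); apply: ler_sum. Qed.

Let sum_le (i : I) (F : I -> R) (c : R) :
  (forall j, j != i -> F j <= c) -> \sum_(j | j != i) F j <= c * N%:R.
Proof. by move=> h; rewrite -(sum_neq_const i); apply: ler_sum. Qed.

Let big1E : rho / (2 * Q ^+ 2) * N%:R = 2 * E.
Proof. by rewrite mulrAC rhoE; field; rewrite gt_eqF. Qed.

Let big2E : rho / Q ^+ 2 * N%:R = 4 * E.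
Proof. by rewrite mulrAC rhoE; field; rewrite gt_eqF. Qed.

Let boundE (z : R) : `|z| <= E -> - z <= E /\ - E <= - z.
Proof. by rewrite ler_norml => /andP[? ?]; split; lra. Qed.

Let not_all_large_row i : ~ (forall j, j != i -> rho < x i j).
Proof.
move=> H; have : rho / (2 * Q ^+ 2) * N%:R <= \sum_(j | j != i) f (t i j) (x i j).
  apply: sum_ge => j ji; apply: f_large; [by apply: tqQ; rewrite eq_sym|exact: rho_leQ|exact/ltW/H].
by rewrite row_eq big1E; have [? _] := boundE (DE i); have := E0; lra.
Qed.

Let not_all_large_col j : ~ (forall i, i != j -> rho < x i j).
Proof.
move=> H; have : rho / (2 * Q ^+ 2) * N%:R <= \sum_(i | i != j) f (t i j) (x i j).
  apply: sum_ge => i ij; apply: f_large; [exact: tqQ|exact: rho_leQ|exact/ltW/H].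
by rewrite col_eq big1E; have [? _] := boundE (BE j); have := E0; lra.
Qed.

Let not_all_neg_row i : ~ (forall j, j != i -> x i j < - rho).
Proof.
move=> H; have : \sum_(j | j != i) f (t i j) (x i j) <= - (rho / Q ^+ 2) * N%:R.
  apply: sum_le => j ji; rewrite eq_sym in ji.
  by apply: f_neg; [exact: tqQ|exact: tx|exact: ltW|apply/ltW/H; rewrite eq_sym].
by rewrite row_eq mulNr big2E; have [_ ?] := boundE (DE i); have := E0; lra.
Qed.

Let not_all_neg_col j : ~ (forall i, i != j -> x i j < - rho).
Proof.
move=> H; have : \sum_(i | i != j) f (t i j) (x i j) <= - (rho / Q ^+ 2) * N%:R.
  apply: sum_le => i ij.
  by apply: f_neg; [exact: tqQ|exact: tx|exact: ltW|exact/ltW/H].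
by rewrite col_eq mulNr big2E; have [_ ?] := boundE (BE j); have := E0; lra.
Qed.

(** The entry of largest [al] and smallest [be] is maximal in its column and minimal in its row, so
    neither can be uniformly beyond rho and the entry lies in [-rho, rho]; likewise with the roles
    exchanged. This holds even if the entry is diagonal, where no equation constrains it. It remains
    to bound the oscillation of [al], by comparing its two extreme rows column by column. *)
Lemma mle_sup_bound i0 j0 : `|x i0 j0| <= sup_radius.
Proof.
have [i1 Hi1] := exists_max al; have [i2 Hi2] := exists_min al.
have [j1 Hj1] := exists_max be; have [j2 Hj2] := exists_min be.
have Y1 : - rho <= al i1 + be j2 <= rho.
  apply/andP; split; rewrite leNgt; apply/negP => H.
    apply: (@not_all_neg_col j2) => l _; apply: le_lt_trans H.
    by rewrite lerD2r.
  by apply: (@not_all_large_row i1) => l _; apply: (lt_le_trans H); rewrite lerD2l.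
have Y2 : - rho <= al i2 + be j1 <= rho.
  apply/andP; split; rewrite leNgt; apply/negP => H.
    by apply: (@not_all_neg_row i2) => l _; apply: le_lt_trans H; rewrite lerD2l.
  by apply: (@not_all_large_col j1) => l _; apply: (lt_le_trans H); rewrite lerD2r.
have osc : al i1 - al i2 <= 2 * Lam.
  have [<-|i12] := eqVneq i1 i2; first by rewrite subrr; have := rhoLam; have := rho0; lra.
  rewrite leNgt; apply/negP => H.
  have LamQ : 0 <= Lam <= Q.
    by have := rhoLam; have := rho0; have := Lam_small; have := q0; have := qQ;
      move=> *; apply/andP; lra.
  have rhoq : 0 <= rho <= q / 2.
    by have := rhoLam; have := rho0; have := Lam_small; have := q0;
      move=> *; apply/andP; lra.
  have tneq k l : k != l -> q <= t k l <= Q /\ 0 < t k l + x k l.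
    by move=> kl; split; [exact: tqQ|exact: tx].
  pose a := rho / q ^+ 2.
  have a0 : 0 < a by rewrite divr_gt0// exprn_gt0.
  have LamE : Lam / (2 * Q ^+ 2) = 8 * a.
    by rewrite /a /Lam /kap; field; rewrite !gt_eqF.
  have low1 j : i1 != j -> - (2 * a) <= f (t i1 j) (x i1 j).
    move=> /tneq[tj txj]; rewrite mulrA; apply: f_ge => //.
    by case/andP: Y1 => y1 _; apply: (le_trans y1); rewrite lerD2l.
  have up2 j : i2 != j -> f (t i2 j) (x i2 j) <= a.
    move=> /tneq[tj txj]; apply: f_le => //; first exact: ltW.
    by case/andP: Y2 => _ y2; apply: le_trans y2; rewrite lerD2l.
  (* The two entries differ by more than 2 [Lam], so either the first is at least [Lam] and its [f]
     at least 8 a, or the second is at most - [Lam] and its [f] at most - 16 a. The bounds [low1]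
     and [up2] handle the other entry. *)
  have gap j : j != i1 -> j != i2 ->
      6 * a <= f (t i1 j) (x i1 j) - f (t i2 j) (x i2 j).
    rewrite !(eq_sym j) => ji1 ji2.
    have := low1 _ ji1; have := up2 _ ji2.
    have [t1 tx1] := tneq _ _ ji1; have [t2 tx2] := tneq _ _ ji2.
    have [xL|xL] := lerP Lam (x i1 j).
      by have := f_large t1 LamQ xL; rewrite LamE; lra.
    have {}xL : x i2 j <= - Lam by lra.
    have := f_neg t2 tx2 (_ : 0 <= Lam) xL; case/andP: LamQ => -> _ /(_ isT).
    have -> : Lam / Q ^+ 2 = 16 * a by rewrite /a /Lam /kap; field; rewrite !gt_eqF.
    by lra.
  have := row_eq i1; rewrite (bigD1 i2) 1?eq_sym//= => r1.
  have := row_eq i2; rewrite (bigD1 i1)//= => r2.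
  have r3 : \sum_(j | (j != i2) && (j != i1)) f (t i2 j) (x i2 j) =
      \sum_(j | (j != i1) && (j != i2)) f (t i2 j) (x i2 j).
    by apply: eq_bigl => j; rewrite andbC.
  have : \sum_(j | (j != i1) && (j != i2)) (6 * a) <=
      \sum_(j | (j != i1) && (j != i2)) (f (t i1 j) (x i1 j) - f (t i2 j) (x i2 j)).
    by apply: ler_sum => j /andP[]; exact: gap.
  rewrite sumrB.
  have -> : \sum_(j | (j != i1) && (j != i2)) (6 * a) = 6 * a * N%:R - 6 * a.
    rewrite -(sum_neq_const i1) [in RHS](bigD1 i2) 1?eq_sym//=.
    by rewrite addrAC subrr add0r.
  have l12 := low1 _ i12; have := up2 i1; rewrite eq_sym => /(_ i12) u21.
  have [d1 _] := boundE (DE i1).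
  have [_ d2] := boundE (DE i2).
  have E2 : 2 * E <= a * N%:R / 2.
    have h : rho / (2 * Q ^+ 2) <= a / 2.
      have -> : rho / (2 * Q ^+ 2) = rho / Q ^+ 2 / 2 by field; rewrite gt_eqF.
      rewrite ler_wpM2r// ler_wpM2l ?(ltW rho0)// lef_pV2 ?posrE ?exprn_gt0//.
      by rewrite lerXn2r// nnegrE ltW.
    by rewrite -big1E; have := ler_wpM2r (ltW N0) h; lra.
  (* The row sums differ by at least 6 a (N - 1) - 3 a, where - 3 a accounts for the two columns
     outside the comparison. For N >= 3 this exceeds a N / 2, an upper bound of 2 E. *)
  have aN : 3 * a <= a * N%:R by rewrite mulrC ler_wpM2l// ltW.
  rewrite r3 in r2; move: r1 r2 l12 u21 d1 d2 E2 aN a0.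
  set S1 := \sum_(_ | _) _; set S2 := \sum_(_ | _) _.
  lra.
have := Hi1 i0; have := Hi2 i0; have := Hj1 j0; have := Hj2 j0.
have := rhoLam; rewrite ler_norml /sup_radius.
move: Y1 Y2 => /andP[? ?] /andP[? ?] *; apply/andP; split; lra.
Qed.

End Consistency.

(** * Linearized likelihood equations and contraction *)

Section Linearization.
Variables (R : realType) (I : finType) (N : nat).
Hypothesis cardI : #|I| = N.+1.
Hypothesis N3 : (3 <= N)%N.
Variables (q Q : R) (t : I -> I -> R).
Hypothesis q0 : 0 < q.
Hypothesis qQ : q <= Q.
Hypothesis tqQ : forall i j, i != j -> q <= t i j <= Q.
Variables (al be D B : I -> R) (tau : R).
Local Notation x i j := (al i + be j).
Hypothesis tau_small : tau <= q / 2.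
Hypothesis x_tau : forall i j, `|x i j| <= tau.
Hypothesis row_eq : forall i,
  \sum_(j | j != i) ((t i j)^-1 - (t i j + x i j)^-1) = - D i.
Hypothesis col_eq : forall j,
  \sum_(i | i != j) ((t i j)^-1 - (t i j + x i j)^-1) = - B j.

Let u i j := (t i j ^+ 2)^-1.
Let v i := \sum_(j | j != i) u i j.
Let w j := \sum_(i | i != j) u i j.
Let eps := 2 * tau ^+ 2 / q.

Let NR : 3 <= N%:R :> R. Proof. by rewrite (ler_nat R 3). Qed.
Let N0 : 0 < N%:R :> R. Proof. by apply: lt_le_trans NR. Qed.
Let Q0 : 0 < Q. Proof. exact: lt_le_trans qQ. Qed.
Let t0 i j : i != j -> 0 < t i j.
Proof. by move=> /tqQ /andP[+ _]; exact: lt_le_trans. Qed.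

Let u_bounds i j : i != j -> (Q ^+ 2)^-1 <= u i j <= (q ^+ 2)^-1.
Proof.
move=> ij; have /andP[h1 h2] := tqQ ij.
by rewrite /u !lef_pV2 ?posrE ?exprn_gt0 ?t0// !lerXn2r// nnegrE ltW// t0.
Qed.

Let u0 i j : i != j -> 0 < u i j.
Proof. by move=> ij; rewrite invr_gt0 exprn_gt0// t0. Qed.

Lemma v_bounds i : N%:R / Q ^+ 2 <= v i <= N%:R / q ^+ 2.
Proof.
rewrite !(mulrC N%:R) -!(sum_neq_const cardI i).
by apply/andP; split; apply: ler_sum => j ji; rewrite eq_sym in ji;
  case/andP: (u_bounds ji).
Qed.

Lemma w_bounds j : N%:R / Q ^+ 2 <= w j <= N%:R / q ^+ 2.
Proof.
rewrite !(mulrC N%:R) -!(sum_neq_const cardI j).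
by apply/andP; split; apply: ler_sum => i ij; case/andP: (u_bounds ij).
Qed.

Let v0 i : 0 < v i.
Proof.
by case/andP: (v_bounds i) => + _; apply: lt_le_trans; rewrite divr_gt0// exprn_gt0.
Qed.

Let w0 i : 0 < w i.
Proof.
by case/andP: (w_bounds i) => + _; apply: lt_le_trans; rewrite divr_gt0// exprn_gt0.
Qed.

(** The weights of [A i], and those of [A' j], sum to 1: both are averages, which preserve
    constants, order and sup bounds. *)
Let A i (h : I -> R) := \sum_(j | j != i) u i j / v i * h j.
Let A' j (h : I -> R) := \sum_(i | i != j) u i j / w j * h i.

Let A_cst i c : A i (fun=> c) = c.
Proof.
rewrite /A -mulr_suml -mulr_suml -/(v i) divff ?mul1r//.
by rewrite gt_eqF.
Qed.

Let A'_cst i c : A' i (fun=> c) = c.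
Proof.
rewrite /A' -mulr_suml -mulr_suml -/(w i) divff ?mul1r//.
by rewrite gt_eqF.
Qed.

Let A_le i g h : (forall j, g j <= h j) -> A i g <= A i h.
Proof.
move=> gh; apply: ler_sum => j ji; rewrite ler_wpM2l// divr_ge0 ?ltW//.
by rewrite u0// eq_sym.
Qed.

Let A'_le i g h : (forall j, g j <= h j) -> A' i g <= A' i h.
Proof. by move=> gh; apply: ler_sum => j ji; rewrite ler_wpM2l// divr_ge0 ?ltW// u0. Qed.

Let A_norm i h c : (forall j, `|h j| <= c) -> `|A i h| <= c.
Proof.
move=> hc; rewrite ler_norml -{1}(A_cst i (- c)) -{2}(A_cst i c).
by apply/andP; split; apply: A_le => j; have := hc j; rewrite ler_norml => /andP[].
Qed.

Let A'_norm i h c : (forall j, `|h j| <= c) -> `|A' i h| <= c.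
Proof.
move=> hc; rewrite ler_norml -{1}(A'_cst i (- c)) -{2}(A'_cst i c).
by apply/andP; split; apply: A'_le => j; have := hc j; rewrite ler_norml => /andP[].
Qed.

Let AD i g h : A i (fun j => g j + h j) = A i g + A i h.
Proof. by rewrite /A -big_split/=; apply: eq_bigr => j _; rewrite mulrDr. Qed.

Let AN i g : A i (fun j => - g j) = - A i g.
Proof. by rewrite /A -sumrN; apply: eq_bigr => j _; rewrite mulrN. Qed.

Let A'D i g h : A' i (fun j => g j + h j) = A' i g + A' i h.
Proof. by rewrite /A' -big_split/=; apply: eq_bigr => j _; rewrite mulrDr. Qed.

Let A'N i g : A' i (fun j => - g j) = - A' i g.
Proof. by rewrite /A' -sumrN; apply: eq_bigr => j _; rewrite mulrN. Qed.

(** This is the exact remainder of 1/t - 1/(t + x) after its linear term u x. Since |x| <= tau and t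
    + x >= q / 2, it is at most u eps. *)
Let rem i j := u i j * (x i j ^+ 2 / (t i j + x i j)).

Let remE i j : i != j ->
  (t i j)^-1 - (t i j + x i j)^-1 = u i j * (al i + be j) - rem i j.
Proof.
move=> ij; have ht := t0 ij; have /andP[htq _] := tqQ ij.
have htx : 0 < t i j + x i j.
  by have := x_tau i j; have := tau_small; have := q0; rewrite ler_norml => ? ? /andP[? ?]; lra.
by rewrite /rem /u; field; rewrite !gt_eqF.
Qed.

Let rem_le i j : i != j -> `|rem i j| <= u i j * eps.
Proof.
move=> ij; have ht := t0 ij; have /andP[htq _] := tqQ ij.
have hx := x_tau i j.
have htx : q / 2 <= t i j + x i j.
  by have := tau_small; have := q0; move: hx; rewrite ler_norml => /andP[? ?] ? ?; lra.
have htx0 : 0 < t i j + x i j by apply: lt_le_trans htx; rewrite divr_gt0.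
have tau0 : 0 <= tau by apply: le_trans hx.
have uij := ltW (u0 ij).
rewrite /rem normrM (ger0_norm uij); apply: ler_wpM2l => //.
rewrite normrM normrX [X in _ * X]gtr0_norm ?invr_gt0// /eps.
have -> : 2 * tau ^+ 2 / q = tau ^+ 2 * (q / 2)^-1 by field; rewrite gt_eqF.
apply: ler_pM.
- by rewrite exprn_ge0.
- by rewrite invr_ge0 ltW.
- by rewrite lerXn2r// nnegrE.
- by rewrite lef_pV2// posrE// divr_gt0.
Qed.

Let r i := (\sum_(j | j != i) rem i j) / v i.
Let r' j := (\sum_(i | i != j) rem i j) / w j.

Let r_le i : `|r i| <= eps.
Proof.
rewrite normrM [X in _ * X]gtr0_norm ?invr_gt0// ler_pdivrMr// mulrC.
apply: (le_trans (ler_norm_sum _ _ _)); rewrite /v mulr_suml.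
by apply: ler_sum => j ji; apply: rem_le; rewrite eq_sym.
Qed.

Let r'_le i : `|r' i| <= eps.
Proof.
rewrite normrM [X in _ * X]gtr0_norm ?invr_gt0// ler_pdivrMr// mulrC.
apply: (le_trans (ler_norm_sum _ _ _)); rewrite /w mulr_suml.
by apply: ler_sum => j ji; exact: rem_le.
Qed.

Let al_eq i : al i = - (D i / v i) + (- A i be + r i).
Proof.
have vi : v i != 0 by rewrite gt_eqF.
have H : v i * al i + v i * A i be - v i * r i = - D i.
  rewrite -row_eq (eq_bigr (fun j => u i j * al i + u i j * be j - rem i j)).
    rewrite sumrB big_split/= -mulr_suml -/(v i); congr (_ + _ - _).
      rewrite /A mulr_sumr; apply: eq_bigr => j _; field; exact: vi.
    by rewrite /r mulrC divfK.
  by move=> j ji; rewrite remE 1?eq_sym// mulrDr.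
have -> : D i = - (v i * al i + v i * A i be - v i * r i) by rewrite H opprK.
by field.
Qed.

Let be_eq j : be j = - (B j / w j) + (- A' j al + r' j).
Proof.
have wj : w j != 0 by rewrite gt_eqF.
have H : w j * be j + w j * A' j al - w j * r' j = - B j.
  rewrite -col_eq (eq_bigr (fun i => u i j * be j + u i j * al i - rem i j)).
    rewrite sumrB big_split/= -mulr_suml -/(w j); congr (_ + _ - _).
      rewrite /A' mulr_sumr; apply: eq_bigr => i _; field; exact: wj.
    by rewrite /r' mulrC divfK.
  by move=> i ij; rewrite remE//; ring.
have -> : B j = - (w j * be j + w j * A' j al - w j * r' j) by rewrite H opprK.
by field.
Qed.

Let kap := Q / q.

(* any two rows of the stochastic matrix A overlap by at least kap^-2 / 2 *)
Let contraction (z : I -> R) a b i1 i2 : (forall j, a <= z j <= b) ->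
  A i1 z - A i2 z <= (1 - (2 * kap ^+ 2)^-1) * (b - a).
Proof.
move=> zab.
have kap1 : 1 <= kap by rewrite ler_pdivlMr// mul1r.
have k2 : 1 <= kap ^+ 2 by rewrite exprn_ege1.
have k20 : 0 < kap ^+ 2 by apply: lt_le_trans k2.
have ab : 0 <= b - a by case/andP: (zab i1) => h1 h2; rewrite subr_ge0 (le_trans h1).
have [<-|i12] := eqVneq i1 i2.
  rewrite subrr; apply: mulr_ge0 => //; rewrite subr_ge0 invf_le1; last by rewrite mulr_gt0.
  by apply: (le_trans k2); apply: ler_peMl; [exact: ltW|rewrite ler1n].
(* Every weight of a row is at least p0, and the two rows share N - 1 columns, so their overlap is
   at least (N - 1) / (N kap^2), hence at least half of kap^-2. *)
pose p0 := (kap ^+ 2 * N%:R)^-1.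
have p00 : 0 < p0 by rewrite invr_gt0 mulr_gt0.
have p_ge i j : j != i -> p0 <= u i j / v i.
  move=> ji; have ij : i != j by rewrite eq_sym.
  rewrite ler_pdivlMr//; case/andP: (v_bounds i) => _ vi.
  case/andP: (u_bounds ij) => ui _.
  apply: le_trans ui; apply: (le_trans (ler_wpM2l (ltW p00) vi)).
  rewrite le_eqVlt; apply/orP; left; apply/eqP; rewrite /p0 /kap.
  by field; rewrite !gt_eqF.
have H1 : p0 * \sum_(j | (j != i1) && (j != i2)) (b - z j) <= b - A i1 z.
  have -> : b - A i1 z = A i1 (fun j => b - z j) by rewrite AD AN A_cst.
  rewrite /A [X in _ <= X](bigD1 i2) 1?eq_sym//= mulr_sumr -[leLHS]add0r; apply: lerD.
    rewrite mulr_ge0 ?divr_ge0 ?(ltW (v0 _)) ?(ltW (u0 _))//.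
    by case/andP: (zab i2) => _; rewrite subr_ge0.
  apply: ler_sum => j /andP[ji1 _]; apply: ler_wpM2r; last exact: p_ge.
  by case/andP: (zab j) => _; rewrite subr_ge0.
have H2 : p0 * \sum_(j | (j != i1) && (j != i2)) (z j - a) <= A i2 z - a.
  have -> : A i2 z - a = A i2 (fun j => z j - a) by rewrite AD A_cst.
  rewrite /A [X in _ <= X](bigD1 i1)//= mulr_sumr -[leLHS]add0r; apply: lerD.
    rewrite mulr_ge0 ?divr_ge0 ?(ltW (v0 _)) ?(ltW (u0 _)) 1?eq_sym//.
    by case/andP: (zab i1) => + _; rewrite subr_ge0.
  rewrite (eq_bigl (fun j => (j != i2) && (j != i1))) => [|j]; last by rewrite andbC.
  apply: ler_sum => j /andP[ji2 _]; apply: ler_wpM2r; last exact: p_ge.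
  by case/andP: (zab j) => + _; rewrite subr_ge0.
have H3 : \sum_(j | (j != i1) && (j != i2)) (b - z j) +
    \sum_(j | (j != i1) && (j != i2)) (z j - a) = (b - a) * N%:R - (b - a).
  rewrite -(sum_neq_const cardI i1) [in RHS](bigD1 i2) 1?eq_sym//=.
  rewrite -big_split/= [RHS]addrAC subrr add0r; apply: eq_bigr => j _; ring.
have H4 : (2 * kap ^+ 2)^-1 * (b - a) <= p0 * ((b - a) * N%:R - (b - a)).
  have -> : p0 * ((b - a) * N%:R - (b - a)) = p0 * (N%:R - 1) * (b - a) by ring.
  apply: ler_wpM2r => //.
  have -> : p0 * (N%:R - 1) = (kap ^+ 2)^-1 * ((N%:R - 1) / N%:R).
    rewrite /p0; move: (kap ^+ 2) k20 => K K0; field.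
    by apply/andP; split; rewrite gt_eqF.
  have -> : (2 * kap ^+ 2)^-1 = (kap ^+ 2)^-1 * 2^-1 by rewrite invfM mulrC.
  apply: ler_wpM2l; first by rewrite invr_ge0 ltW.
  by rewrite ler_pdivlMr//; have := NR; lra.
by have := lerD H1 H2; rewrite -mulrDr H3; lra.
Qed.

Variables (b b' : R) (m : I).
Hypothesis be_m : be m = 0.
Hypothesis A_B : forall i, `|\sum_(j | j != i) u i j / v i * (B j / w j)| <= b.
Hypothesis A'_D : forall j, `|\sum_(i | i != j) u i j / w j * (D i / v i)| <= b'.

(** Eliminating [be] shows that [zeta], the column average of [al], is fixed by A'A up to an error
    [e]. Its oscillation O then satisfies O <= (1 - kap^-2 / 2) O + 2 e, so O <= 4 kap^2 e. An
    oscillation is all that can be controlled in this way, as constants are fixed by A'A; the level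
    of [zeta] comes from the pinned coordinate [m]. *)
Lemma mle_expansion l :
  `|al l + D l / v l + B m / w m| <=
  b + 3 * eps + 4 * kap ^+ 2 * (b + b' + 2 * eps).
Proof.
pose zeta j := A' j al.
have A_be i : A i be = - A i (fun j => B j / w j) - A i zeta + A i r'.
  rewrite -!AN -!AD; congr (A i _); apply/funext => j.
  by rewrite {1}be_eq /zeta; ring.
have zetaE j : zeta j = - A' j (fun i => D i / v i) +
    A' j (fun i => A i (fun k => B k / w k)) + A' j (fun i => A i zeta) -
    A' j (fun i => A i r') + A' j r.
  rewrite -!A'N -!A'D; congr (A' j _); apply/funext => i.
  by rewrite {1}al_eq A_be; ring.
pose e := b + b' + 2 * eps.
have zeta_e j : `|zeta j - A' j (fun i => A i zeta)| <= e.
  rewrite {1}zetaE.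
  set a1 := A' j _; set a2 := A' j _; set a3 := A' j _; set a4 := A' j _; set a5 := A' j _.
  have h1 : `|a1| <= b' by exact: A'_D.
  have h2 : `|a2| <= b by apply: A'_norm => i; exact: A_B.
  have h4 : `|a4| <= eps by apply: A'_norm => i; apply: A_norm => k; exact: r'_le.
  have h5 : `|a5| <= eps by apply: A'_norm => i; exact: r_le.
  have -> : - a1 + a2 + a3 - a4 + a5 - a3 = - a1 + a2 - a4 + a5 by ring.
  move: h1 h2 h4 h5; rewrite /e !ler_norml.
  move=> /andP[? ?] /andP[? ?] /andP[? ?] /andP[? ?]; apply/andP; split; lra.
have [j1 Hj1] := exists_max cardI zeta; have [j2 Hj2] := exists_min cardI zeta.
have [i1 Hi1] := exists_max cardI (fun i => A i zeta).
have [i2 Hi2] := exists_min cardI (fun i => A i zeta).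
pose O := zeta j1 - zeta j2.
have k20 : 0 < kap ^+ 2 by rewrite exprn_gt0// divr_gt0.
have O_le : O <= 4 * kap ^+ 2 * e.
  have h1 : A' j1 (fun i => A i zeta) <= A i1 zeta.
    by rewrite -[leRHS](A'_cst j1); exact: A'_le.
  have h2 : A i2 zeta <= A' j2 (fun i => A i zeta).
    by rewrite -[leLHS](A'_cst j2); exact: A'_le.
  have h3 : A i1 zeta - A i2 zeta <= (1 - (2 * kap ^+ 2)^-1) * O.
    by apply: contraction => j; rewrite Hj1 Hj2.
  have h4 : (2 * kap ^+ 2)^-1 * O <= 2 * e.
    have := zeta_e j1; have := zeta_e j2; rewrite !ler_norml => /andP[? ?] /andP[? ?].
    move: h3 h2 h1; rewrite mulrBl mul1r; move: (_ * O) => cO.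
    by rewrite /O => *; lra.
  have kk : 0 < 2 * kap ^+ 2 by apply: mulr_gt0.
  rewrite mulrC (ler_pdivrMr _ _ kk) in h4.
  by apply: (le_trans h4); rewrite le_eqVlt; apply/orP; left; apply/eqP; ring.
(* Since [be m] = 0, the column equation at [m] reads off the value of [zeta] there. This is the
   origin of the term B_m / w_m, common to all coordinates. *)
have Bm : B m / w m = - zeta m + r' m.
  by have := be_eq m; rewrite be_m -/(zeta m); lra.
rewrite {1}al_eq A_be Bm.
have h1 : `|A l (fun j => B j / w j)| <= b by exact: A_B.
have h2 : `|A l r'| <= eps by apply: A_norm => k; exact: r'_le.
have h3 := r_le l; have h4 := r'_le m.
have h5 : zeta j2 <= A l zeta <= zeta j1.
  by rewrite -[X in X <= _ <= _](A_cst l) -[X in _ <= _ <= X](A_cst l) !A_le.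
have h6 := Hj1 m; have h7 := Hj2 m; rewrite /O in O_le.
move: h1 h2 h3 h4 h5 O_le; rewrite -/e; move: (4 * kap ^+ 2 * e) => g.
rewrite !ler_norml => /andP[? ?] /andP[? ?] /andP[? ?] /andP[? ?] /andP[? ?] ?.
apply/andP; split; lra.
Qed.

End Linearization.

(** * Solvability of the likelihood equations *)

Section MleExistence.
Variable R : realType.

Lemma cvg_sum_cond (T : Type) (G : set_system T) {FG : Filter G} (I : Type) (s : seq I) (Q : pred I)
    (f : I -> T -> R) (l : I -> R) :
  (forall i, Q i -> f i x @[x --> G] --> l i) ->
  \sum_(i <- s | Q i) f i x @[x --> G] --> \sum_(i <- s | Q i) l i.
Proof.
move=> fl; elim: s => [|i s IH].
  by rewrite big_nil; under eq_fun do rewrite big_nil; exact: cvg_cst.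
rewrite big_cons; under eq_fun do rewrite big_cons.
by case: (boolP (Q i)) => // Qi; apply: cvgD => //; exact: fl.
Qed.

Lemma rV_coord_continuous n (k : 'I_n) : continuous (fun c : 'rV[R]_n => c ord0 k).
Proof. exact: coord_continuous. Qed.

(** Moving one coordinate [al i] or [be j] by h shifts every entry of its row or column by the same
    h, so each likelihood equation is the vanishing of a one-variable derivative at an interior
    maximum. *)
Lemma critical_of_max n (Q : pred 'I_n) (t a : 'I_n -> R) (h0 : R) :
  0 < h0 -> (forall j h, Q j -> `|h| < h0 -> 0 < t j + h) ->
  (forall h, `|h| < h0 ->
    \sum_(j | Q j) (ln (t j + h) - a j * (t j + h)) <=
    \sum_(j | Q j) (ln (t j) - a j * t j)) ->
  \sum_(j | Q j) a j = \sum_(j | Q j) (t j)^-1.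
Proof.
move=> h00 th Hmax.
pose F j h := if Q j then ln (t j + h) - a j * (t j + h) else 0 : R.
pose phi := \sum_(j < n) F j.
have phiE h : phi h = \sum_(j | Q j) (ln (t j + h) - a j * (t j + h)).
  by rewrite /phi fct_sumE [RHS]big_mkcond.
have dF j h : `|h| < h0 ->
    is_derive h (1 : R) (F j) (if Q j then (t j + h)^-1 - a j else 0).
  rewrite /F; case: ifP => [Qj hh|_ _]; last exact: is_derive_cst.
  have tj := th j h Qj hh.
  have dln := is_derive1_ln tj.
  have d1 : is_derive h (1 : R) (fun h => ln (t j + h)) ((t j + h)^-1).
    have d2 : is_derive h (1 : R) (fun h => t j + h) 1.
      by apply: is_derive_eq; rewrite add0r mulr1.
    by have := is_derive1_comp dln d2; rewrite mulr1.
  by apply: is_derive_eq; rewrite /GRing.scale/=; lra.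
have dphi h : `|h| < h0 ->
    is_derive h (1 : R) phi (\sum_(j < n) if Q j then (t j + h)^-1 - a j else 0).
  by move=> hh; apply: is_derive_sum => j; exact: dF.
have in_h h : (h \in `]- h0, h0[) = (`|h| < h0) by rewrite in_itv/= ltr_norml.
have d0 : `|0 : R| < h0 by rewrite normr0.
have mh : - h0 <= h0 by lra.
have H1 h : h \in `]- h0, h0[ -> derivable phi h 1.
  by rewrite in_h => /dphi; case.
have H2 : 0 \in `]- h0, h0[ by rewrite in_h.
have H3 h : h \in `]- h0, h0[ -> phi h <= phi 0.
  rewrite in_h !phiE => /Hmax.
  by under [X in _ -> _ <= X]eq_bigr do rewrite addr0.
have [_ e1] := @derive1_at_max R phi (- h0) h0 0 mh H1 H2 H3.
have [_] := dphi 0 d0; rewrite e1 -big_mkcond sumrB => /esym/eqP.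
rewrite subr_eq0 => /eqP <-; apply: eq_bigr => j _; by rewrite addr0.
Qed.

(* the likelihood of one entry tends to -oo at both ends of ]0, +oo[ *)
Lemma ln_linear_coercive (a C : R) : 0 < a -> exists e M : R, [/\ 0 < e, e < M &
  forall t, 0 < t -> C <= ln t - a * t -> e < t < M].
Proof.
move=> a0.
pose M := 2 / a * (- C - 1 - ln (a / 2)) + 1 + expR C.
have a2 : 0 < a / 2 by rewrite divr_gt0.
have H t : 0 < t -> C <= ln t - a * t -> expR C / 2 < t < M.
  move=> t0 Ct; have at0 : 0 < a * t by rewrite mulr_gt0.
  have et : expR C <= t by rewrite -[t]lnK ?posrE// ler_expR; lra.
  have e0 := expR_gt0 C.
  apply/andP; split; first by lra.
  have : ln (a / 2 * t) <= a / 2 * t - 1.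
    have -> : a / 2 * t = 1 + (a / 2 * t - 1) by ring.
    by rewrite {2}addrC addrK; apply: le_ln1Dx; have : 0 < a / 2 * t; [rewrite mulr_gt0|lra].
  rewrite lnM ?posrE// => h.
  have h2 : a / 2 * t <= - C - 1 - ln (a / 2) by lra.
  have : t <= 2 / a * (- C - 1 - ln (a / 2)).
    have -> : t = 2 / a * (a / 2 * t) by field; rewrite gt_eqF.
    by rewrite ler_wpM2l// divr_ge0// ltW.
  by rewrite /M; lra.
exists (expR C / 2), (Num.max M (expR C)); split.
- by rewrite divr_gt0 ?expR_gt0.
- by rewrite lt_max; apply/orP; right; have := expR_gt0 C; lra.
- by move=> t t0 Ct; rewrite lt_max; case/andP: (H t t0 Ct) => -> ->.
Qed.

(** The inverse of 1 plus the sum of the inverses also makes sense for an empty index type. *)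
Lemma exists_positive_lower (I : finType) (g : I -> R) : (forall i, 0 < g i) ->
  exists2 h, 0 < h & forall i, h <= g i.
Proof.
move=> g0; pose S := 1 + \sum_i (g i)^-1.
have gi i : 0 <= (g i)^-1 by rewrite invr_ge0 ltW.
have S0 : 0 < S by rewrite ltr_pwDl// sumr_ge0.
exists S^-1 => [|i]; first by rewrite invr_gt0.
rewrite invf_ple ?posrE// /S (bigD1 i)//= addrCA lerDl.
by rewrite addr_ge0// sumr_ge0.
Qed.

Section Existence.
Variable p : nat.
Hypothesis p2 : (2 <= p)%N.
Local Notation n := p.+1.
Variable a : 'I_n -> 'I_n -> R.
Hypothesis a0 : forall i j, i != j -> 0 < a i j.

Let term i j (s : R) := ln s - a i j * s.

Let term_le i j s : i != j -> 0 < s -> term i j s <= `|ln (a i j)|.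
Proof.
move=> /a0 aij s0; have as0 : 0 < a i j * s by rewrite mulr_gt0.
have := @le_ln1Dx _ (a i j * s - 1); rewrite (addrC 1) subrK lnM ?posrE// => H.
have {}/H : -1 < a i j * s - 1 by lra.
by have := ler_norm (- ln (a i j)); rewrite normrN /term; lra.
Qed.

Local Notation vec := 'rV[R]_(n + n).
Let al (c : vec) i := c ord0 (lshift n i).
Let be (c : vec) j := c ord0 (rshift n j).
Let tt c i j := al c i + be c j.
Let F (c : vec) := \sum_i \sum_(j | j != i) term i j (tt c i j).

Let S := \sum_i \sum_(j | j != i) `|ln (a i j)|.
Let C := \sum_i \sum_(j | j != i) term i j 1 - S.

(* if one entry falls below C then the total is below its value at t = 1 *)
Let all_terms_large c : (forall i j, i != j -> 0 < tt c i j) ->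
  \sum_i \sum_(j | j != i) term i j 1 <= F c ->
  forall i j, i != j -> C <= term i j (tt c i j).
Proof.
move=> c0 Fc i j ij; rewrite leNgt; apply/negP => H.
have ji : j != i by rewrite eq_sym.
have : F c < C + S.
  rewrite /F /S (bigD1 i)//= (bigD1 j)//= [in ltRHS](bigD1 i)//= [in ltRHS](bigD1 j)//=.
  rewrite -[X in X < _]addrA -[X in _ < C + X]addrA.
  apply: ltr_leD; first exact: H.
  rewrite -[leLHS]add0r.
  apply: lerD => //; apply: lerD.
    apply: ler_sum => k /andP[ki kj]; apply: term_le; first by rewrite eq_sym.
    by apply: c0; rewrite eq_sym.
  apply: ler_sum => k ki; apply: ler_sum => l lk.
  by apply: term_le; [rewrite eq_sym|apply: c0; rewrite eq_sym].
by rewrite /C subrK ltNge Fc.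
Qed.

Let al_cts i (c : vec) : {for c, continuous (fun c : vec => al c i)}.
Proof. exact: rV_coord_continuous. Qed.

Let be_cts j (c : vec) : {for c, continuous (fun c : vec => be c j)}.
Proof. exact: (@rV_coord_continuous _ (rshift n j) c). Qed.

Let tt_cts i j (c : vec) : {for c, continuous (fun c : vec => tt c i j)}.
Proof. exact: (cvgD (@al_cts i c) (@be_cts j c)). Qed.

(** The log-likelihood is maximized over a compact set [K] on which all entries lie in [e1, M].
    Coercivity keeps the maximizer off the bounds on the entries, so that every coordinate except
    the pinned one can be varied. *)
Lemma likelihood_max : exists (aa bb : 'I_n -> R), [/\ bb ord_max = 0,
  forall i j, i != j -> 0 < aa i + bb j,
  forall i, \sum_(j | j != i) a i j = \sum_(j | j != i) (aa i + bb j)^-1 &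
  forall j, j != ord_max ->
    \sum_(i | i != j) a i j = \sum_(i | i != j) (aa i + bb j)^-1].
Proof.
have He : forall ij : 'I_n * 'I_n, exists eM : R * R, [/\ 0 < eM.1, eM.1 < eM.2 &
    ij.1 != ij.2 -> forall t, 0 < t -> C <= term ij.1 ij.2 t -> eM.1 < t < eM.2].
  move=> [i j] /=; have [-> | ij] := eqVneq i j; first by exists (1, 2); split => //=; lra.
  by have [e [M [e0 eM h]]] := ln_linear_coercive C (a0 ij); exists (e, M).
have [eM HeM] := choice He.
have [e e0 He'] := @exists_positive_lower _ (fun ij => (eM ij).1) (fun ij =>
  let: And3 h _ _ := HeM ij in h).
(* Together with M >= 1, the minimum with 1 ensures that [K] contains the reference point [c1], at
   which every entry equals 1. *)
pose e1 := Num.min e 1.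
pose M := 1 + \sum_ij (eM ij).2.
have eM2 ij : 0 <= (eM ij).2 by case: (HeM ij) => ? ? _; lra.
have M1 : 1 <= M by rewrite lerDl sumr_ge0.
have HM ij : (eM ij).2 <= M.
  by rewrite /M (bigD1 ij)//= addrCA lerDl addr_ge0// sumr_ge0.
have e10 : 0 < e1 by rewrite lt_min e0 ltr01.
pose K : set vec := [set c | be c ord_max = 0 /\
  forall i j, i != j -> e1 <= tt c i j <= M].
(* The value 0 at the last [be] bounds every [al i] except the last. Each [be j] is then bounded
   through some such i different from j, which exists because there are at least three indices, and
   the last [al] through the first [be]. *)
have K_box : K `<=` [set c : vec | forall k, (`[- (3 * M), 3 * M]%classic) (c ord0 k)].
  move=> c [b0 Hc] k.
  have alM i : i != ord_max -> 0 < al c i <= M.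
    by move=> im; have := Hc _ _ im; rewrite /tt b0 addr0 => /andP[h ->]; rewrite (lt_le_trans e10 h).
  pose o0 : 'I_n := ord0; pose o1 : 'I_n := inord 1.
  have v1 : o1 = 1%N :> nat by rewrite inordK// ltnS ltnW.
  have o01 : o0 != o1 by rewrite -val_eqE/= v1.
  have o0m : o0 != ord_max by rewrite -val_eqE/= eq_sym -lt0n; exact: ltnW.
  have o1m : o1 != ord_max by rewrite -val_eqE/= v1 neq_ltn; apply/orP; left.
  have beM j : - M <= be c j <= M.
    have [->|jm] := eqVneq j ord_max; first by rewrite b0; apply/andP; lra.
    have [i [ij im]] : exists i, i != j /\ i != ord_max.
      by have [->|h] := eqVneq j o0; [exists o1; rewrite eq_sym|exists o0; rewrite eq_sym].
    by have := Hc _ _ ij; have := alM _ im; rewrite /tt => /andP[? ?] /andP[? ?]; apply/andP; lra.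
  have alM' i : - (3 * M) <= al c i <= 3 * M.
    have [->|im] := eqVneq i ord_max.
      have := Hc ord_max o0; rewrite eq_sym => /(_ o0m); have := beM o0.
      by rewrite /tt => /andP[? ?] /andP[? ?]; apply/andP; lra.
    by have /andP[? ?] := alM _ im; apply/andP; lra.
  rewrite /= in_itv/=; case: (split_ordP k) => [i ->|j ->]; first exact: alM'.
  by have /andP[? ?] := beM j; apply/andP; rewrite -/(be c j); lra.
have K_closed : closed K.
  rewrite (_ : K = ((be ^~ ord_max) @^-1` [set 0]) `&`
      \bigcap_(ij in [set ij : 'I_n * 'I_n | ij.1 != ij.2])
        ((fun c => tt c ij.1 ij.2) @^-1` `[e1, M])).
    apply: closedI.
      by apply: closed_comp; [move=> c _; exact: be_cts|exact: closed_eq].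
    apply: closed_bigI => ij _.
    by apply: closed_comp; [move=> c _; exact: tt_cts|exact: itv_closed].
  apply/seteqP; split => c [b0 Hc]; split => //.
    by move=> [i j]/= ij; rewrite in_itv/=; exact: Hc.
  by move=> i j ij; have := Hc (i, j) ij; rewrite /= in_itv.
have K_compact : compact K.
  apply: (subclosed_compact K_closed _ K_box).
  apply: (@rV_compact _ _ (fun=> `[- (3 * M), 3 * M]%classic)) => k.
  exact: segment_compact.
have Kpos c i j : K c -> i != j -> 0 < tt c i j.
  by move=> [_ H] ij; case/andP: (H _ _ ij) => h _; exact: lt_le_trans h.
pose c1 : vec := row_mx (const_mx 1) (const_mx 0).
have al1 i : al c1 i = 1 by rewrite /al row_mxEl mxE.
have be1 j : be c1 j = 0 by rewrite /be row_mxEr mxE.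
have Kc1 : K c1.
  split=> [|i j ij]; first exact: be1.
  by rewrite /tt al1 be1 addr0 M1 andbT ge_min lexx orbT.
have FK : {within K, continuous F}.
  apply: continuous_in_subspaceT => c /set_mem Kc.
  apply: (@cvg_sum_cond _ (nbhs c) (nbhs_filter c)) => i _.
  apply: (@cvg_sum_cond _ (nbhs c) (nbhs_filter c)) => j ji.
  have tpos : 0 < tt c i j by apply: Kpos => //; rewrite eq_sym.
  apply: cvgB; last by apply: cvgM; [exact: cvg_cst|exact: tt_cts].
  apply: continuous_cvg; last exact: tt_cts.
  exact: continuous_ln.
have [c /set_mem Kc cmax] := EVT_max_rV (ex_intro _ c1 Kc1) K_compact FK.
have Fc1 : F c1 = \sum_i \sum_(j | j != i) term i j 1.
  by apply: eq_bigr => i _; apply: eq_bigr => j _; rewrite /tt al1 be1 addr0.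
(* The maximizer does at least as well as [c1], so no term falls below [C] and the coercivity bounds
   are strict. Small moves of a free coordinate therefore stay in [K]. *)
have tC i j (ij : i != j) : e1 < tt c i j < M.
  have := all_terms_large (fun i j => @Kpos c i j Kc) _ ij.
  rewrite -Fc1 => /(_ (cmax c1 (mem_set Kc1))).
  have [_ _ H] := HeM (i, j).
  move=> /(H ij _ (Kpos _ _ _ Kc ij)) /andP[h1 h2]; apply/andP; split.
    by apply: le_lt_trans h1; apply: le_trans (He' (i, j)); rewrite ge_min lexx.
  exact: lt_le_trans h2 (HM (i, j)).
have gap0 (ij : 'I_n * 'I_n) : 0 < (if ij.1 != ij.2 then
    Num.min (tt c ij.1 ij.2 - e1) (M - tt c ij.1 ij.2) else 1).
  by case: ifPn => // /tC /andP[? ?]; rewrite lt_min !subr_gt0; apply/andP.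
have [h0 h00 Hh0] := exists_positive_lower gap0.
have tth i j h : i != j -> `|h| < h0 -> e1 <= tt c i j + h <= M.
  move=> ij; have := Hh0 (i, j); rewrite /= ij le_min => /andP[h1 h2].
  by rewrite ltr_norml => /andP[h3 h4]; apply/andP; lra.
have delta (k l : 'I_(n + n)) h : (c + h *: delta_mx ord0 k) ord0 l =
    c ord0 l + (if l == k then h else 0).
  by rewrite !mxE eqxx/=; case: (l == k); rewrite ?mulr1 ?mulr0.
exists (al c), (be c); split.
- by case: Kc.
- by move=> i j; exact: Kpos.
- move=> i.
  apply: (@critical_of_max _ (fun j => j != i) (tt c i) (a i) h0) => //.
    by move=> j h ji /(tth i j); rewrite eq_sym ji => /(_ isT) /andP[+ _]; exact: lt_le_trans.
  move=> h hh.
  pose c' : vec := c + h *: delta_mx ord0 (lshift n i).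
  have be' j : be c' j = be c j.
    by rewrite /be delta eq_rlshift /= addr0.
  have al' k : al c' k = al c k + (if k == i then h else 0).
    by rewrite /al delta eq_lshift.
  have Kc' : K c'.
    split; first by rewrite be'; case: Kc.
    move=> k j kj; rewrite /tt al' be'; have [ki|_] := eqVneq k i.
      by rewrite addrAC; apply: tth => //; rewrite -ki.
    by rewrite addr0; case: Kc => _; exact.
  have := cmax c' (mem_set Kc'); rewrite /F (bigD1 i)//= [in leRHS](bigD1 i)//=.
  have -> : \sum_(k | k != i) \sum_(j | j != k) term k j (tt c' k j) =
      \sum_(k | k != i) \sum_(j | j != k) term k j (tt c k j).
    apply: eq_bigr => k ki; apply: eq_bigr => j _.
    by rewrite /tt al' be' (negbTE ki) addr0.
  rewrite lerD2r; apply: le_trans; rewrite le_eqVlt; apply/orP; left; apply/eqP.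
  by apply: eq_bigr => j _; rewrite /term /tt al' be' eqxx addrAC.
- move=> j jm.
  apply: (@critical_of_max _ (fun i => i != j) (fun i => tt c i j) (fun i => a i j) h0) => //.
    by move=> i h ij /(tth i j); rewrite ij => /(_ isT) /andP[+ _]; exact: lt_le_trans.
  move=> h hh.
  pose c' : vec := c + h *: delta_mx ord0 (rshift n j).
  have al' i : al c' i = al c i.
    by rewrite /al delta eq_lrshift /= addr0.
  have be' k : be c' k = be c k + (if k == j then h else 0).
    by rewrite /be delta eq_rshift.
  have Kc' : K c'.
    split; first by rewrite be' eq_sym (negbTE jm) addr0; case: Kc.
    move=> i k ik; rewrite /tt al' be'; have [kj|_] := eqVneq k j.
      by rewrite addrA; exact: tth.
    by rewrite addr0; case: Kc => _; exact.
  have Fx d : F d = \sum_k \sum_(i | i != k) term i k (tt d i k).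
    rewrite /F (exchange_big_dep xpredT)//=; apply: eq_bigr => k _.
    by apply: eq_bigl => i; rewrite eq_sym.
  have := cmax c' (mem_set Kc'); rewrite !Fx (bigD1 j)//= [in leRHS](bigD1 j)//=.
  have -> : \sum_(k | k != j) \sum_(i | i != k) term i k (tt c' i k) =
      \sum_(k | k != j) \sum_(i | i != k) term i k (tt c i k).
    apply: eq_bigr => k ki; apply: eq_bigr => i _.
    by rewrite /tt al' be' (negbTE ki) addr0.
  rewrite lerD2r; apply: le_trans; rewrite le_eqVlt; apply/orP; left; apply/eqP.
  by apply: eq_bigr => i _; rewrite /term /tt al' be' eqxx addrA.
Qed.

End Existence.

Lemma mle_exists (n : nat) (a : nat -> nat -> R) : (3 <= n)%N ->
  (forall i j, (i < n)%N -> (j < n)%N -> i != j -> 0 < a i j) ->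
  exists al be, mle_eq n a al be.
Proof.
case: n => // p p2 a0.
have a0' (i j : 'I_p.+1) : i != j -> 0 < a i j by move=> ij; exact: a0.
have [aa [bb [bm pos Hr Hc]]] := @likelihood_max p p2 (fun i j => a i j) a0'.
exists (fun i => aa (inord i)), (fun j => bb (inord j)).
have eq_neq (i : 'I_p.+1) (F : 'I_p.+1 -> R) (k : nat) : k = i :> nat ->
    \sum_(j < p.+1 | (j : nat) != k) F j = \sum_(j | j != i) F j.
  by move=> ->; apply: eq_bigl => j; rewrite -val_eqE.
split.
- by rewrite /= (_ : inord p = ord_max)//; apply: val_inj; rewrite /= inordK.
- by move=> i j ip jp ij; apply: pos; rewrite -val_eqE/= !inordK.
- move=> i ip; rewrite (eq_neq (inord i) (fun j => a i j)) ?inordK//.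
  rewrite (eq_neq (inord i) (fun k => (aa (inord i) + bb (inord k))^-1)) ?inordK//.
  have := Hr (inord i); rewrite inordK// => ->.
  by apply: eq_bigr => j _; rewrite inord_val.
- move=> j jp; have jp' : (j < p.+1)%N by apply: leq_trans jp _.
  rewrite (eq_neq (inord j) (fun i => a i j)) ?inordK//.
  rewrite (eq_neq (inord j) (fun k => (aa (inord k) + bb (inord j))^-1)) ?inordK//.
  have := Hc (inord j); rewrite inordK// => ->.
    by apply: eq_bigr => i _; rewrite inord_val.
  by rewrite -val_eqE/= inordK// neq_ltn jp.
Qed.


End MleExistence.

(** * The Fisher information and the linear part *)

Section FisherEntries.
Variables (R : realType) (n : nat) (al be : nat -> R).
Hypothesis n0 : (0 < n)%N.

Lemma vmat_alpha (i : 'I_n) :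
  vmat n al be i i = \sum_(j < n | j != i) ufun (al i + be j).
Proof. by rewrite /vmat eqxx ltn_ord. Qed.

Let n2 : n.*2.-1 = (n + n.-1)%N.
Proof. by rewrite -addnn; case: n n0 => // m _; rewrite addSn addnS. Qed.

Let sum_split (F : nat -> R) (Q : pred nat) :
  \sum_(j < n.*2.-1 | Q j) F j =
  \sum_(j < n | Q j) F j + \sum_(j < n.-1 | Q (n + j)%N) F (n + j)%N.
Proof. by rewrite n2 big_split_ord. Qed.

Let sum_last (F : nat -> R) (Q : pred nat) :
  \sum_(j < n | Q j) F j =
  \sum_(j < n.-1 | Q j) F j + (if Q n.-1 then F n.-1 else 0).
Proof.
case: n n0 => // m _ /=; rewrite big_mkcond big_ord_recr/=.
by rewrite [in RHS]big_mkcond.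
Qed.

Let v2n_alpha (i : nat) : (i < n)%N ->
  v2n n al be i = if i != n.-1 then ufun (al i + be n.-1) else 0.
Proof.
move=> iltn; rewrite /v2n.
rewrite (sum_split (vmat n al be i) (fun j => j != i)) {1}/vmat eqxx iltn.
rewrite [X in _ - (X + _)]big1 ?add0r; last first.
  move=> j ji; rewrite /vmat eq_sym (negbTE ji).
  by rewrite [(n <= j)%N]leqNgt ltn_ord [(n <= i)%N]leqNgt iltn /= ?andbF.
rewrite (sum_last (fun j => ufun (al i + be j)) (fun j => j != i)).
rewrite [X in _ - X](eq_bigl (fun j : 'I_n.-1 => true) _)/=; last first.
  move=> j; apply/negP => /eqP e; move: iltn; rewrite -e ltnNge leq_addr//.
rewrite [X in _ - X](_ : _ = \sum_(j < n.-1 | (j : nat) != i) ufun (al i + be j)).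
  by rewrite eq_sym addrAC subrr add0r.
rewrite [RHS]big_mkcond; apply: eq_bigr => j _; rewrite /vmat.
have -> : (i == n + j)%N = false.
  by apply/negbTE; rewrite neq_ltn ltn_addr.
rewrite iltn leq_addr n2 ltn_add2l ltn_ord addKn /= eq_sym.
by case: eqVneq => //= _; rewrite [(n + j < n)%N]ltnNge leq_addr.
Qed.

Let v2n_beta (j0 : nat) : (j0 < n.-1)%N -> v2n n al be (n + j0) = 0.
Proof.
move=> jn; rewrite /v2n.
rewrite (sum_split (vmat n al be (n + j0)) (fun j => j != n + j0)%N) {1}/vmat eqxx ltnNge leq_addr /= addKn.
rewrite [X in _ - (_ + X)]big1 ?addr0; last first.
  move=> j ji; rewrite /vmat eq_sym (negbTE ji).
  by rewrite ![(n + _ < n)%N]ltnNge !leq_addr /=.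
rewrite [X in _ - X](_ : _ = \sum_(k < n | (k : nat) != j0) ufun (al k + be j0)).
  by rewrite subrr.
rewrite [RHS]big_mkcond [LHS]big_mkcond; apply: eq_bigr => j _; rewrite /vmat.
have -> : (n + j0 == j)%N = false.
  by apply/negbTE; rewrite neq_ltn [(j < _)%N]ltn_addr ?orbT.
rewrite [(j == n + j0 :> nat)%N]eq_sym.
have -> : (n + j0 == j)%N = false.
  by apply/negbTE; rewrite neq_ltn [(j < _)%N]ltn_addr ?orbT.
by rewrite /= [(n + j0 < n)%N]ltnNge leq_addr /= ltn_ord n2 ltn_add2l jn addKn.
Qed.

(** The quantity v_{2n,i} is what the off-diagonal entries leave of the diagonal one. It vanishes
    for each free beta and equals u_{i,n} for alpha_i with i < n, so the total is the information of
    the pinned beta_n. *)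
Lemma v2n2nE : v2n2n n al be =
  \sum_(i < n | (i : nat) != n.-1) ufun (al i + be n.-1).
Proof.
rewrite /v2n2n (sum_split (v2n n al be) xpredT) [X in _ + X]big1 => [|j _]; last exact: v2n_beta.
rewrite addr0 [RHS]big_mkcond; apply: eq_bigr => i _; exact: v2n_alpha.
Qed.

End FisherEntries.

(** With R the matrix [Rm], R S R = 1, so y = t R satisfies y S y^T = |t|^2. On the first k <= n
    coordinates S is a diagonal matrix plus a constant one, which turns y S y^T into the left side:
    up to cross terms, the variance of the linear part. *)
Lemma quad_form (R : realType) (k n : nat) (al be : nat -> R) (Rm : 'M[R]_k) (t : 'I_k -> R) :
  (k <= n)%N -> Sblock k n al be \in unitmx -> Rm^T = Rm ->
  Rm *m Rm = invmx (Sblock k n al be) ->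
  let y j := \sum_i t i * Rm i j in
  \sum_j y j ^+ 2 / vmat n al be j j + (\sum_j y j) ^+ 2 / v2n2n n al be =
  \sum_i t i ^+ 2.
Proof.
move=> kn Su Rt RR y.
have RSR : Rm *m Sblock k n al be *m Rm = 1%:M.
  by apply: mulmx1C; rewrite mulmxA RR mulVmx.
pose T : 'rV[R]_k := \row_i t i.
pose Y : 'rV[R]_k := T *m Rm.
have YE j : Y ord0 j = y j by rewrite mxE; apply: eq_bigr => i _; rewrite mxE.
have YT : Y^T = Rm *m T^T by rewrite trmx_mul Rt.
have H : (Y *m Sblock k n al be *m Y^T) ord0 ord0 = \sum_i t i ^+ 2.
  have -> : Y *m Sblock k n al be *m Y^T = T *m T^T.
    rewrite YT /Y -!mulmxA; congr (_ *m _).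
    by rewrite !mulmxA RSR mul1mx.
  by rewrite mxE; apply: eq_bigr => i _; rewrite !mxE.
rewrite -H mxE.
have kk (i : 'I_k) : (i < n)%N by apply: leq_trans (ltn_ord i) kn.
have row j : (Y *m Sblock k n al be) ord0 j =
    y j / vmat n al be j j + (\sum_i y i) / v2n2n n al be.
  rewrite mxE (eq_bigr (fun i => (if i == j then y i / vmat n al be i i else 0) +
      y i / v2n2n n al be)).
    rewrite big_split/= -mulr_suml; congr (_ + _).
    by rewrite -big_mkcond big_pred1_eq.
  move=> i _; rewrite YE mxE /Smat !kk /= mulrDr.
  have -> : ((i : nat) == j) = (i == j) by [].
  by case: (i == j); rewrite ?mulr0.
rewrite [RHS](eq_bigr (fun j => y j ^+ 2 / vmat n al be j j +
    y j * ((\sum_i y i) / v2n2n n al be))) => [|j _]; last first.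
  by rewrite row [Y^T _ _]mxE YE; ring.
by rewrite big_split/= -mulr_suml; congr (_ + _); ring.
Qed.

(** * Deviation bounds *)

Lemma fine_prob_le (R : realType) d (T : measurableType d) (P : probability T R)
    (A B : set T) : measurable A -> measurable B -> A `<=` B ->
  fine (P A) <= fine (P B).
Proof.
move=> mA mB AB; apply: fine_le; rewrite ?fin_num_measure//.
by apply: le_measure; rewrite ?inE.
Qed.

Lemma prob_setU_le (R : realType) d (T : measurableType d) (P : probability T R)
    (A B : set T) : measurable A -> measurable B ->
  fine (P (A `|` B)) <= fine (P A) + fine (P B).
Proof.
move=> mA mB; rewrite -fineD ?fin_num_measure//.
apply: fine_le; rewrite ?fin_numD ?fin_num_measure//; first exact: measurableU.
exact: measureU2.
Qed.

Lemma measurable_exists d (T : measurableType d) (I : finType) (A : I -> set T) :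
  (forall i, measurable (A i)) -> measurable [set w | exists i, A i w].
Proof.
move=> mA; rewrite (_ : [set w | _] = \bigcup_(i in [set: I]) A i).
  exact: fin_bigcup_measurable.
by apply/seteqP; split => [w [i Ai]|w [i _ Ai]]; exists i.
Qed.

Lemma prob_exists_le (R : realType) d (T : measurableType d) (P : probability T R)
    (I : finType) (A : I -> set T) (c : R) : (forall i, measurable (A i)) ->
  (forall i, fine (P (A i)) <= c) ->
  fine (P [set w | exists i, A i w]) <= #|I|%:R * c.
Proof.
move=> mA Ac.
have H (s : seq I) : measurable (\big[setU/set0]_(i <- s) A i) /\
    fine (P (\big[setU/set0]_(i <- s) A i)) <= (size s)%:R * c.
  elim: s => [|i s [ms IH]]; first by rewrite big_nil measure0 mul0r.
  rewrite big_cons; split; first exact: measurableU.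
  apply: le_trans (prob_setU_le _ _ _) _ => //=.
  by rewrite -natr1 mulrDl mul1r addrC; exact: lerD.
have [_] := H (enum I); rewrite -cardE.
rewrite (_ : \big[_/_]_(_ <- _) _ = [set w | exists i, A i w])//.
rewrite -bigcup_seq; apply/seteqP; split => [w [i _ Ai]|w [i Ai]]; exists i => //=.
by rewrite mem_enum.
Qed.

Lemma measurable_ge_cst (R : realType) d (T : measurableType d) (f : T -> R) (y : R) :
  measurable_fun setT f -> measurable [set w | y <= f w].
Proof.
move=> mf; rewrite -[X in measurable X]setTI.
rewrite (_ : [set w | _] = f @^-1` `[y, +oo[); first exact: mf.
by apply/seteqP; split => w /=; rewrite in_itv/= andbT.
Qed.

Lemma measurable_gt_cst (R : realType) d (T : measurableType d) (f : T -> R) (y : R) :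
  measurable_fun setT f -> measurable [set w | y < f w].
Proof.
move=> mf; rewrite -[X in measurable X]setTI.
rewrite (_ : [set w | _] = f @^-1` `]y, +oo[); first exact: mf.
by apply/seteqP; split => w /=; rewrite in_itv/= andbT.
Qed.

Section Chernoff.
Context (R : realType) d (T : measurableType d) (P : probability T R).
Variables (I : finType) (X : I -> T -> R) (l : I -> R).
Hypothesis mX : forall i, measurable_fun setT (X i).
Hypothesis indepX : mutual_indep P X.
Hypothesis l0 : forall i, 0 < l i.
Hypothesis lawX : forall i (B : set R), measurable B ->
  P (X i @^-1` B) = exponential_prob (l i) B.

Lemma measurable_sum_centered (c : I -> R) :
  measurable_fun setT (fun w => \sum_i c i * (X i w - (l i)^-1)).
Proof.
by apply: measurable_sum => i; apply: measurable_funM => //; exact: measurable_funB.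
Qed.

Lemma chernoff_one_sided (c : I -> R) (s : R) : (forall i, `|c i / l i| <= 2^-1) ->
  fine (P [set w | s < \sum_i c i * (X i w - (l i)^-1)]) <=
  expR (\sum_i (c i / l i) ^+ 2 - s).
Proof.
move=> cl.
have mS := measurable_sum_centered c.
pose S : {RV P >-> R} := HB.pack (fun w => \sum_i c i * (X i w - (l i)^-1))
  (isMeasurableFun.Build _ _ _ _ _ mS).
have ch := @chernoff _ _ _ P S 1 s ltr01.
have mgf : ('M_P S 1 <= (expR (\sum_i (c i / l i) ^+ 2))%:E)%E.
  rewrite /mmt_gen_fun unlock /=.
  under eq_integral do rewrite /= mulr1.
  exact: (mgf_sum_exponential mX indepX l0 lawX).
rewrite mul1r in ch.
have {}ch : (P [set w | (s <= \sum_i c i * (X i w - (l i)^-1))%R] <=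
    (expR (\sum_i (c i / l i) ^+ 2) * expR (- s))%:E)%E.
  apply: le_trans ch _; rewrite EFinM lee_wpmul2r// lee_fin expR_ge0.
have mle : measurable [set w | s <= \sum_i c i * (X i w - (l i)^-1)].
  exact: (measurable_ge_cst _ mS).
have mlt : measurable [set w | s < \sum_i c i * (X i w - (l i)^-1)].
  exact: (measurable_gt_cst _ mS).
rewrite expRD; apply: (le_trans (fine_prob_le P mlt mle _)); first by move=> w /ltW.
by rewrite -lee_fin fineK ?fin_num_measure.
Qed.

Lemma chernoff_two_sided (c : I -> R) (s : R) : (forall i, `|c i / l i| <= 2^-1) ->
  fine (P [set w | s < `|\sum_i c i * (X i w - (l i)^-1)|]) <=
  2 * expR (\sum_i (c i / l i) ^+ 2 - s).
Proof.
move=> cl; have cl' i : `|- c i / l i| <= 2^-1 by rewrite mulNr normrN.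
have sumN w : \sum_i - c i * (X i w - (l i)^-1) = - \sum_i c i * (X i w - (l i)^-1).
  by rewrite -sumrN; apply: eq_bigr => i _; rewrite mulNr.
have m1 : measurable [set w | s < \sum_i c i * (X i w - (l i)^-1)].
  exact: (measurable_gt_cst _ (measurable_sum_centered c)).
have m2 : measurable [set w | s < \sum_i - c i * (X i w - (l i)^-1)].
  exact: (measurable_gt_cst _ (measurable_sum_centered (fun i => - c i))).
rewrite (_ : [set w | _] = [set w | s < \sum_i c i * (X i w - (l i)^-1)] `|`
    [set w | s < \sum_i - c i * (X i w - (l i)^-1)]); last first.
  apply/seteqP; split => w /=; rewrite ltr_normr sumN; first by move/orP.
  by move=> [->//|->]; rewrite orbT.
apply: le_trans (prob_setU_le _ m1 m2) _; rewrite mulr_natl mulr2n; apply: lerD.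
  exact: chernoff_one_sided.
apply: le_trans (chernoff_one_sided _ cl') _.
by under eq_bigr do rewrite mulNr sqrrN.
Qed.

(** The tilt h is chosen so that h^2 rho^2 m = L, which makes the threshold 4 L and the exponent L -
    4 L; the condition 4 L <= m keeps the tilted coefficients at most 1/2. With L = ln n the result
    is of order n^-3, small enough for a union of O(n) events. *)
Lemma sum_deviation (c : I -> R) (rho m L : R) : 0 < rho -> 0 < L -> 4 * L <= m ->
  (forall i, `|c i / l i| <= rho) -> \sum_i (c i / l i) ^+ 2 <= rho ^+ 2 * m ->
  fine (P [set w | 4 * rho * Num.sqrt (m * L) < `|\sum_i c i * (X i w - (l i)^-1)|]) <=
  2 * expR (- (3 * L)).
Proof.
move=> rho0 L0 Lm cl c2.
have m0 : 0 < m by lra.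
pose h := Num.sqrt (L / m) / rho.
have h0 : 0 < h by rewrite divr_gt0// sqrtr_gt0 divr_gt0.
have sLm : Num.sqrt (L / m) <= 2^-1.
  rewrite -(ler_sqr (_ : _ \is Num.nneg)) ?nnegrE ?sqrtr_ge0//.
  rewrite sqr_sqrtr ?divr_ge0 ?(ltW L0) ?(ltW m0)//.
  rewrite ler_pdivrMr//; lra.
have hcl i : `|h * c i / l i| <= 2^-1.
  rewrite -mulrA normrM gtr0_norm//; apply: le_trans sLm.
  by rewrite /h mulrAC ler_pdivrMr// ler_wpM2l ?sqrtr_ge0.
have := chernoff_two_sided (4 * L) hcl.
have -> : [set w | 4 * L < `|\sum_i h * c i * (X i w - (l i)^-1)|] =
  [set w | 4 * rho * Num.sqrt (m * L) < `|\sum_i c i * (X i w - (l i)^-1)|].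
  have hs : h * (4 * rho * Num.sqrt (m * L)) = 4 * L.
    have -> : h * (4 * rho * Num.sqrt (m * L)) =
        4 * (Num.sqrt (L / m) * Num.sqrt (m * L)).
      by rewrite /h; field; rewrite gt_eqF.
    rewrite -sqrtrM ?divr_ge0 ?ltW// (_ : L / m * _ = L ^+ 2).
      by rewrite sqrtr_sqr gtr0_norm.
    by field; rewrite gt_eqF.
  apply/funext => w /=; rewrite -hs; under eq_bigr do rewrite -mulrA.
  by rewrite -mulr_sumr normrM (gtr0_norm h0) ltr_pM2l.
move/le_trans; apply; rewrite ler_pM2l// ler_expR.
have -> : \sum_i (h * c i / l i) ^+ 2 = h ^+ 2 * \sum_i (c i / l i) ^+ 2.
  by rewrite mulr_sumr; apply: eq_bigr => i _; rewrite -mulrA exprMn.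
have : h ^+ 2 * \sum_i (c i / l i) ^+ 2 <= L.
  have -> : L = h ^+ 2 * (rho ^+ 2 * m).
    rewrite /h expr_div_n sqr_sqrtr ?divr_ge0 ?ltW//.
    by field; rewrite !gt_eqF.
  by apply: ler_wpM2l => //; rewrite sqr_ge0.
lra.
Qed.

End Chernoff.

Lemma exponential_prob_le0 (R : realType) (l : R) :
  exponential_prob l `]-oo, 0] = 0%E.
Proof.
rewrite /exponential_prob -integral_itv_bndo_bndc.
  rewrite integral0_eq// => x /=; rewrite in_itv/= => x0.
  by rewrite lt0_exponential_pdf.
apply: measurable_funTS; apply/measurable_EFinP; exact: measurable_exponential_pdf.
Qed.

Section OffDiagonalSums.
Context (R : realType) d (T : measurableType d) (P : probability T R).
Variables (n : nat) (a : nat -> nat -> T -> R) (t : 'I_n -> 'I_n -> R).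
Hypothesis t0 : forall i j, i != j -> 0 < t i j.
Hypothesis ma : forall i j, measurable_fun setT (a i j).
Hypothesis lawa : forall i j : 'I_n, i != j -> forall B : set R, measurable B ->
  P (a i j @^-1` B) = exponential_prob (t i j) B.
Hypothesis inda : forall B : 'I_n -> 'I_n -> set R, (forall i j, measurable (B i j)) ->
  fine (P [set w | forall i j : 'I_n, i != j -> B i j (a i j w)])
  = \prod_(i < n) \prod_(j < n | i != j) fine (P (a i j @^-1` B i j)).

Let offdiag : {pred 'I_n * 'I_n} := [pred p | p.1 != p.2].
(** A single finite index type for the off-diagonal pairs makes the results on families of
    independent exponentials applicable. *)
Let J := {p in offdiag}.
Let X (m : J) := a (val m).1 (val m).2.
Let l (m : J) := t (val m).1 (val m).2.

Let J_neq (m : J) : (val m).1 != (val m).2. Proof. exact: (valP m). Qed.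

Let pairs_sum (F : 'I_n -> 'I_n -> R) :
  \sum_i \sum_(j | i != j) F i j = \sum_(m : J) F (val m).1 (val m).2.
Proof.
rewrite pair_big_dep/= -(big_sub offdiag (fun p => F p.1 p.2)).
by apply: eq_bigl => p.
Qed.

Let mX m : measurable_fun setT (X m). Proof. exact: ma. Qed.

Let l0 m : 0 < l m. Proof. exact: t0. Qed.

Let lawX m (B : set R) : measurable B -> P (X m @^-1` B) = exponential_prob (l m) B.
Proof. exact: lawa. Qed.

Let indepX : mutual_indep P X.
Proof.
move=> B mB.
(* A set is required for every pair; diagonal pairs receive the whole line, which imposes no
   condition. *)
pose B' i j := if insub (i, j) is Some m then B m else setT.
have B'E (m : J) : B' (val m).1 (val m).2 = B m.
  by rewrite /B' -surjective_pairing valK.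
have mB' i j : measurable (B' i j) by rewrite /B'; case: insub.
rewrite (_ : [set w | _] = [set w | forall i j : 'I_n, i != j -> B' i j (a i j w)]).
  rewrite inda// pair_big_dep/=.
  rewrite (eq_bigl (fun p => p \in offdiag))// big_sub.
  by apply: eq_bigr => m _; rewrite B'E.
apply/seteqP; split => w /= H.
  move=> i j ij; rewrite /B'; case: insubP => //= m _ mij.
  by have := H m; rewrite /X /= mij.
by move=> m; rewrite -B'E; exact: H.
Qed.

Definition dev (c : 'I_n -> 'I_n -> R) (w : T) : R :=
  \sum_i \sum_(j | i != j) c i j * (a i j w - (t i j)^-1).

Let devE c w : dev c w = \sum_(m : J) c (val m).1 (val m).2 * (X m w - (l m)^-1).
Proof. exact: (pairs_sum (fun i j => c i j * (a i j w - (t i j)^-1))). Qed.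

Lemma measurable_dev c : measurable_fun setT (dev c).
Proof.
rewrite (_ : dev c = fun w => \sum_(m : J) c (val m).1 (val m).2 * (X m w - (l m)^-1)).
  exact: (measurable_sum_centered l mX (fun m => c (val m).1 (val m).2)).
by apply/funext => w; rewrite devE.
Qed.

Lemma dev_deviation c (rho m L : R) : 0 < rho -> 0 < L -> 4 * L <= m ->
  (forall i j, i != j -> `|c i j / t i j| <= rho) ->
  \sum_i \sum_(j | i != j) (c i j / t i j) ^+ 2 <= rho ^+ 2 * m ->
  fine (P [set w | 4 * rho * Num.sqrt (m * L) < `|dev c w|]) <= 2 * expR (- (3 * L)).
Proof.
move=> rho0 L0 Lm crho c2.
rewrite (_ : [set w | _] = [set w | 4 * rho * Num.sqrt (m * L) <
    `|\sum_(m : J) c (val m).1 (val m).2 * (X m w - (l m)^-1)|]); last first.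
  by apply/funext => w /=; rewrite devE.
apply: (sum_deviation mX indepX l0 lawX rho0 L0 Lm).
  by move=> p; exact: crho.
by rewrite -(pairs_sum (fun i j => (c i j / t i j) ^+ 2)).
Qed.

Lemma dev_chernoff c (s : R) : (forall i j, i != j -> `|c i j / t i j| <= 2^-1) ->
  fine (P [set w | s < `|dev c w|]) <=
  2 * expR (\sum_i \sum_(j | i != j) (c i j / t i j) ^+ 2 - s).
Proof.
move=> c2.
rewrite (_ : [set w | _] = [set w | s <
    `|\sum_(m : J) c (val m).1 (val m).2 * (X m w - (l m)^-1)|]); last first.
  by apply/funext => w /=; rewrite devE.
rewrite (pairs_sum (fun i j => (c i j / t i j) ^+ 2)).
by apply: (chernoff_two_sided mX indepX l0 lawX) => p; exact: c2.
Qed.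

Lemma dev_characteristic_function c (y : R) :
  (forall i j, i != j -> `|c i j / t i j| <= 1) ->
  `|\int[P]_w cos (dev c w + y) -
    expR (- (\sum_i \sum_(j | i != j) (c i j / t i j) ^+ 2) / 2) * cos y| <=
  4 * \sum_i \sum_(j | i != j) `|c i j / t i j| ^+ 3.
Proof.
move=> c1; rewrite (pairs_sum (fun i j => (c i j / t i j) ^+ 2)).
rewrite (pairs_sum (fun i j => `|c i j / t i j| ^+ 3)).
under eq_Rintegral do rewrite addrC devE.
by apply: (characteristic_function_approx mX indepX l0 lawX) => p; exact: c1.
Qed.

(** Existence of a solution requires positive entries, while the exponential law gives them only
    almost surely. *)
Lemma entries_nonpositive_null : fine (P [set w | exists p : 'I_n * 'I_n,
  p.1 != p.2 /\ a p.1 p.2 w <= 0]) = 0.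
Proof.
have mle i j : measurable [set w | a i j w <= 0] by exact: measurable_le_cst.
apply/eqP; rewrite eq_le fine_ge0// andbT -[leRHS](mulr0 #|{: 'I_n * 'I_n}|%:R).
pose A (p : 'I_n * 'I_n) := [set w | p.1 != p.2 /\ a p.1 p.2 w <= 0].
have := @prob_exists_le _ _ _ P _ A 0; apply; rewrite /A.
  move=> p; case: (boolP (p.1 != p.2)) => pp.
    by rewrite (_ : [set w | _] = [set w | a p.1 p.2 w <= 0])//; apply/seteqP; split => w [].
  by rewrite (_ : [set w | _] = set0)//; apply/seteqP; split => w [].
move=> p; case: (boolP (p.1 != p.2)) => pp; last first.
  by rewrite (_ : [set w | _] = set0) ?measure0//; apply/seteqP; split => w [].
rewrite (_ : [set w | _] = a p.1 p.2 @^-1` `]-oo, 0]); last first.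
  by apply/seteqP; split => w /=; rewrite in_itv /=; [case|].
by rewrite lawa// exponential_prob_le0.
Qed.

Lemma measurable_nonpositive_entries :
  measurable [set w | exists p : 'I_n * 'I_n, p.1 != p.2 /\ a p.1 p.2 w <= 0].
Proof.
apply: measurable_exists => p; case: (boolP (p.1 != p.2)) => pp; last first.
  by rewrite (_ : (fun _ => _) = set0)//; apply/seteqP; split => w [].
rewrite (_ : (fun _ => _) = [set w | a p.1 p.2 w <= 0]); first exact: measurable_le_cst.
by apply/seteqP; split => w [].
Qed.

Lemma dev_rows (f : 'I_n -> R) w : dev (fun i _ => f i) w =
  \sum_i f i * \sum_(j | j != i) (a i j w - (t i j)^-1).
Proof.
apply: eq_bigr => i _; rewrite mulr_sumr.
by apply: eq_bigl => j; rewrite eq_sym.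
Qed.

Lemma dev_cols (f : 'I_n -> R) w : dev (fun _ j => f j) w =
  \sum_j f j * \sum_(i | i != j) (a i j w - (t i j)^-1).
Proof.
rewrite /dev (exchange_big_dep xpredT)//=.
by apply: eq_bigr => i _; rewrite mulr_sumr.
Qed.

Lemma dev_rows_cols (f g : 'I_n -> R) w : dev (fun i j => f i + g j) w =
  \sum_i f i * \sum_(j | j != i) (a i j w - (t i j)^-1) +
  \sum_j g j * \sum_(i | i != j) (a i j w - (t i j)^-1).
Proof.
rewrite -dev_rows -dev_cols /dev -big_split/=; apply: eq_bigr => i _.
by rewrite -big_split/=; apply: eq_bigr => j _; rewrite mulrDl.
Qed.

End OffDiagonalSums.

(** * Error of the estimator on a given sample *)

Section MleError.
Variables (R : realType) (N : nat) (al be : nat -> R) (q Q : R).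
Local Notation n := N.+1.
Hypothesis N3 : (3 <= N)%N.
Hypothesis q0 : 0 < q.
Hypothesis qQ : q <= Q.
Hypothesis beN : be N = 0.
Hypothesis tqQ : forall i j, (i < n)%N -> (j < n)%N -> i != j -> q <= al i + be j <= Q.

Let t (i j : 'I_n) := al i + be j.
Let u (i j : 'I_n) := (t i j ^+ 2)^-1.
Let v i := \sum_(j | j != i) u i j.
Let w j := \sum_(i | i != j) u i j.

Lemma mle_error (a : nat -> nat -> R) (hal hbe : nat -> R) (E b : R) :
  let D i := \sum_(j < n | j != i) (a i j - (t i j)^-1) in
  let B j := \sum_(i < n | i != j) (a i j - (t i j)^-1) in
  mle_eq n a hal hbe -> 0 < E ->
  (forall i, `|D i| <= E) -> (forall j, `|B j| <= E) ->
  (forall i, `|\sum_(j | j != i) u i j / v i * (B j / w j)| <= b) ->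
  (forall j, `|\sum_(i | i != j) u i j / w j * (D i / v i)| <= b) ->
  let tau := sup_radius N q Q E in tau <= q / 2 ->
  let eps := 2 * tau ^+ 2 / q in
  forall i : 'I_n, `|hal i - al i + D i / vmat n al be i i + B ord_max / v2n2n n al be|
    <= b + 3 * eps + 4 * (Q / q) ^+ 2 * (b + b + 2 * eps).
Proof.
move=> D B [hbeN pos rowE colE] E0 DE BE PB PD tau tau_small eps l.
have cardI : #|'I_n| = n by rewrite card_ord.
have tqQ' (i j : 'I_n) : i != j -> q <= t i j <= Q by move=> ij; exact: tqQ.
pose de (i : 'I_n) := hal i - al i; pose ga (j : 'I_n) := hbe j - be j.
have tx i j : t i j + (de i + ga j) = hal i + hbe j by rewrite /t /de /ga; ring.
have tx0 i j : i != j -> 0 < t i j + (de i + ga j) by move=> ij; rewrite tx; exact: pos.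
pose g i j := a i j - (hal i + hbe j)^-1.
have ltN (j : 'I_n) : j != ord_max -> (j < N)%N.
  by rewrite -val_eqE /= ltn_neqAle => ->; rewrite -ltnS ltn_ord.
have g_row (i : 'I_n) : \sum_(j < n | j != i) g i j = 0.
  by rewrite /g sumrB; apply/eqP; rewrite subr_eq0; apply/eqP; exact: (rowE i (ltn_ord i)).
(* The equation of the last column is not part of [mle_eq]. It follows because the rows and the
   columns sum up the same off-diagonal entries, and every other column and every row sums to 0. *)
have g_col (j : 'I_n) : \sum_(i < n | i != j) g i j = 0.
  have [->|jN] := eqVneq j ord_max; last first.
    rewrite /g sumrB; apply/eqP; rewrite subr_eq0; apply/eqP; apply: colE.
    exact: ltN.
  have H : \sum_(j < n) \sum_(i < n | i != j) g i j = 0.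
    rewrite (exchange_big_dep xpredT)//= big1// => i _.
    by rewrite -[RHS](g_row i); apply: eq_bigl => k; rewrite eq_sym.
  move: H; rewrite (bigD1 ord_max)//= [X in _ + X]big1 ?addr0// => k kN.
  rewrite /g sumrB; apply/eqP; rewrite subr_eq0; apply/eqP; apply: colE.
  exact: ltN.
have row_eq i : \sum_(j | j != i) ((t i j)^-1 - (t i j + (de i + ga j))^-1) = - D i.
  transitivity (- D i + \sum_(j < n | j != i) g i j); last by rewrite g_row addr0.
  rewrite /D -sumrN -big_split/=.
  by apply: eq_bigr => j _; rewrite tx /g; ring.
have col_eq j : \sum_(i | i != j) ((t i j)^-1 - (t i j + (de i + ga j))^-1) = - B j.
  transitivity (- B j + \sum_(i < n | i != j) g i j); last by rewrite g_col addr0.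
  rewrite /B -sumrN -big_split/=.
  by apply: eq_bigr => i _; rewrite tx /g; ring.
have x_tau := mle_sup_bound cardI N3 q0 qQ tqQ' tx0 row_eq col_eq E0 DE BE tau_small.
have ga_m : ga ord_max = 0 by rewrite /ga /= beN hbeN subr0.
have := mle_expansion cardI N3 q0 qQ tqQ' tau_small x_tau row_eq col_eq ga_m PB PD l.
rewrite (@vmat_alpha R n al be l) v2n2nE//.
Qed.

End MleError.

Lemma sum_offdiag_le (R : realType) (n : nat) (F G : 'I_n -> 'I_n -> R) :
  (forall i j, i != j -> F i j <= G i j) -> (forall i j, 0 <= G i j) ->
  \sum_i \sum_(j | i != j) F i j <= \sum_i \sum_j G i j.
Proof.
move=> FG G0; apply: ler_sum => i _; rewrite big_mkcond; apply: ler_sum => j _.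
by case: ifPn => // ij; exact: FG.
Qed.

Lemma sum_delta_mul (R : realType) (n : nat) (i : 'I_n) (F : 'I_n -> R) :
  \sum_(i' < n) (i' == i)%:R * F i' = F i.
Proof.
rewrite (bigD1 i)//= eqxx mul1r big1 ?addr0// => j /negbTE ->.
by rewrite mul0r.
Qed.

Lemma sum_delta_div (R : realType) (n : nat) (i : 'I_n) (F : 'I_n -> R) (V : R) :
  \sum_(i' < n) (i' == i)%:R / V * F i' = F i / V.
Proof.
under eq_bigr do rewrite mulrAC.
by rewrite -mulr_suml sum_delta_mul.
Qed.

Section GoodEvent.
Context (R : realType) d (T : measurableType d) (P : probability T R).
Variables (N : nat) (al be : nat -> R) (q Q : R).
Local Notation n := N.+1.
Hypothesis N3 : (3 <= N)%N.
Hypothesis q0 : 0 < q.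
Hypothesis qQ : q <= Q.
Hypothesis beN : be N = 0.
Hypothesis tqQ : forall i j, (i < n)%N -> (j < n)%N -> i != j -> q <= al i + be j <= Q.
Variable a : nat -> nat -> T -> R.
Let t (i j : 'I_n) := al i + be j.
Hypothesis ma : forall i j, measurable_fun setT (a i j).
Hypothesis lawa : forall i j : nat, (i < n)%N -> (j < n)%N -> i != j ->
  forall B : set R, measurable B -> P (a i j @^-1` B) = exponential_prob (al i + be j) B.
Hypothesis inda : forall B : 'I_n -> 'I_n -> set R, (forall i j, measurable (B i j)) ->
  fine (P [set w | forall i j : 'I_n, i != j -> B i j (a i j w)])
  = \prod_(i < n) \prod_(j < n | i != j) fine (P (a i j @^-1` B i j)).

Let t0 (i j : 'I_n) : i != j -> 0 < t i j.
Proof. by move=> ij; have /andP[+ _] := tqQ (ltn_ord i) (ltn_ord j) ij; exact: lt_le_trans. Qed.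

Let lawa' (i j : 'I_n) : i != j -> forall B : set R, measurable B ->
  P (a i j @^-1` B) = exponential_prob (t i j) B.
Proof. by move=> ij; exact: lawa. Qed.

Let tqQ' (i j : 'I_n) : i != j -> q <= t i j <= Q.
Proof. by move=> ij; exact: tqQ. Qed.

Let cardI : #|'I_n| = n. Proof. exact: card_ord. Qed.

Let u (i j : 'I_n) := (t i j ^+ 2)^-1.
Let v i := \sum_(j | j != i) u i j.
Let w j := \sum_(i | i != j) u i j.

Let Q0 : 0 < Q. Proof. exact: lt_le_trans qQ. Qed.
Let N0 : 0 < N%:R :> R. Proof. by rewrite ltr0n (leq_trans _ N3). Qed.

Let vb i : N%:R / Q ^+ 2 <= v i <= N%:R / q ^+ 2.
Proof. exact: (v_bounds cardI q0 qQ tqQ'). Qed.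

Let wb j : N%:R / Q ^+ 2 <= w j <= N%:R / q ^+ 2.
Proof. exact: (w_bounds cardI q0 qQ tqQ'). Qed.

(** Upper bound for u / (v w), from u <= q^-2 and v, w >= N / Q^2. It bounds the coefficient of each
    entry in the averages of B_j / w_j and of D_i / v_i. *)
Let K := Q ^+ 4 / (q ^+ 2 * N%:R ^+ 2).

Let lowb_gt0 : 0 < N%:R / Q ^+ 2. Proof. by rewrite divr_gt0// exprn_gt0. Qed.

Let v0 i : 0 < v i.
Proof. by case/andP: (vb i) => + _; exact: lt_le_trans. Qed.
Let w0 j : 0 < w j.
Proof. by case/andP: (wb j) => + _; exact: lt_le_trans. Qed.

Let K0 : 0 < K. Proof. by rewrite divr_gt0 ?mulr_gt0 ?exprn_gt0. Qed.

Let uvw (i j i' j' : 'I_n) : i' != j' -> 0 <= u i' j' / (v i * w j) <= K.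
Proof.
move=> ij'; have u0 : 0 < u i' j' by rewrite invr_gt0 exprn_gt0// t0.
have uq : u i' j' <= (q ^+ 2)^-1.
  have /andP[h1 h2] := tqQ' ij'.
  rewrite /u lef_pV2 ?posrE ?exprn_gt0 ?t0//.
  by rewrite lerXn2r ?nnegrE ?(ltW q0) ?(ltW (t0 ij')).
have vw : N%:R / Q ^+ 2 * (N%:R / Q ^+ 2) <= v i * w j.
  by apply: ler_pM; rewrite ?(ltW lowb_gt0)//; [case/andP: (vb i)|case/andP: (wb j)].
have vw0 : 0 < v i * w j by rewrite mulr_gt0.
rewrite divr_ge0 ?(ltW u0) ?(ltW vw0)//= ler_pdivrMr//.
apply: (le_trans uq).
apply: (le_trans _ (ler_wpM2l (ltW K0) vw)).
rewrite le_eqVlt; apply/orP; left; apply/eqP; rewrite /K; field.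
by rewrite !gt_eqF.
Qed.

Variable L : R.
Hypothesis L0 : 0 < L.
Hypothesis Ln : 4 * L <= n%:R.

Let n1 : 1 <= n%:R :> R. Proof. by rewrite ler1n. Qed.
Let Ln2 : 4 * L <= n%:R ^+ 2. Proof. by apply: (le_trans Ln); rewrite expr2 ler_peMl// (le_trans ler01). Qed.

Let bad c s := [set w | s < `|dev a t c w|].

Let prob_bad_delta (c : 'I_n -> 'I_n -> 'I_n -> R) (i : 'I_n) :
  (forall i' j, 0 <= c i i' j <= 1) ->
  \sum_i' \sum_j c i i' j = n%:R ->
  fine (P (bad (c i) (4 * q^-1 * Num.sqrt (n%:R * L)))) <= 2 * expR (- (3 * L)).
Proof.
move=> c01 cn.
have cq i' j : i' != j -> `|c i i' j / t i' j| <= q^-1.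
  move=> ij; have /andP[c0 c1] := c01 i' j; have /andP[tq _] := tqQ' ij.
  rewrite ger0_norm ?divr_ge0 ?(ltW (t0 ij))// -[leRHS]mul1r.
  by apply: ler_pM; rewrite ?invr_ge0 ?(ltW (t0 ij))// lef_pV2 ?posrE ?t0.
apply: (dev_deviation t0 ma lawa' inda) => //; first by rewrite invr_gt0.
apply: (@le_trans _ _ (\sum_i' \sum_j c i i' j * q^-1 ^+ 2)).
  apply: sum_offdiag_le => i' j; last first.
    by case/andP: (c01 i' j) => c0 _; rewrite mulr_ge0 ?sqr_ge0.
  move=> ij; have /andP[c0 c1] := c01 i' j; have /andP[tq _] := tqQ' ij.
  rewrite exprMn; apply: ler_pM; rewrite ?sqr_ge0//.
    by rewrite expr2 ler_piMl.
  by rewrite ler_sqr ?nnegrE ?invr_ge0 ?(ltW (t0 ij)) ?(ltW q0)// lef_pV2 ?posrE ?t0.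
under eq_bigr do rewrite -mulr_suml.
by rewrite -mulr_suml cn mulrC.
Qed.

(** Up to n^2 entries take part, each with a coefficient of order n^-2. The threshold is therefore
    of order sqrt L / n, smaller than a single D_i / v_i by a factor sqrt n. *)
Let prob_bad_small (c : 'I_n -> 'I_n -> R) :
  (forall i j, 0 <= c i j <= K) ->
  fine (P (bad c (4 * (K / q) * Num.sqrt (n%:R ^+ 2 * L)))) <= 2 * expR (- (3 * L)).
Proof.
move=> cK.
have cq i j : i != j -> `|c i j / t i j| <= K / q.
  move=> ij; have /andP[c0 c1] := cK i j; have /andP[tq _] := tqQ' ij.
  rewrite ger0_norm ?divr_ge0 ?(ltW (t0 ij))//.
  by apply: ler_pM; rewrite ?invr_ge0 ?(ltW (t0 ij))// lef_pV2 ?posrE ?t0.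
apply: (dev_deviation t0 ma lawa' inda) => //; first by rewrite divr_gt0.
apply: (@le_trans _ _ (\sum_(i < n) \sum_(j < n) (K / q) ^+ 2)).
  apply: sum_offdiag_le => i j; last by rewrite sqr_ge0.
  move=> ij; rewrite -[leLHS]real_normK ?num_real//.
  by rewrite 2!expr2; apply: ler_pM; rewrite ?normr_ge0 ?cq.
rewrite !sumr_const card_ord -mulrnA -[leLHS]mulr_natr natrM -expr2.
by rewrite lexx.
Qed.

Variables hal hbe : T -> nat -> R.
Hypothesis mle : forall om, (exists al' be', mle_eq n (fun i j => a i j om) al' be') ->
  mle_eq n (fun i j => a i j om) (hal om) (hbe om).

Lemma mle_linearization :
  let tau := sup_radius N q Q (4 * q^-1 * Num.sqrt (n%:R * L)) in
  let eps := 2 * tau ^+ 2 / q in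
  let b := 4 * (Q ^+ 4 / (q ^+ 2 * N%:R ^+ 2) / q) * Num.sqrt (n%:R ^+ 2 * L) in
  tau <= q / 2 ->
  exists Bad : set T, [/\ measurable Bad, fine (P Bad) <= 8 * n%:R * expR (- (3 * L)) &
    forall om, ~ Bad om -> forall i : 'I_n, `|hal om i - al i +
      dev a t (fun i' j => (i' == i)%:R / vmat n al be i i +
                           (j == ord_max)%:R / v2n2n n al be) om| <=
      b + 3 * eps + 4 * (Q / q) ^+ 2 * (b + b + 2 * eps)].
Proof.
move=> tau eps b tau_small.
pose E := 4 * q^-1 * Num.sqrt (n%:R * L).
have E0 : 0 < E.
  by rewrite /E !mulr_gt0 ?invr_gt0// sqrtr_gt0 mulr_gt0// (lt_le_trans ltr01).
pose cD (i i' j : 'I_n) : R := (i' == i)%:R.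
pose cB (j0 i j : 'I_n) : R := (j == j0)%:R.
pose cA (i i' j : 'I_n) : R := if j != i then u i j / (v i * w j) else 0.
pose cA' (j i j' : 'I_n) : R := if i != j then u i j / (v i * w j) else 0.
(* Four families of n events, for row sums, column sums and the two kinds of averages, each event of
   probability at most 2 exp(- 3 L): this is the constant 8. The fifth event is null. *)
pose F1 := [set om | exists i, bad (cD i) E om].
pose F2 := [set om | exists j, bad (cB j) E om].
pose F3 := [set om | exists i, bad (cA i) b om].
pose F4 := [set om | exists j, bad (cA' j) b om].
pose F5 := [set om | exists p : 'I_n * 'I_n, p.1 != p.2 /\ a p.1 p.2 om <= 0].
have mbad c s : measurable (bad c s).
  by apply: measurable_norm_gt; exact: measurable_dev.
have m1 : measurable F1 by apply: measurable_exists.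
have m2 : measurable F2 by apply: measurable_exists.
have m3 : measurable F3 by apply: measurable_exists.
have m4 : measurable F4 by apply: measurable_exists.
have m5 : measurable F5 by exact: measurable_nonpositive_entries.
have e0 : 0 <= expR (- (3 * L)) by exact: expR_ge0.
have p1 : fine (P F1) <= n%:R * (2 * expR (- (3 * L))).
  rewrite -[in leRHS]cardI; apply: (prob_exists_le (A := fun i => bad (cD i) E)) => // i.
  apply: (prob_bad_delta (c := cD)).
    by move=> i' j; rewrite /cD; case: (_ == _); rewrite ?lexx ?ler01.
  under eq_bigr do rewrite sumr_const card_ord -(mulr_natr _ n).
  by rewrite sum_delta_mul.
have p2 : fine (P F2) <= n%:R * (2 * expR (- (3 * L))).
  rewrite -[in leRHS]cardI; apply: (prob_exists_le (A := fun i => bad (cB i) E)) => // j.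
  apply: (prob_bad_delta (c := cB)).
    by move=> i' j'; rewrite /cB; case: (_ == _); rewrite ?lexx ?ler01.
  rewrite exchange_big/=; under eq_bigr do rewrite sumr_const card_ord -(mulr_natr _ n).
  by rewrite sum_delta_mul.
have p3 : fine (P F3) <= n%:R * (2 * expR (- (3 * L))).
  rewrite -[in leRHS]cardI; apply: (prob_exists_le (A := fun i => bad (cA i) b)) => // i.
  apply: prob_bad_small => i' j; rewrite /cA; case: ifP => ji; last by rewrite lexx ltW.
  by apply: uvw; rewrite eq_sym.
have p4 : fine (P F4) <= n%:R * (2 * expR (- (3 * L))).
  rewrite -[in leRHS]cardI; apply: (prob_exists_le (A := fun i => bad (cA' i) b)) => // j.
  apply: prob_bad_small => i' j'; rewrite /cA'; case: ifP => ji; last by rewrite lexx ltW.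
  exact: uvw.
have p5 : fine (P F5) = 0 by exact: (entries_nonpositive_null ma lawa').
exists (F1 `|` F2 `|` F3 `|` F4 `|` F5); split.
- by repeat apply: measurableU.
- have h1 := prob_setU_le P m1 m2.
  have m12 := measurableU _ _ m1 m2.
  have h2 := prob_setU_le P m12 m3.
  have m123 := measurableU _ _ m12 m3.
  have h3 := prob_setU_le P m123 m4.
  have m1234 := measurableU _ _ m123 m4.
  have h4 := prob_setU_le P m1234 m5.
  rewrite p5 addr0 in h4; apply: (le_trans h4); apply: (le_trans h3).
  apply: (le_trans (lerD (le_trans h2 (lerD (le_trans h1 (lerD p1 p2)) p3)) p4)).
  by rewrite le_eqVlt; apply/orP; left; apply/eqP; ring.
move=> om Bom i; rewrite dev_rows_cols.
have g1 i0 : `|\sum_(j < n | j != i0) (a i0 j om - (t i0 j)^-1)| <= E.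
  rewrite leNgt; apply/negP => H; apply: Bom; do 4 left; exists i0.
  by rewrite /bad/= (dev_rows a t (fun i' => (i' == i0)%:R)) sum_delta_mul.
have g2 j0 : `|\sum_(i < n | i != j0) (a i j0 om - (t i j0)^-1)| <= E.
  rewrite leNgt; apply/negP => H; apply: Bom; do 3 left; right; exists j0.
  by rewrite /bad/= (dev_cols a t (fun j => (j == j0)%:R)) sum_delta_mul.
have g3 i0 : `|\sum_(j | j != i0) u i0 j / v i0 *
    ((\sum_(i < n | i != j) (a i j om - (t i j)^-1)) / w j)| <= b.
  rewrite leNgt; apply/negP => H; apply: Bom; do 2 left; right; exists i0.
  rewrite /bad/= (dev_cols a t (fun j => if j != i0 then u i0 j / (v i0 * w j) else 0)).
  rewrite (_ : \sum_j _ = \sum_(j | j != i0) u i0 j / v i0 *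
    ((\sum_(i < n | i != j) (a i j om - (t i j)^-1)) / w j))//.
  rewrite [RHS]big_mkcond; apply: eq_bigr => j _; case: ifP; rewrite ?mul0r// => _.
  by rewrite invfM; ring.
have g4 j0 : `|\sum_(i | i != j0) u i j0 / w j0 *
    ((\sum_(j < n | j != i) (a i j om - (t i j)^-1)) / v i)| <= b.
  rewrite leNgt; apply/negP => H; apply: Bom; left; right; exists j0.
  rewrite /bad/= (dev_rows a t (fun i => if i != j0 then u i j0 / (v i * w j0) else 0)).
  rewrite (_ : \sum_j _ = \sum_(i | i != j0) u i j0 / w j0 *
    ((\sum_(j < n | j != i) (a i j om - (t i j)^-1)) / v i))//.
  rewrite [RHS]big_mkcond; apply: eq_bigr => j _; case: ifP; rewrite ?mul0r// => _.
  by rewrite invfM; ring.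
have apos (i0 j : nat) : (i0 < n)%N -> (j < n)%N -> i0 != j -> 0 < a i0 j om.
  move=> i0n jn ij; rewrite ltNge; apply/negP => H; apply: Bom; right.
  by exists (Ordinal i0n, Ordinal jn).
have Hm := mle (mle_exists (a := fun i j => a i j om) (leqW N3) apos).
have := mle_error N3 q0 qQ beN tqQ Hm E0 g1 g2 g3 g4 tau_small i.
by rewrite !sum_delta_div addrA.
Qed.

End GoodEvent.

Lemma sum_ord_prefix (R : nmodType) (k n : nat) (F : nat -> R) : (k <= n)%N ->
  (forall i, (k <= i)%N -> F i = 0) -> \sum_(i < n) F i = \sum_(l < k) F l.
Proof.
move=> /subnKC <- F0; rewrite big_split_ord/= [X in _ + X]big1 ?addr0// => i _.
by rewrite F0// leq_addr.
Qed.

(* the coefficients of the centered entries a_ij - 1/t_ij in the linear part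
   of sum_l y_l (alpha^_l - alpha_l) *)
Definition fisher_coef (R : realType) (n : nat) (al be : nat -> R) (k : nat)
    (y : 'I_k -> R) (i j : nat) : R :=
  - \sum_(l < k) y l * ((i == l)%:R / vmat n al be l l + (j == n.-1)%:R / v2n2n n al be).

Section FisherCoef.
Variables (R : realType) (N : nat) (al be : nat -> R) (q Q : R).
Local Notation n := N.+1.
Hypothesis N3 : (3 <= N)%N.
Hypothesis q0 : 0 < q.
Hypothesis qQ : q <= Q.
Hypothesis tqQ : forall i j, (i < n)%N -> (j < n)%N -> i != j -> q <= al i + be j <= Q.
Variables (k : nat) (y : 'I_k -> R) (s : R).
Hypothesis kN : (k <= N)%N.
Local Notation v i := (vmat n al be i i).
Local Notation w := (v2n2n n al be).
Hypothesis quad : \sum_l y l ^+ 2 / v l + (\sum_l y l) ^+ 2 / w = s.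

Let t (i j : 'I_n) := al i + be j.

Let tqQ' (i j : 'I_n) : i != j -> q <= t i j <= Q.
Proof. by move=> ij; exact: tqQ. Qed.

Let cardI : #|'I_n| = n. Proof. exact: card_ord. Qed.
Let Q0 : 0 < Q. Proof. exact: lt_le_trans qQ. Qed.
Let N0 : 0 < N%:R :> R. Proof. by rewrite ltr0n (leq_trans _ N3). Qed.

Lemma fisher_diag_bounds (i : nat) : (i < n)%N -> N%:R / Q ^+ 2 <= v i <= N%:R / q ^+ 2.
Proof.
move=> ilt; rewrite (vmat_alpha al be (Ordinal ilt)).
exact: (v_bounds cardI q0 qQ tqQ' (Ordinal ilt)).
Qed.

Let wE : w = \sum_(i < n | i != ord_max) (t i ord_max ^+ 2)^-1.
Proof. by rewrite v2n2nE. Qed.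

Let w_lower : N%:R / Q ^+ 2 <= w.
Proof. by rewrite wE; case/andP: (w_bounds cardI q0 qQ tqQ' ord_max). Qed.

Let low0 : 0 < N%:R / Q ^+ 2. Proof. by rewrite divr_gt0// exprn_gt0. Qed.
Let w0 : 0 < w. Proof. exact: lt_le_trans w_lower. Qed.
Let v0 i : (i < n)%N -> 0 < v i.
Proof. by move=> /fisher_diag_bounds/andP[+ _]; exact: lt_le_trans. Qed.
Let kv (l : 'I_k) : (l < n)%N. Proof. exact: (leq_trans (ltn_ord l) (leqW kN)). Qed.

(** The coefficients separate into [f], supported on the first k rows, and [g], supported on the
    last column. *)
Let f (i : nat) := - \sum_(l < k) y l * (i == l)%:R / v l.
Let G := - (\sum_l y l) / w.
Let g (j : nat) := (j == N)%:R * G.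

Let coefE i j : fisher_coef n al be y i j = f i + g j.
Proof.
rewrite /fisher_coef /f /g /G/= mulNr mulrN -opprD mulrA mulr_sumr mulr_suml -big_split/=.
by congr (- _); apply: eq_bigr => l _; ring.
Qed.

Let f_lt (l : 'I_k) : f l = - (y l / v l).
Proof.
rewrite /f (bigD1 l)//= eqxx mulr1 big1 ?addr0// => j jl.
by rewrite eq_sym val_eqE (negbTE jl) mulr0 mul0r.
Qed.

Let f_ge i : (k <= i)%N -> f i = 0.
Proof.
move=> ki; rewrite /f big1 ?oppr0// => l _.
by rewrite gtn_eqF ?mulr0 ?mul0r// (leq_trans _ ki).
Qed.

Let quad_le_y l : y l ^+ 2 / v l <= s.
Proof.
rewrite -quad (bigD1 l)//= -addrA lerDl addr_ge0//.
  by apply: sumr_ge0 => j _; rewrite divr_ge0 ?sqr_ge0 ?(ltW (v0 (kv j))).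
by rewrite divr_ge0 ?sqr_ge0 ?(ltW w0).
Qed.

Let quad_le_Y : (\sum_l y l) ^+ 2 / w <= s.
Proof.
rewrite -quad lerDr.
by apply: sumr_ge0 => j _; rewrite divr_ge0 ?sqr_ge0 ?(ltW (v0 (kv j))).
Qed.

Let s0 : 0 <= s. Proof. by apply: le_trans quad_le_Y; rewrite divr_ge0 ?sqr_ge0 ?(ltW w0). Qed.

(** From y^2 / v <= s and v >= N / Q^2 one gets (y / v)^2 <= s Q^2 / N, so no entry dominates: this
    is the negligibility behind the normal limit. *)
Let m := Q * Num.sqrt (s / N%:R).
Let m0 : 0 <= m. Proof. by rewrite mulr_ge0 ?sqrtr_ge0// ltW. Qed.
Let m2 : m ^+ 2 = s * Q ^+ 2 / N%:R.
Proof. by rewrite exprMn sqr_sqrtr ?divr_ge0// ?(ltW N0)//; ring. Qed.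

Let sqr_div_le (x z : R) : N%:R / Q ^+ 2 <= z -> x ^+ 2 / z <= s -> `|x / z| <= m.
Proof.
move=> zlow xz; have z0 := lt_le_trans low0 zlow.
rewrite -ler_sqr ?nnegrE ?normr_ge0// m2 real_normK ?num_real//.
have -> : (x / z) ^+ 2 = x ^+ 2 / z * z^-1 by rewrite exprMn expr2 -!mulrA.
rewrite -[leRHS]mulrA; apply: ler_pM => //.
- by rewrite divr_ge0 ?sqr_ge0 ?(ltW z0).
- by rewrite invr_ge0 ltW.
- by rewrite -[leRHS]invf_div lef_pV2 ?posrE.
Qed.

Let f_le i : `|f i| <= m.
Proof.
have [ki|ik] := leqP k i; first by rewrite f_ge// normr0.
rewrite (f_lt (Ordinal ik)) normrN; apply: sqr_div_le; last exact: quad_le_y.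
by case/andP: (fisher_diag_bounds (kv (Ordinal ik))).
Qed.

Let G_le : `|G| <= m.
Proof. by rewrite /G mulNr normrN; apply: sqr_div_le. Qed.

Let g_le j : `|g j| <= m.
Proof. by rewrite /g; case: eqP => _; rewrite ?mul1r// mul0r normr0. Qed.

Lemma fisher_coef_le (i j : 'I_n) : i != j ->
  `|fisher_coef n al be y i j / t i j| <= 2 * m / q.
Proof.
move=> ij; have /andP[tq _] := tqQ' ij; have t0 := lt_le_trans q0 tq.
rewrite normrM normfV (gtr0_norm t0); apply: ler_pM; rewrite ?invr_ge0 ?(ltW t0)//.
  rewrite coefE (le_trans (ler_normD _ _))// mulr_natl mulr2n; exact: lerD.
by rewrite lef_pV2 ?posrE.
Qed.

(** The squares of [f] and of [g] reproduce the two terms of the quadratic form exactly. The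
    products f g live on the last column in the first k rows, hence on at most k entries, each
    contributing at most m^2 / q^2. *)
Lemma fisher_coef_sqr_sum :
  `|\sum_(i < n) \sum_(j < n | i != j) (fisher_coef n al be y i j / t i j) ^+ 2 - s| <=
  2 * k%:R * s * (Q / q) ^+ 2 / N%:R.
Proof.
pose u (i j : 'I_n) := (t i j ^+ 2)^-1.
have S1 : \sum_(i < n) \sum_(j < n | i != j) f i ^+ 2 * u i j = \sum_l y l ^+ 2 / v l.
  transitivity (\sum_(i < n) f i ^+ 2 * v i).
    apply: eq_bigr => i _; rewrite -mulr_sumr vmat_alpha; congr (_ * _).
    by apply: eq_bigl => j; rewrite eq_sym.
  rewrite (sum_ord_prefix (leqW kN) (F := fun i => f i ^+ 2 * v i)) => [|i ki]; last first.
    by rewrite f_ge// expr0n mul0r.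
  by apply: eq_bigr => l _; rewrite f_lt; field; rewrite gt_eqF// v0.
have S3 : \sum_(i < n) \sum_(j < n | i != j) g j ^+ 2 * u i j = (\sum_l y l) ^+ 2 / w.
  rewrite (exchange_big_dep xpredT)//= (bigD1 ord_max)//= [X in _ + X]big1 ?addr0.
    by rewrite -mulr_sumr -wE /g eqxx mul1r /G; field; rewrite gt_eqF.
  move=> j jN; rewrite big1// => i _; rewrite /g (_ : (_ == N) = false) ?mul0r ?expr0n ?mul0r//.
  by apply/negbTE; rewrite -val_eqE in jN.
have S2 : `|\sum_(i < n) \sum_(j < n | i != j) f i * g j * u i j| <= k%:R * (m ^+ 2 / q ^+ 2).
  apply: le_trans (ler_norm_sum _ _ _) _.
  apply: (@le_trans _ _ (\sum_(i < n) (if (i < k)%N then m ^+ 2 / q ^+ 2 else 0))).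
    apply: ler_sum => i _; case: ltnP => ik; last first.
      by rewrite f_ge// big1 ?normr0// => j _; rewrite !mul0r.
    apply: le_trans (ler_norm_sum _ _ _) _.
    rewrite big_mkcond (bigD1 ord_max)//= [X in _ + X]big1 ?addr0 => [|j jN]; last first.
      case: ifP => // _; rewrite /g (_ : (_ == N) = false) ?mul0r ?mulr0 ?mul0r ?normr0//.
      by apply/negbTE; rewrite -val_eqE in jN.
    case: ifPn => iN; last by rewrite divr_ge0 ?sqr_ge0.
    have /andP[tq _] := tqQ' iN; have t0 := lt_le_trans q0 tq.
    rewrite (normrM (f i * _)) (normrM (f i)); apply: ler_pM; rewrite ?mulr_ge0//.
      by rewrite expr2; apply: ler_pM.
    rewrite ger0_norm ?invr_ge0 ?sqr_ge0// lef_pV2 ?posrE ?exprn_gt0//.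
    by rewrite lerXn2r// nnegrE ltW.
  rewrite (sum_ord_prefix (leqW kN) (F := fun i => if (i < k)%N then m ^+ 2 / q ^+ 2 else 0)).
    rewrite (eq_bigr (fun=> m ^+ 2 / q ^+ 2)) => [|l _]; last by rewrite ltn_ord.
    by rewrite sumr_const card_ord mulr_natl.
  by move=> i; rewrite ltnNge => ->.
have -> : \sum_(i < n) \sum_(j < n | i != j) (fisher_coef n al be y i j / t i j) ^+ 2 - s =
    2 * \sum_(i < n) \sum_(j < n | i != j) f i * g j * u i j.
  rewrite -[in LHS]quad -S1 -S3 mulr_sumr -big_split/= -sumrB; apply: eq_bigr => i _.
  rewrite mulr_sumr -big_split/= -sumrB; apply: eq_bigr => j _.
  by rewrite coefE exprMn exprVn -/(u i j); ring.
rewrite normrM ger0_norm//; apply: (le_trans (ler_wpM2l _ S2)) => //.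
rewrite m2 le_eqVlt; apply/orP; left; apply/eqP; field.
by rewrite !gt_eqF.
Qed.

(** Applied to the rows of S_[k]^{-1/2}, where s = 1, this bounds the entries of that matrix by sqrt
    N / q. *)
Lemma quad_coord_le l : `|y l| <= Num.sqrt (s * N%:R) / q.
Proof.
have /andP[_ vq] := fisher_diag_bounds (kv l).
rewrite -ler_sqr ?nnegrE ?normr_ge0 ?divr_ge0 ?sqrtr_ge0 ?(ltW q0)//.
rewrite real_normK ?num_real// exprMn sqr_sqrtr ?mulr_ge0 ?(ltW N0)//.
rewrite exprVn -mulrA; have := quad_le_y l; rewrite ler_pdivrMr ?v0// => /le_trans; apply.
by apply: ler_wpM2l.
Qed.

End FisherCoef.

(** * Asymptotics *)

Section ErrorBounds.
Variables (R : realType) (N : nat) (q Q L A : R).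
Local Notation n := N.+1.
Hypothesis N3 : (3 <= N)%N.
Hypothesis q0 : 0 < q.
Hypothesis qQ : q <= Q.
Hypothesis L1 : 1 <= L.
(* a variable instead of the literal, which conversion would unfold in unary *)
Hypothesis A768 : A = 768.

Let kap := Q / q.
Let x := kap ^+ 8 * L / n%:R.
Let tau := sup_radius N q Q (4 * q^-1 * Num.sqrt (n%:R * L)).
Let eps := 2 * tau ^+ 2 / q.
Let b := 4 * (Q ^+ 4 / (q ^+ 2 * N%:R ^+ 2) / q) * Num.sqrt (n%:R ^+ 2 * L).

Let kap1 : 1 <= kap. Proof. by rewrite ler_pdivlMr// mul1r. Qed.
Let N0 : 0 < N%:R :> R. Proof. by rewrite ltr0n (leq_trans _ N3). Qed.
Let n0 : 0 < n%:R :> R. Proof. by rewrite ltr0n. Qed.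
Let nN : n%:R <= 2 * N%:R :> R.
Proof. by rewrite -natrM ler_nat mul2n -addnn -addn1 leq_add2l (leq_trans _ N3). Qed.
Let L0 : 0 < L. Proof. exact: lt_le_trans L1. Qed.
Let x0 : 0 <= x.
Proof. by rewrite divr_ge0 ?(ltW n0)// mulr_ge0 ?(ltW L0)// exprn_ge0// (le_trans ler01). Qed.

Let nNN : n%:R / N%:R ^+ 2 <= 4 / n%:R :> R.
Proof.
rewrite ler_pdivrMr ?exprn_gt0// mulrAC ler_pdivlMr//.
have := nN; have := n0; have := N0; move: (n%:R : R) (N%:R : R) => a c; nra.
Qed.

(** The constant is 768 = 3 * 16 * 4 * 4, from the radius 3 [Lam], [Lam], [rho] and the deviation
    bound [E]. The extra 2 comes from n / N^2 <= 4 / n. Squares are compared in order to remove the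
    square root of n L. *)
Lemma sup_radius_sqr_le : tau ^+ 2 <= (2 * A * q) ^+ 2 * x.
Proof.
have -> : tau ^+ 2 = (A * q) ^+ 2 * (kap ^+ 8 * L) * (n%:R / N%:R ^+ 2).
  rewrite /tau /sup_radius; set r := Num.sqrt _.
  have r2 : r ^+ 2 = n%:R * L by rewrite sqr_sqrtr// mulr_ge0 ?(ltW n0) ?(ltW L0).
  transitivity ((A * q) ^+ 2 * kap ^+ 8 * r ^+ 2 / N%:R ^+ 2).
    rewrite A768 /kap; move: r r2 => r _; field.
    by rewrite !gt_eqF.
  by rewrite r2; ring.
apply: (@le_trans _ _ ((A * q) ^+ 2 * (kap ^+ 8 * L) * (4 / n%:R))).
  apply: ler_wpM2l => //.
  by rewrite mulr_ge0 ?sqr_ge0// mulr_ge0 ?(ltW L0)// exprn_ge0// (le_trans ler01).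
rewrite /x le_eqVlt; apply/orP; left; apply/eqP; move: (kap ^+ 8 * L) => c.
by field; rewrite gt_eqF.
Qed.

Lemma sup_radius_small : 4 * (2 * A) ^+ 2 * x <= 1 -> tau <= q / 2.
Proof.
move=> xs; have [t0|/ltW t0] := leP tau 0.
  by apply: (le_trans t0); rewrite divr_ge0// ltW.
rewrite -ler_sqr ?nnegrE ?divr_ge0 ?(ltW q0)//; apply: (le_trans sup_radius_sqr_le).
have : q ^+ 2 * (4 * (2 * A) ^+ 2 * x) <= q ^+ 2 * 1 by rewrite ler_wpM2l// sqr_ge0.
rewrite (exprMn 2 (2 * A)) (exprMn 2 q) exprVn.
move: ((2 * A) ^+ 2 : R) => B; lra.
Qed.

Let b_le : b <= 16 * q * x.
Proof.
have sL : Num.sqrt L <= L.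
  rewrite -ler_sqr ?nnegrE ?sqrtr_ge0 ?(ltW L0)// sqr_sqrtr ?(ltW L0)//.
  by rewrite expr2 ler_peMr// ltW.
have -> : b = 4 * q * kap ^+ 4 * Num.sqrt L * (n%:R / N%:R ^+ 2).
  rewrite /b sqrtrM ?sqr_ge0// sqrtr_sqr ger0_norm ?(ltW n0)//.
  by move: (Num.sqrt L) => r; rewrite /kap; field; rewrite !gt_eqF.
have -> : 16 * q * x = 4 * q * kap ^+ 8 * L * (4 / n%:R) by rewrite /x; ring.
have c0 : 0 <= 4 * q * kap ^+ 4.
  apply: mulr_ge0; last by rewrite exprn_ge0// (le_trans ler01).
  by rewrite mulr_ge0// ltW.
apply: ler_pM => //.
- by apply: mulr_ge0 => //; exact: sqrtr_ge0.
- apply: ler_pM; rewrite ?sqrtr_ge0//.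
  by rewrite ler_wpM2l ?mulr_ge0 ?(ltW q0)// ler_weXn2l.
Qed.

Let eps_le : eps <= 2 * (2 * A) ^+ 2 * q * x.
Proof.
rewrite /eps ler_pdivrMr//; have := sup_radius_sqr_le.
rewrite (exprMn 2 (2 * A)); by move: ((2 * A) ^+ 2 : R) => B; lra.
Qed.

(** In units of q x, b is at most 16 and eps at most 2 (2 A)^2. The total 16 + 6 (2 A)^2 + 4 kap^2
    (32 + 4 (2 A)^2) gives 144 = 16 + 128 and 22 = 6 + 16, the terms without kap^2 being absorbed by
    kap >= 1. *)
Lemma mle_error_le : b + 3 * eps + 4 * (Q / q) ^+ 2 * (b + b + 2 * eps) <=
  (144 + 22 * (2 * A) ^+ 2) * (q * kap ^+ 10 * L / n%:R).
Proof.
have -> : q * kap ^+ 10 * L / n%:R = kap ^+ 2 * (q * x) by rewrite /x; ring.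
have y0 : 0 <= q * x by rewrite mulr_ge0// ltW.
have k2 : 1 <= kap ^+ 2 by rewrite exprn_ege1.
have bl : b <= 16 * (q * x) by rewrite mulrA.
have el : eps <= 2 * ((2 * A) ^+ 2 * (q * x)).
  by apply: (le_trans eps_le); rewrite le_eqVlt; apply/orP; left; apply/eqP; ring.
rewrite -/kap.
have A0 : 0 <= (2 * A) ^+ 2 :> R by rewrite sqr_ge0.
move: y0 k2 A0 bl el; move: (kap ^+ 2) (q * x) ((2 * A) ^+ 2 : R) b eps => K y B b' e y0 K1 A0 bl el.
apply: (@le_trans _ _ (16 * y + 3 * (2 * (B * y)) + 4 * K * (16 * y + 16 * y + 2 * (2 * (B * y))))).
  apply: lerD; first by lra.
  by rewrite ler_wpM2l//; lra.
have : (16 + 6 * B) * y * 1 <= (16 + 6 * B) * y * K.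
  by rewrite ler_wpM2l// mulr_ge0//; lra.
lra.
Qed.

End ErrorBounds.

(** The function x^25 is continuous and vanishes at 0; it removes the exponent 1/25 and turns 1/50
    into a square root. The identities for real powers use n >= 1, where ln n >= 0. *)
Lemma ratio_cvg0 (R : realType) (q Q : nat -> R) :
  (forall n, 0 < q n) -> (forall n, q n <= Q n) ->
  ((fun n : nat => Q n / q n * (ln (n%:R : R) `^ (25^-1)) / ((n%:R : R) `^ (50^-1)))
    @ \oo --> 0) ->
  (fun n : nat => (Q n / q n) ^+ 25 * ln (n%:R : R) / Num.sqrt (n%:R : R)) @ \oo --> 0.
Proof.
move=> q0 qQ h0.
have H : (fun n : nat => (Q n / q n * (ln (n%:R : R) `^ (25^-1)) /
    ((n%:R : R) `^ (50^-1))) ^+ 25) @ \oo --> (0 : R) ^+ 25.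
  apply: (cvg_comp (fun n : nat => Q n / q n * (ln (n%:R : R) `^ (25^-1)) /
    ((n%:R : R) `^ (50^-1))) (fun x : R => x ^+ 25) h0).
  exact: exprn_continuous.
rewrite expr0n /= in H; apply: cvg_trans H; apply: near_eq_cvg; near=> n.
have n1 : 1 <= n%:R :> R by rewrite ler1n; near: n; exists 1%N.
have e1 : (ln (n%:R : R) `^ 25^-1) ^+ 25 = ln (n%:R : R).
  by rewrite -powR_mulrn ?powR_ge0// -powRrM mulVf ?powRr1 ?ln_ge0// pnatr_eq0.
have e2 : ((n%:R : R) `^ 50^-1) ^+ 25 = Num.sqrt (n%:R : R).
  rewrite -powR_mulrn ?powR_ge0// -powRrM (_ : 50^-1 * 25 = 2^-1); last by field.
  by rewrite powR12_sqrt.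
by rewrite expr_div_n (exprMn 25 (Q n / q n)) e1 e2.
Unshelve. all: by end_near. Qed.

Lemma expRN_lipschitz (R : realType) (a b : R) : 0 <= a -> 0 <= b ->
  `|expR (- a) - expR (- b)| <= `|a - b|.
Proof.
wlog ab : a b / a <= b.
  move=> H a0 b0; have [ab|/ltW ba] := leP a b; first exact: H.
  by rewrite distrC (distrC a); exact: H.
move=> a0 _; rewrite (distrC a b) !ger0_norm ?subr_ge0 ?ler_expR ?lerN2//.
have -> : expR (- b) = expR (- a) * expR (a - b) by rewrite -expRD; congr expR; ring.
have h := expR_ge1Dx (a - b).
have ea : expR (- a) <= 1 by rewrite -[leRHS]expR0 ler_expR oppr_le0.
have ea0 := expR_ge0 (- a).
have : expR (- a) * (1 + (a - b)) <= expR (- a) * expR (a - b) by exact: ler_wpM2l.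
have : 0 <= (1 - expR (- a)) * (b - a) by rewrite mulr_ge0 ?subr_ge0.
lra.
Qed.

(** The density is at most 1 / sqrt(2 pi), hence at most 1. *)
Lemma std_normal_cdf_lipschitz (R : realType) (x h : R) : 0 <= h ->
  fine (normal_prob (0 : R) 1 `]-oo, (x + h)]) <= fine (normal_prob (0 : R) 1 `]-oo, x]) + h.
Proof.
move=> h0.
have -> : `]-oo, (x + h)]%classic = `]-oo, x] `|` `]x, (x + h)] :> set R.
  apply/seteqP; split => y /=; rewrite !in_itv/=.
    by case: (leP y x) => xy yh; [left|right; rewrite yh].
  by case=> [yx|/andP[]//]; rewrite (le_trans yx)// lerDl.
have peak : normal_peak (1 : R) <= 1.
  have r1 : 1 <= Num.sqrt (pi *+ 2 : R).
    have p2 := pi_ge2 R; rewrite -[leLHS]sqrtr1; apply: ler_wsqrtr.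
    by rewrite mulr2n; lra.
  by rewrite /normal_peak expr1n mul1r invf_le1// (lt_le_trans ltr01).
have H : (normal_prob (0 : R) 1 `]x, (x + h)%R] <= h%:E)%E.
  apply: (@le_trans _ _ (\int[lebesgue_measure]_(y in `]x, (x + h)%R]) (cst 1%:E y))%E).
    apply: ge0_le_integral => //.
    - by move=> y _; rewrite lee_fin normal_pdf_ge0.
    - apply: measurable_funTS; apply/measurable_EFinP; exact: measurable_normal_pdf.
    - by move=> y _; rewrite lee_fin (le_trans _ peak)// normal_pdf_ub ?oner_neq0.
  rewrite integral_cst//= mul1e lebesgue_measure_itv/= lte_fin.
  by case: ifP => _; rewrite lee_fin // addrAC subrr add0r.
have := prob_setU_le (normal_prob (0 : R) 1) (measurable_itv `]-oo, x]) (measurable_itv `]x, (x + h)]).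
move/le_trans; apply.
by rewrite lerD2l -lee_fin fineK ?fin_num_measure.
Qed.

Section FixedSize.
Context (R : realType) d (T : measurableType d) (P : probability T R).

Lemma dev_sum n (a : nat -> nat -> T -> R) (t : 'I_n -> 'I_n -> R) (k : nat)
    (c : 'I_k -> R) (F : 'I_k -> 'I_n -> 'I_n -> R) om :
  \sum_l c l * dev a t (F l) om = dev a t (fun i j => \sum_l c l * F l i j) om.
Proof.
rewrite /dev; under eq_bigr do rewrite mulr_sumr.
rewrite exchange_big; apply: eq_bigr => i _.
under eq_bigr do rewrite mulr_sumr.
rewrite exchange_big; apply: eq_bigr => j _.
by rewrite mulr_suml; apply: eq_bigr => l _; rewrite mulrA.
Qed.

Lemma fisher_coef_sum n (al be : nat -> R) (k : nat) (c : 'I_k -> R) (Y : 'I_k -> 'I_k -> R) i j :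
  \sum_l c l * fisher_coef n al be (Y l) i j =
  fisher_coef n al be (fun l' => \sum_l c l * Y l l') i j.
Proof.
rewrite /fisher_coef; under eq_bigr do rewrite mulrN mulr_sumr.
rewrite sumrN exchange_big; congr (- _); apply: eq_bigr => l _.
by rewrite mulr_suml; apply: eq_bigr => m _; rewrite mulrA.
Qed.

Lemma dev_fisher n (al be : nat -> R) (a : nat -> nat -> T -> R) (t : 'I_n -> 'I_n -> R)
    (k : nat) (y : 'I_k -> R) om :
  dev a t (fun i j => fisher_coef n al be y i j) om =
  - \sum_l y l * dev a t (fun i j => ((i : nat) == l)%:R / vmat n al be l l +
                                     ((j : nat) == n.-1)%:R / v2n2n n al be) om.
Proof.
rewrite -sumrN (eq_bigr (fun l => (- y l) * dev a t (fun i j => ((i : nat) == l)%:R / vmat n al be l l +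
   ((j : nat) == n.-1)%:R / v2n2n n al be) om)) => [|l _]; last by rewrite mulNr.
rewrite dev_sum; congr (dev a t _ om); apply/funext => i; apply/funext => j.
by rewrite /fisher_coef -sumrN; apply: eq_bigr => l _; rewrite mulNr.
Qed.

Variables (N : nat) (al be : nat -> R) (q Q : R).
Local Notation n := N.+1.
Hypothesis N3 : (3 <= N)%N.
Hypothesis q0 : 0 < q.
Hypothesis qQ : q <= Q.
Hypothesis tqQ : forall i j, (i < n)%N -> (j < n)%N -> i != j -> q <= al i + be j <= Q.
Variable a : nat -> nat -> T -> R.
Let t (i j : 'I_n) := al i + be j.
Hypothesis ma : forall i j, measurable_fun setT (a i j).
Hypothesis lawa : forall i j : nat, (i < n)%N -> (j < n)%N -> i != j ->
  forall B : set R, measurable B -> P (a i j @^-1` B) = exponential_prob (al i + be j) B.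
Hypothesis inda : forall B : 'I_n -> 'I_n -> set R, (forall i j, measurable (B i j)) ->
  fine (P [set w | forall i j : 'I_n, i != j -> B i j (a i j w)])
  = \prod_(i < n) \prod_(j < n | i != j) fine (P (a i j @^-1` B i j)).

Let t0 (i j : 'I_n) : i != j -> 0 < t i j.
Proof. by move=> ij; have /andP[+ _] := tqQ (ltn_ord i) (ltn_ord j) ij; exact: lt_le_trans. Qed.

Let lawa' (i j : 'I_n) : i != j -> forall B : set R, measurable B ->
  P (a i j @^-1` B) = exponential_prob (t i j) B.
Proof. by move=> ij; exact: lawa. Qed.

Variables (k : nat) (y : 'I_k -> R) (s : R).
Hypothesis kN : (k <= N)%N.
Hypothesis quad : \sum_l y l ^+ 2 / vmat n al be l l + (\sum_l y l) ^+ 2 / v2n2n n al be = s.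
Hypothesis s0 : 0 <= s.

Variable z : R.
Hypothesis z_ge : (Q / q) ^+ 2 / N%:R <= 2 * z.

Let c := fun i j : 'I_n => fisher_coef n al be y i j.
Let sig := \sum_(i < n) \sum_(j < n | i != j) (c i j / t i j) ^+ 2.
(** Bound for the largest normalized coefficient, whose square is at most 4 s (Q/q)^2 / N, hence at
    most 8 s z. *)
Let rho := Num.sqrt (8 * s * z).
Let N0 : 0 < N%:R :> R. Proof. by rewrite ltr0n (leq_trans _ N3). Qed.

Let c_le (i j : 'I_n) : i != j -> `|c i j / t i j| <= rho.
Proof.
move=> ij; apply: (le_trans (fisher_coef_le N3 q0 qQ tqQ kN quad ij)).
have Q0 : 0 < Q by exact: lt_le_trans qQ.
have s2 : 0 <= s / N%:R by rewrite divr_ge0// ltW.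
rewrite -[leLHS]ger0_norm; last first.
  by rewrite divr_ge0 ?(ltW q0)// mulr_ge0// mulr_ge0 ?sqrtr_ge0// ltW.
rewrite -sqrtr_sqr ler_wsqrtr//.
have -> : (2 * (Q * Num.sqrt (s / N%:R)) / q) ^+ 2 = 4 * s * ((Q / q) ^+ 2 / N%:R).
  transitivity (4 * (Q / q) ^+ 2 * Num.sqrt (s / N%:R) ^+ 2).
    by move: (Num.sqrt _) => r; field; rewrite gt_eqF.
  by rewrite sqr_sqrtr//; ring.
have -> : 8 * s * z = 4 * s * (2 * z) by ring.
by rewrite ler_wpM2l// mulr_ge0.
Qed.

Let sig_s : `|sig - s| <= 4 * k%:R * s * z.
Proof.
apply: (le_trans (fisher_coef_sqr_sum N3 q0 qQ tqQ kN quad)).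
have -> : 4 * k%:R * s * z = 2 * k%:R * s * (2 * z) by ring.
by rewrite -[leLHS]mulrA ler_wpM2l// !mulr_ge0.
Qed.

Let sig0 : 0 <= sig.
Proof. by apply: sumr_ge0 => i _; apply: sumr_ge0 => j _; exact: sqr_ge0. Qed.

(** Lyapunov's condition: the sum of the cubes is at most [rho] times the sum [sig] of the squares.
    The last term accounts for [sig] differing from s, as exp(- x) is 1-Lipschitz on x >= 0. *)
Lemma fisher_cf_bound (y0 : R) : rho <= 1 ->
  `|\int[P]_om cos (dev a t c om + y0) - expR (- s / 2) * cos y0| <=
  4 * (rho * (s + 4 * k%:R * s * z)) + 4 * k%:R * s * z.
Proof.
move=> rho1.
have cf := dev_characteristic_function t0 ma lawa' inda (c := c) y0
  (fun i j ij => le_trans (c_le ij) rho1).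
rewrite -(subrKA (expR (- sig / 2) * cos y0)); apply: (le_trans (ler_normD _ _)); apply: lerD.
  apply: (le_trans cf); rewrite ler_wpM2l//.
  have sig_le : sig <= s + 4 * k%:R * s * z.
    by move: sig_s; rewrite ler_norml => /andP[_]; lra.
  apply: (le_trans _ (ler_wpM2l (sqrtr_ge0 _) sig_le)).
  rewrite /sig mulr_sumr; apply: ler_sum => i _; rewrite mulr_sumr; apply: ler_sum => j ij.
  rewrite exprS real_normK ?num_real//; apply: ler_wpM2r; first exact: sqr_ge0.
  exact: c_le.
rewrite -mulrBl normrM -[leRHS]mulr1; apply: ler_pM => //; last first.
  by rewrite ler_norml cos_geN1 cos_le1.
rewrite !mulNr; apply: (le_trans (expRN_lipschitz _ _)); rewrite ?divr_ge0//.
apply: le_trans sig_s; rewrite -mulrBl (normrM (sig - s)).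
rewrite -[leRHS]mulr1; apply: ler_pM => //.
by rewrite ger0_norm// invf_le1 ?ler1n ?ltr0n.
Qed.

Lemma fisher_tail (M : R) : rho <= 2^-1 -> 4 * k%:R * s * z <= 1 ->
  fine (P [set om | M < `|dev a t c om|]) <= 2 * expR (s + 1 - M).
Proof.
move=> rho2 z1.
apply: (le_trans (dev_chernoff t0 ma lawa' inda M (fun i j ij => le_trans (c_le ij) rho2))).
rewrite ler_pM2l// ler_expR lerD2r.
by have := le_trans sig_s z1; rewrite ler_norml => /andP[_]; rewrite lerBlDl.
Qed.

End FixedSize.

Section RatioBounds.
Variables (R : realType) (N : nat) (kap L : R).
Local Notation n := N.+1.
Hypothesis N3 : (3 <= N)%N.
Hypothesis kap1 : 1 <= kap.
Hypothesis L1 : 1 <= L.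
Let z := kap ^+ 25 * L / Num.sqrt n%:R.

Let n0 : 0 < n%:R :> R. Proof. by rewrite ltr0n. Qed.
Let r0 : 0 < Num.sqrt n%:R :> R. Proof. by rewrite sqrtr_gt0. Qed.
Let r1 : 1 <= Num.sqrt n%:R :> R.
Proof. by rewrite -[leLHS]sqrtr1 ler_sqrt// ler1n. Qed.
Let rr : Num.sqrt n%:R ^+ 2 = n%:R :> R. Proof. by rewrite sqr_sqrtr// ltW. Qed.
Let nr : (n%:R : R)^-1 <= (Num.sqrt n%:R)^-1.
Proof. by rewrite lef_pV2 ?posrE// -[leRHS]rr expr2 ler_peMr// ltW. Qed.
Let kapL (m : nat) : (m <= 25)%N -> kap ^+ m * L <= kap ^+ 25 * L.
Proof. by move=> m25; rewrite ler_wpM2r ?ler_weXn2l// (le_trans ler01). Qed.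
Let kapL0 (m : nat) : 0 <= kap ^+ m * L.
Proof. by rewrite mulr_ge0 ?exprn_ge0// (le_trans ler01). Qed.

Lemma ratio_le (m : nat) : (m <= 25)%N -> kap ^+ m * L / n%:R <= z.
Proof. by move=> m25; apply: ler_pM; rewrite ?invr_ge0 ?(ltW n0) ?kapL ?kapL0. Qed.

Lemma ratio_sqr_le : kap ^+ 2 / N%:R <= 2 * z.
Proof.
have N0 : 0 < N%:R :> R by rewrite ltr0n (leq_trans _ N3).
have nN : n%:R <= 2 * N%:R :> R.
  by rewrite -natrM ler_nat mul2n -addnn -addn1 leq_add2l (leq_trans _ N3).
have k2 : 0 <= kap ^+ 2 by exact: sqr_ge0.
apply: (@le_trans _ _ (2 * (kap ^+ 2 * L / n%:R))); last by rewrite ler_wpM2l// ratio_le.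
apply: (@le_trans _ _ (kap ^+ 2 * (2 / n%:R))).
  by apply: ler_wpM2l => //; rewrite ler_pdivlMr// mulrC ler_pdivrMr.
rewrite mulrCA ler_wpM2l// ler_wpM2r ?invr_ge0 ?(ltW n0)//.
by rewrite -[leLHS]mulr1 ler_wpM2l.
Qed.

Lemma log_le : 4 * z <= 1 -> 4 * L <= n%:R.
Proof.
move=> z1; have h : L / n%:R <= z by have := @ratio_le 0 isT; rewrite expr0 mul1r.
have : 4 * (L / n%:R) <= 1 by apply: le_trans z1; rewrite ler_wpM2l.
by rewrite mulrA ler_pdivrMr// mul1r.
Qed.

(** The factor sqrt N / q, the size of the standardizing matrix, cancels q and reduces 1/n to 1 /
    sqrt n. The passage from kap^10 to kap^25 is free because kap >= 1. *)
Lemma scaled_error_le (q : R) : 0 < q ->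
  Num.sqrt N%:R / q * (q * kap ^+ 10 * L / n%:R) <= z.
Proof.
move=> q0.
have -> : Num.sqrt N%:R / q * (q * kap ^+ 10 * L / n%:R) =
    kap ^+ 10 * L * (Num.sqrt N%:R / n%:R).
  by move: (Num.sqrt _) => r; field; rewrite (gt_eqF q0) gt_eqF.
apply: ler_pM; [exact: kapL0|by rewrite mulr_ge0 ?sqrtr_ge0 ?invr_ge0 ?(ltW n0)|exact: kapL|].
rewrite -[X in _ / X]rr ler_pdivrMr ?exprn_gt0// expr2 mulrA mulVf ?gt_eqF// mul1r.
by rewrite ler_sqrt ?ler_nat// ltW.
Qed.

End RatioBounds.

(** Each row of [Rm] combines k coordinate errors with weights of size at most sqrt N / q. The
    linear parts combine exactly into one weighted sum of entries, so only the expansion errors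
    remain. *)
Lemma standardized_mle_close (R : realType) d (T : measurableType d) (P : probability T R)
  (N k : nat) (al be : nat -> R) (q Q A : R) (a : nat -> nat -> T -> R)
  (hal hbe : T -> nat -> R) (Rm : 'M[R]_k) :
  let n := N.+1 in
  let t (i j : 'I_n) := al i + be j in
  let L := ln (n%:R : R) in
  let z := (Q / q) ^+ 25 * L / Num.sqrt n%:R in
  (3 <= N)%N -> (k <= N)%N -> 0 < q -> q <= Q -> be N = 0 ->
  (forall i j, (i < n)%N -> (j < n)%N -> i != j -> q <= al i + be j <= Q) ->
  (forall i j, measurable_fun setT (a i j)) ->
  (forall i j : nat, (i < n)%N -> (j < n)%N -> i != j ->
    forall B : set R, measurable B -> P (a i j @^-1` B) = exponential_prob (al i + be j) B) ->
  (forall B : 'I_n -> 'I_n -> set R, (forall i j, measurable (B i j)) ->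
    fine (P [set w | forall i j : 'I_n, i != j -> B i j (a i j w)])
    = \prod_(i < n) \prod_(j < n | i != j) fine (P (a i j @^-1` B i j))) ->
  (forall om, (exists al' be', mle_eq n (fun i j => a i j om) al' be') ->
    mle_eq n (fun i j => a i j om) (hal om) (hbe om)) ->
  (forall l, \sum_l' Rm l l' ^+ 2 / vmat n al be l' l' +
    (\sum_l' Rm l l') ^+ 2 / v2n2n n al be = 1) ->
  1 <= L -> A = 768 -> 4 * z <= 1 -> 4 * (2 * A) ^+ 2 * z <= 1 ->
  exists Bad : set T, [/\ measurable Bad, fine (P Bad) <= 8 * n%:R * expR (- (3 * L)) &
    forall om, ~ Bad om -> forall l : 'I_k,
      `|(Rm *m \col_(l0 < k) (theta_coord n (hal om) (hbe om) l0 -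
                              theta_coord n al be l0)) l ord0 -
        dev a t (fun i j => fisher_coef n al be (fun l' => Rm l l') i j) om| <=
      k%:R * (144 + 22 * (2 * A) ^+ 2) * z].
Proof.
move=> n t L z N3 kN q0 qQ beN tqQ ma lawa inda mle quad L1 AE z1 z2.
have L0 : 0 < L by exact: lt_le_trans L1.
have kap1 : 1 <= Q / q by rewrite ler_pdivlMr// mul1r.
have xz := ratio_le N kap1 L1 (isT : (8 <= 25)%N) : (Q / q) ^+ 8 * L / n%:R <= z.
have A2 : 0 <= 4 * (2 * A) ^+ 2 by rewrite mulr_ge0 ?sqr_ge0.
have tau_small := sup_radius_small N3 q0 qQ L1 AE (le_trans (ler_wpM2l A2 xz) z2).
have [Bad [mBad PBad HBad]] := mle_linearization N3 q0 qQ beN tqQ ma lawa inda L0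
  (log_le kap1 L1 z1) mle tau_small.
exists Bad; split => // om Bom l.
have errz := mle_error_le N3 q0 qQ L1 AE.
have c0 : 0 <= 144 + 22 * (2 * A) ^+ 2 by rewrite addr_ge0// mulr_ge0// sqr_ge0.
move: (HBad om Bom); move: errz.
set err := (X in X <= _ -> _) => errz Herr.
have kn (l' : 'I_k) : (l' < n)%N by exact: (leq_trans (ltn_ord l') (leqW kN)).
have -> : (Rm *m \col_(l0 < k) (theta_coord n (hal om) (hbe om) l0 -
    theta_coord n al be l0)) l ord0 -
    dev a t (fun i j => fisher_coef n al be (fun l' => Rm l l') i j) om =
    \sum_l' Rm l l' * (hal om l' - al l' +
      dev a t (fun i j => ((i : nat) == l')%:R / vmat n al be l' l' +
                          ((j : nat) == n.-1)%:R / v2n2n n al be) om).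
  rewrite dev_fisher opprK mxE -big_split/=; apply: eq_bigr => l' _.
  by rewrite mxE /theta_coord kn -mulrDr.
apply: (le_trans (ler_norm_sum _ _ _)).
apply: (@le_trans _ _ (\sum_(l' < k) (144 + 22 * (2 * A) ^+ 2) * z)); last first.
  rewrite -[leRHS]mulrA; move: (_ * z) => c; rewrite sumr_const card_ord -(mulr_natl c k).
  exact: lexx.
apply: ler_sum => l' _; rewrite normrM.
have yq := quad_coord_le N3 q0 qQ tqQ kN (quad l) l'; rewrite mul1r in yq.
have sq0 : 0 <= Num.sqrt (N%:R : R) / q by rewrite divr_ge0 ?sqrtr_ge0// ltW.
have scz := scaled_error_le N kap1 L1 q0.
apply: (@le_trans _ _ (Num.sqrt N%:R / q * ((144 + 22 * (2 * A) ^+ 2) *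
    (q * (Q / q) ^+ 10 * L / n%:R)))).
  apply: ler_pM => //; apply: le_trans errz.
  exact: (Herr (Ordinal (kn l'))).
by rewrite mulrCA; apply: ler_wpM2l.
Qed.

Lemma dist_le_add (R : realFieldType) (v w x e : R) : `|v - w| <= e -> v <= x -> w <= x + e.
Proof. by rewrite ler_norml => /andP[h1 h2]; lra. Qed.

Lemma dist_le_sub (R : realFieldType) (v w x e : R) : `|v - w| <= e -> w <= x - e -> v <= x.
Proof. by rewrite ler_norml => /andP[h1 h2]; lra. Qed.

Lemma squeeze_dist (R : realFieldType) (p f up lo pu pl b e e1 h : R) :
  f <= up + b -> lo <= f + b -> b <= e1 -> up <= pu + e1 -> pl - e1 <= lo ->
  pu <= p + h -> p <= pl + h -> h + (e1 + e1) = e -> `|p - f| <= e.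
Proof. by move=> *; rewrite ler_norml; apply/andP; split; lra. Qed.

Theorem theorem4 (R : realType) (d : nat -> measure_display)
  (T : forall n, measurableType (d n)) (P : forall n, probability (T n) R)
  (al be : nat -> nat -> R) (q Q : nat -> R)
  (a : forall n, nat -> nat -> T n -> R)
  (hal hbe : forall n, T n -> nat -> R) :
  (forall n, 0 < q n) ->
  (forall n, q n <= Q n) ->
  (forall n, be n n.-1 = 0) ->
  (forall n (i j : nat), (i < n)%N -> (j < n)%N -> i != j ->
     q n <= al n i + be n j <= Q n) ->
  ((fun n : nat => Q n / q n * (ln (n%:R : R) `^ (25^-1))
                   / ((n%:R : R) `^ (50^-1))) @ \oo --> 0) ->
  (* the entries a_{i,j}, i <> j, are independent with the exponential
     densities (al_i + be_j) exp(-(al_i + be_j) x) on [0, oo) *)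
  (forall n i j, measurable_fun setT (a n i j)) ->
  (forall n (i j : nat), (i < n)%N -> (j < n)%N -> i != j ->
     forall B : set R, measurable B ->
       P n (a n i j @^-1` B) = exponential_prob (al n i + be n j) B) ->
  (forall n (B : 'I_n -> 'I_n -> set R), (forall i j, measurable (B i j)) ->
     fine (P n [set w | forall i j : 'I_n, i != j -> B i j (a n i j w)])
     = \prod_(i < n) \prod_(j < n | i != j) fine (P n (a n i j @^-1` B i j))) ->
  (* the MLE: measurable, and solving the likelihood equations whenever
     they have a solution *)
  (forall n i, measurable_fun setT (fun w => hal n w i)) ->
  (forall n j, measurable_fun setT (fun w => hbe n w j)) ->
  (forall n w, (exists al' be', mle_eq n (fun i j => a n i j w) al' be') ->
     mle_eq n (fun i j => a n i j w) (hal n w) (hbe n w)) ->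
  forall k : nat, (0 < k)%N ->
  forall Rm : nat -> 'M[R]_k,
  (* Rm n = S_[k]^{-1/2}: the symmetric positive definite square root of
     the inverse of S_[k] (for all large n) *)
  (\forall n \near \oo,
     [/\ Sblock k n (al n) (be n) \in unitmx, (Rm n)^T = Rm n, posdef (Rm n) &
         Rm n *m Rm n = invmx (Sblock k n (al n) (be n))]) ->
  forall x : 'I_k -> R,
  (fun n : nat =>
     fine (P n [set w | forall l : 'I_k,
       (Rm n *m \col_(l0 < k) (theta_coord n (hal n w) (hbe n w) l0
                              - theta_coord n (al n) (be n) l0)) l ord0 <= x l]))
  @ \oo --> \prod_(l < k) fine (normal_prob 0 1 `]-oo, x l]).
Proof.
move=> q0 qQ be0 tqQ hratio ma lawa inda mhal mhbe mle k k0 Rm HRm x.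
pose t n (i j : 'I_n) := al n i + be n j.
(* [W] is the standardized linear part, for which the limit theorem is proved. The standardized
   estimator [V] is compared with it only at the end. *)
pose W n (l : 'I_k) om :=
  dev (a n) (@t n) (fun i j => fisher_coef n (al n) (be n) (fun l' => Rm n l l') i j) om.
pose z n : R := (Q n / q n) ^+ 25 * ln (n%:R : R) / Num.sqrt (n%:R : R).
have z0 : z @ \oo --> 0 by exact: (ratio_cvg0 q0 qQ hratio).
have zsmall (c e : R) : 0 < e -> \forall n \near \oo, c * z n <= e.
  move=> e0; have cz : (fun n => c * z n) @ \oo --> c * 0.
    by apply: cvgM z0; exact: cvg_cst.
  rewrite mulr0 in cz; move/cvgrPdist_le : cz => /(_ _ e0); apply: filterS => n.
  by rewrite sub0r normrN => /(le_trans (ler_norm _)).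
(* Quantifying over all [u] inside makes one threshold in n serve all linear combinations. *)
pose good n := [/\ (3 < n)%N, (k < n)%N, 1 <= ln (n%:R : R) & forall u : 'I_k -> R,
  \sum_j (\sum_i u i * Rm n i j) ^+ 2 / vmat n (al n) (be n) j j +
  (\sum_j \sum_i u i * Rm n i j) ^+ 2 / v2n2n n (al n) (be n) = \sum_i u i ^+ 2].
have Hgood : \forall n \near \oo, good n.
  near=> n.
  have kn : (k < n)%N by near: n; exists k.+1.
  split => //; first by near: n; exists 4%N.
    have en : expR 1 <= n%:R :> R by near: n; exact: nbhs_infty_ger.
    by rewrite -[leLHS]expRK ler_ln ?posrE ?expR_gt0// (lt_le_trans (expR_gt0 1)).
  move=> u; have [Su Rt _ RR] : [/\ Sblock k n (al n) (be n) \in unitmx,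
    (Rm n)^T = Rm n, posdef (Rm n) & Rm n *m Rm n = invmx (Sblock k n (al n) (be n))].
    by near: n.
  exact: (quad_form u (ltnW kn) Su Rt RR).
have quad_row n : good n -> forall l : 'I_k,
    \sum_j Rm n l j ^+ 2 / vmat n (al n) (be n) j j +
    (\sum_j Rm n l j) ^+ 2 / v2n2n n (al n) (be n) = 1.
  (* The unit vector at [l] selects row [l] of [Rm n], with squared norm 1. *)
  move=> [_ _ _ H] l; have <- : \sum_(i < k) ((i == l)%:R : R) ^+ 2 = 1.
    by under eq_bigr do rewrite expr2; rewrite sum_delta_mul eqxx.
  rewrite -H; congr (_ + _ ^+ 2 / _); apply: eq_bigr => j _; by rewrite sum_delta_mul.
have kap1 n : 1 <= Q n / q n by rewrite ler_pdivlMr// mul1r.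
have mW n l : measurable_fun setT (@W n l) by apply: measurable_dev.
have cf n (u : 'I_k -> R) (s : R) : good n ->
    Num.sqrt (8 * (\sum_i u i ^+ 2) * z n) <= 1 ->
    `|\int[P n]_om cos (\sum_l u l * W n l om + s) -
      expR (- (\sum_i u i ^+ 2) / 2) * cos s| <=
    4 * (Num.sqrt (8 * (\sum_i u i ^+ 2) * z n) *
         ((\sum_i u i ^+ 2) + 4 * k%:R * (\sum_i u i ^+ 2) * z n)) +
    4 * k%:R * (\sum_i u i ^+ 2) * z n.
  case: n => [[]//|N] [n3 kn L1 quad] rho1.
  under eq_Rintegral do rewrite dev_sum.
  rewrite (_ : (fun i j => _) = fun i j : 'I_N.+1 => fisher_coef N.+1 (al N.+1) (be N.+1)
      (fun l' => \sum_l u l * Rm N.+1 l l') i j); last first.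
    by apply/funext => i; apply/funext => j; rewrite fisher_coef_sum.
  have s0 : 0 <= \sum_i u i ^+ 2 by apply: sumr_ge0 => i _; exact: sqr_ge0.
  exact: (fisher_cf_bound n3 (q0 _) (qQ _) (@tqQ _) (ma _) (@lawa _) (@inda _) kn (quad u) s0
    (ratio_sqr_le n3 (kap1 _) L1)).
have tail n l (M : R) : good n -> Num.sqrt (8 * 1 * z n) <= 2^-1 -> 4 * k%:R * 1 * z n <= 1 ->
    fine (P n [set om | M < `|W n l om|]) <= 2 * expR (1 + 1 - M).
  case: n => [[]//|N] gn rho1 z1; have qr := quad_row _ gn l; case: gn => n3 kn L1 _.
  exact: (fisher_tail n3 (q0 _) (qQ _) (@tqQ _) (ma _) (@lawa _) (@inda _) kn qr ler01
    (ratio_sqr_le n3 (kap1 _) L1)).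
have cf_cvg (u : 'I_k -> R) (s : R) :
    (fun n => \int[P n]_om cos (\sum_l u l * W n l om + s)) @ \oo -->
    expR (- (\sum_l u l ^+ 2) / 2) * cos s.
  set S := \sum_l _; apply/cvgrPdist_le => e e0.
  pose B n := 4 * (Num.sqrt (8 * S * z n) * (S + 4 * k%:R * S * z n)) + 4 * k%:R * S * z n.
  have cz c : (fun n => c * z n) @ \oo --> (0 : R).
    by rewrite -[X in _ --> X](mulr0 c); apply: cvgM z0; exact: cvg_cst.
  have B0 : B @ \oo --> 4 * (Num.sqrt 0 * (S + 0)) + 0.
    apply: cvgD; last exact: cz.
    apply: cvgM; first exact: cvg_cst.
    apply: cvgM; last by apply: cvgD; [exact: cvg_cst|exact: cz].
    apply: (cvg_comp (fun n => 8 * S * z n) (@Num.sqrt R)); first exact: cz.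
    exact: sqrt_continuous.
  rewrite sqrtr0 mul0r mulr0 addr0 in B0; move/cvgrPdist_le : B0 => /(_ _ e0) B0.
  near=> n; rewrite distrC; have gn : good n by near: n.
  have zn : 8 * S * z n <= 1 by near: n; exact: zsmall.
  apply: (le_trans (cf n u s gn _)); first by rewrite -[leRHS]sqrtr1; exact: ler_wsqrtr.
  have : `|0 - B n| <= e by near: n.
  by rewrite sub0r normrN => /(le_trans (ler_norm _)).
have tight (e : R) : 0 < e -> exists2 M : R, 0 < M & forall l,
    \forall n \near \oo, fine (P n [set om | M < `|W n l om|]) <= e.
  move=> e0; have e20 : 0 < 2 / e by rewrite divr_gt0.
  (* The tail bound 2 exp(2 - M) becomes 2 exp(- 2 / e), at most e since exp(2 / e) >= 2 / e. *)
  exists (1 + 1 + 2 / e) => [|l]; first by lra.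
  near=> n; have gn : good n by near: n.
  have z1 : 4 * k%:R * 1 * z n <= 1 by near: n; exact: zsmall.
  have z2 : 8 * 1 * z n <= 2^-1 ^+ 2.
    by near: n; apply: zsmall; rewrite exprn_gt0.
  apply: (le_trans (tail n l _ gn _ z1)).
    by have := ler_wsqrtr z2; rewrite sqrtr_sqr ger0_norm.
  rewrite opprD addrA subrr sub0r expRN.
  have h : 2 / e <= expR (2 / e) by apply: le_trans (expR_ge1Dx _); rewrite lerDr.
  have : (expR (2 / e))^-1 <= e / 2 by rewrite -[leRHS]invf_div lef_pV2 ?posrE ?expR_gt0.
  by rewrite ler_pdivlMr// mulrC.
pose V n (l : 'I_k) om := (Rm n *m \col_(l0 < k)
  (theta_coord n (hal n om) (hbe n om) l0 - theta_coord n (al n) (be n) l0)) l ord0.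
have [A AE] : exists A : R, A = 768 by exists 768.
pose C := k%:R * (144 + 22 * (2 * A) ^+ 2).
have close n : good n -> 4 * z n <= 1 -> 4 * (2 * A) ^+ 2 * z n <= 1 ->
    exists Bad : set (T n), [/\ measurable Bad,
      fine (P n Bad) <= 8 * n%:R * expR (- (3 * ln (n%:R : R))) &
      forall om, ~ Bad om -> forall l, `|V n l om - W n l om| <= C * z n].
  case: n => [[]//|N] gn z1 z2; have qr := quad_row _ gn; case: gn => n3 kn L1 _.
  exact: (standardized_mle_close n3 kn (q0 _) (qQ _) (be0 _) (@tqQ _) (ma _) (@lawa _)
    (@inda _) (@mle _) qr L1 AE z1 z2).
have sand := cdf_sandwich mW cf_cvg tight.
have Phi01 y : 0 <= fine (normal_prob (0 : R) 1 `]-oo, y]) <= 1.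
  by rewrite fine_ge0//= -lee_fin fineK ?fin_num_measure// probability_le1.
have Phi_prod (y : 'I_k -> R) (h : R) : 0 <= h ->
    \prod_l fine (normal_prob (0 : R) 1 `]-oo, (y l + h)]) <=
    \prod_l fine (normal_prob (0 : R) 1 `]-oo, y l]) + k%:R * h.
  move=> h0; have -> : k%:R * h = \sum_(l < k) h.
    by rewrite sumr_const card_ord -(mulr_natl h k).
  apply: prod_le_prodD => // l; exact: std_normal_cdf_lipschitz.
have mle_set n (U : 'I_k -> T n -> R) (y : 'I_k -> R) :
    (forall l, measurable_fun setT (U l)) -> measurable [set om | forall l, U l om <= y l].
  move=> mU; rewrite (_ : [set om | _] = \bigcap_(l in [set: 'I_k]) [set om | U l om <= y l]).
    by apply: fin_bigcap_measurable => // l _; exact: measurable_le_cst.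
  by apply/seteqP; split => [om omx l _|om omx l]; [exact: omx|exact: omx].
have mtheta n (l : nat) :
    measurable_fun setT (fun om => theta_coord n (hal n om) (hbe n om) l).
  by rewrite /theta_coord; case: (l < n)%N; [exact: mhal|exact: mhbe].
have mV n l : measurable_fun setT (V n l).
  rewrite (_ : V n l = fun om => \sum_l' Rm n l l' *
    (theta_coord n (hal n om) (hbe n om) l' - theta_coord n (al n) (be n) l')).
    by apply: measurable_sum => l'; apply: measurable_funM => //; exact: measurable_funB.
  by apply/funext => om; rewrite /V mxE; apply: eq_bigr => l' _; rewrite mxE.
apply/cvgrPdist_le => e e0.
(* The arguments are shifted by 2 e1, once for the distance between [V] and [W] and once for the
   sandwich, which costs 2 e1 in each of the k factors. The bad event and the sandwich add e1
   each. *)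
pose e1 := e / (2 * k%:R + 2).
have k2 : 0 < 2 * k%:R + 2 :> R by rewrite ltr_wpDl// mulr_ge0.
have e10 : 0 < e1 by rewrite divr_gt0.
have e1E : k%:R * (e1 + e1) + (e1 + e1) = e by rewrite /e1; field; rewrite gt_eqF.
near=> n.
have gn : good n by near: n.
have z1 : 4 * z n <= 1 by near: n; exact: zsmall.
have z2 : 4 * (2 * A) ^+ 2 * z n <= 1 by near: n; exact: zsmall.
have z3 : C * z n <= e1 by near: n; exact: zsmall.
have [Bad [mBad PBad HBad]] := close n gn z1 z2.
have PBad1 : fine (P n Bad) <= e1.
  have n0 : 0 < n%:R :> R by case: gn => n3 _ _ _; rewrite ltr0n (leq_trans _ n3).
  have n1 : 1 <= n%:R :> R by rewrite ler1n -(ltr0n R).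
  apply: (le_trans PBad); rewrite expRN expRM_natl lnK ?posrE//.
  (* Here exp(- 3 ln n) = n^-3, so the bad event has probability at most 8 / n^2, and n >= 8 / e1 is
     more than enough. *)
  have ne : 8 / e1 <= n%:R by near: n; exact: nbhs_infty_ger.
  have -> : 8 * n%:R * (n%:R ^+ 3)^-1 = 8 / n%:R / n%:R :> R by field; rewrite gt_eqF.
  rewrite ler_pdivrMr// ler_pdivrMr//; move: ne; rewrite ler_pdivrMr// => /le_trans; apply.
  by rewrite mulrC ler_peMr// mulr_ge0// ltW.
have VW om l : ~ Bad om -> `|V n l om - W n l om| <= e1.
  by move=> nB; apply: (le_trans (HBad om nB l)).
have up : fine (P n [set om | forall l, V n l om <= x l]) <=
    fine (P n [set om | forall l, W n l om <= x l + e1]) + fine (P n Bad).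
  have mW1 : measurable [set om | forall l, W n l om <= x l + e1] by exact: mle_set.
  apply: le_trans (prob_setU_le _ mW1 mBad); apply: fine_prob_le.
  - exact: mle_set.
  - exact: measurableU.
  move=> om Vx; have [B|nB] := pselect (Bad om); [by right|left => l].
  exact: (dist_le_add (VW om l nB) (Vx l)).
have lo : fine (P n [set om | forall l, W n l om <= x l - e1]) <=
    fine (P n [set om | forall l, V n l om <= x l]) + fine (P n Bad).
  have mV1 : measurable [set om | forall l, V n l om <= x l] by exact: mle_set.
  apply: le_trans (prob_setU_le _ mV1 mBad); apply: fine_prob_le.
  - exact: mle_set.
  - exact: measurableU.
  move=> om Wx; have [B|nB] := pselect (Bad om); [by right|left => l].
  exact: (dist_le_sub (VW om l nB) (Wx l)).
have /andP[_ s1] : \prod_l fine (normal_prob (0 : R) 1 `]-oo, (x l + e1 - e1)]) - e1 <=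
    fine (P n [set w | forall l, W n l w <= x l + e1]) <=
    \prod_l fine (normal_prob (0 : R) 1 `]-oo, (x l + e1 + e1)]) + e1.
  by near: n; exact: (sand (fun l => x l + e1)).
have /andP[s2 _] : \prod_l fine (normal_prob (0 : R) 1 `]-oo, (x l - e1 - e1)]) - e1 <=
    fine (P n [set w | forall l, W n l w <= x l - e1]) <=
    \prod_l fine (normal_prob (0 : R) 1 `]-oo, (x l - e1 + e1)]) + e1.
  by near: n; exact: (sand (fun l => x l - e1)).
have e11 : 0 <= e1 + e1 by rewrite addr_ge0// ltW.
have p1 : \prod_l fine (normal_prob (0 : R) 1 `]-oo, (x l + e1 + e1)]) <=
    \prod_l fine (normal_prob (0 : R) 1 `]-oo, x l]) + k%:R * (e1 + e1).
  apply: le_trans (Phi_prod x _ e11); rewrite le_eqVlt; apply/orP; left; apply/eqP.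
  by apply: eq_bigr => l _; rewrite addrA.
have p2 : \prod_l fine (normal_prob (0 : R) 1 `]-oo, x l]) <=
    \prod_l fine (normal_prob (0 : R) 1 `]-oo, (x l - e1 - e1)]) + k%:R * (e1 + e1).
  apply: le_trans (Phi_prod (fun l => x l - e1 - e1) _ e11).
  rewrite le_eqVlt; apply/orP; left; apply/eqP; apply: eq_bigr => l _.
  by rewrite (_ : x l - e1 - e1 + (e1 + e1) = x l)//; ring.
exact: (squeeze_dist up lo PBad1 s1 s2 p1 p2 e1E).
Unshelve. all: by end_near. Qed.
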